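(* Let $\eta\in(0,1)$, $\lambda>0$, $p\in(0,1)$, $\mu=\lambda/p$, $\beta=(1-p)/p$, and let $S(t)=\sum_{k=1}^{N_\mu(t)}Y_k^{(\beta)}$, $t\ge 0$, where $N_\mu(\cdot)$ is a Poisson process of intensity $\mu$ and $\{Y_k^{(\beta)}:k\ge 1\}$ are i.i.d. with density $\beta e^{-\beta x}1_{(0,\infty)}(x)$, independent of $N_\mu(\cdot)$. (i) If $\nu\in(0,1)$, let $p_k^{\eta,\nu}(t)=P\big(N_1^{(\eta)}(S(\mathcal{L}^\nu(t)))=k\big)$ for integers $k\ge 0$. Then, for $t>0$, $$\frac{d_C^\nu}{dt^\nu}p_0^{\eta,\nu}(t)=-\frac1\beta\left(\mu+\frac{d_C^\nu}{dt^\nu}\right)p_0^{\eta,\nu}(t),\qquad \frac{d_C^\nu}{dt^\nu}p_k^{\eta,\nu}(t)=-\frac1\beta\left(\mu+\frac{d_C^\nu}{dt^\nu}\right)(1-B)^\eta p_k^{\eta,\nu}(t)\quad\text{for all integers }k\ge 1,$$ with the initial conditions $p_0^{\eta,\nu}(0)=1$ and $p_k^{\eta,\nu}(0)=0$ for all integers $k\ge 1$. (ii) If $\nu\in(1,\infty)$, let $\hat p_k^{\eta,\nu}(t)=P\big(N_1^{(\eta)}(S(\mathcal{A}^{1/\nu}(t)))=k\big)$ for integers $k\ge 0$. Then, for $t>0$, $$\frac{d_{RL}^\nu}{dt^\nu}\hat p_0^{\eta,\nu}(t)=\frac1\beta\left(\mu-\frac{d_{RL}^\nu}{dt^\nu}\right)\hat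 p_0^{\eta,\nu}(t),\qquad \frac{d_{RL}^\nu}{dt^\nu}\hat p_k^{\eta,\nu}(t)=\frac1\beta\left(\mu-\frac{d_{RL}^\nu}{dt^\nu}\right)(1-B)^\eta \hat p_k^{\eta,\nu}(t)\quad\text{for all integers }k\ge 1,$$ with the initial conditions $\hat p_0^{\eta,\nu}(0)=1$ and $\hat p_k^{\eta,\nu}(0)=0$ for all integers $k\ge 1$.
   Context: Fractional derivatives. For $\nu\in(0,1)$, $\frac{d_C^\nu}{dt^\nu}$ is the Caputo derivative $$\frac{d_C^\nu}{dt^\nu}f(t)=\frac{1}{\Gamma(1-\nu)}\int_0^t (t-s)^{-\nu}f'(s)\,ds.$$ For $\nu\in(1,\infty)$, $\frac{d_{RL}^\nu}{dt^\nu}$ is the right-sided Riemann-Liouville derivative on $\mathbb{R}_+$ $$\frac{d_{RL}^\nu}{dt^\nu}f(t)=\frac{1}{\Gamma(m-\nu)}\left(-\frac{d}{dt}\right)^m\int_t^\infty\frac{f(s)}{(s-t)^{\nu-m+1}}\,ds,\qquad m=\lfloor\nu\rfloor+1.$$ In the equations, $\left(\mu\pm\frac{d^\nu}{dt^\nu}\right)g$ means $\mu g\pm\frac{d^\nu}{dt^\nu}g$. Difference operator. $B$ is the backward shift in $k$, $Bf(k)=f(k-1)$, and $$(1-B)^\eta f(k)=\sum_{j=0}^\infty(-1)^j\binom{\eta}{j}f(k-j),\qquad \binom{\eta}{j}=\frac{\eta(\eta-1)\cdots(\eta-j+1)}{j!},\ \binom{\eta}{0}=1,$$ where probability mass functions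 are taken to be $0$ at negative integers (so the sum is finite); it acts on the index $k$. Stable subordinator and inverse. For $\alpha\in(0,1)$, $\mathcal{A}^\alpha(\cdot)$ is the stable subordinator: the L\'evy process started at $0$ with $\mathbb{E}[e^{-\theta\mathcal{A}^\alpha(t)}]=e^{-\theta^\alpha t}$ for $\theta\ge 0$. Its inverse is $\mathcal{L}^\alpha(t)=\inf\{z:\mathcal{A}^\alpha(z)>t\}$. Space-fractional Poisson process. $N_1^{(\eta)}(t)=N_1(\mathcal{A}^{\eta}(t))$, where $N_1(\cdot)$ is a Poisson process of intensity $1$ independent of the stable subordinator $\mathcal{A}^\eta(\cdot)$. The processes $N_1^{(\eta)}(\cdot)$, $S(\cdot)$ and the time change ($\mathcal{L}^\nu(\cdot)$ in (i), $\mathcal{A}^{1/\nu}(\cdot)$ in (ii)) are mutually independent. *)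

(* Defs.v *)
From HB Require Import structures.
From mathcomp Require Import all_boot all_order all_algebra finmap.
From mathcomp Require Import all_classical all_reals all_analysis.

Set Implicit Arguments.
Unset Strict Implicit.
Unset Printing Implicit Defensive.

Import Order.TTheory GRing.Theory Num.Theory.
Import numFieldNormedType.Exports.

Local Open Scope classical_set_scope.
Local Open Scope ring_scope.

Section fractional_calculus.
Context {R : realType}.
Implicit Types (f : R -> R) (nu eta x s t : R).

Local Notation leb := (@lebesgue_measure R).

Definition Gamma x : R :=
  \int[leb]_(s in `]0, +oo[) (s `^ (x - 1) * expR (- s)).

Definition caputo_integrand nu f t : R -> R :=
  fun s => (t - s) `^ (- nu) * derive1 f s.

Definition caputo nu f t : R :=
  (Gamma (1 - nu))^-1 * \int[leb]_(s in `]0, t[) caputo_integrand nu f t s.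

(* [caputo] is total: this says that f' and the integral really exist. *)
Definition caputo_derivable nu f : Prop :=
  (forall t, 0 < t -> derivable f t 1) /\
  (forall t, 0 < t ->
     leb.-integrable `]0, t[ (EFin \o caputo_integrand nu f t)).

(* m = floor(nu) + 1; [Num.truncn] is the floor on nonnegative reals. *)
Definition rl_order nu : nat := (Num.truncn nu).+1.

Definition rl_integrand nu f t : R -> R :=
  fun s => f s / (s - t) `^ (nu - (rl_order nu)%:R + 1).

Definition rl_integral nu f t : R :=
  \int[leb]_(s in `]t, +oo[) rl_integrand nu f t s.

Definition riemann_liouville nu f t : R :=
  (Gamma ((rl_order nu)%:R - nu))^-1 *
  ((-1) ^+ rl_order nu * derive1n (rl_order nu) (rl_integral nu f) t).

(* [riemann_liouville] is total: this says that the integral and its m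
   successive derivatives really exist on the open half-line. *)
Definition riemann_liouville_derivable nu f : Prop :=
  (forall t, 0 < t ->
     leb.-integrable `]t, +oo[ (EFin \o rl_integrand nu f t)) /\
  (forall j t, (j < rl_order nu)%N -> 0 < t ->
     derivable (derive1n j (rl_integral nu f)) t 1).

Definition gbinom eta (j : nat) : R :=
  (\prod_(i < j) (eta - i%:R)) / j`!%:R.

(* (1 - B)^eta for a sequence extended by 0 to the negative integers, which
   truncates the series at j = k. *)
Definition frac_diff eta (f : nat -> R) (k : nat) : R :=
  \sum_(j < k.+1) (-1) ^+ j * gbinom eta j * f (k - j)%N.

End fractional_calculus.

Section processes.
Context d (T : measurableType d) (R : realType) (P : probability T R).

(* The outer measure [P^*] agrees with P on measurable sets and with the
   completion of P on sets that are measurable up to a null set.  The processes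
   below have regular paths only almost surely, so that composing them yields
   random variables that are measurable only up to a null set. *)
Definition Pr (E : set T) : R := fine (P^* E)%mu.

Definition process_sigma (I : Type) (D : set I) d' (E : measurableType d')
    (X : I -> T -> E) : set (set T) :=
  <<s \bigcup_(i in D) preimage_set_system setT (X i) measurable >>.

Definition mutually_independent (I : choiceType) (D : set I)
    (F : I -> set (set T)) : Prop :=
  forall (J : {fset I}) (E : I -> set T), [set` J] `<=` D ->
    (forall i, i \in J -> F i (E i)) ->
    Pr (\bigcap_(i in [set` J]) E i) = \prod_(i <- J) Pr (E i).

Definition independent2 (F G : set (set T)) : Prop :=
  mutually_independent [set: 'I_2] (tnth [tuple F; G]).

Definition independent3 (F G H : set (set T)) : Prop :=
  mutually_independent [set: 'I_3] (tnth [tuple F; G; H]).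

(* Processes are functions [R -> T -> E] of which only the values at
   nonnegative times matter. *)
Definition times : set R := [set t | 0 <= t].

Definition cadlag (x : R -> R) : Prop :=
  (forall t, 0 <= t -> x s @[s --> t^'+] --> x t) /\
  (forall t, 0 < t -> cvg (x s @[s --> t^'-])).

Definition is_levy (X : R -> T -> R) : Prop :=
  [/\ forall t, 0 <= t -> measurable_fun setT (X t),
      {ae P, forall w, X 0 w = 0},
      forall t : nat -> R, 0 <= t 0%N -> nondecreasing_seq t ->
        mutually_independent setT
          (fun i => preimage_set_system setT (X (t i.+1) \- X (t i)) measurable),
      forall (s t : R) (B : set R), 0 <= s -> s <= t -> measurable B ->
        P ((X t \- X s) @^-1` B) = P (X (t - s) @^-1` B)
    & {ae P, forall w, cadlag (X ^~ w)} ].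

Definition is_poisson_process (mu : R) (N : R -> T -> nat) : Prop :=
  is_levy (fun t w => (N t w)%:R) /\
  (forall (t : R) (k : nat), 0 < t ->
     P [set w | N t w = k] = (poisson_pmf (mu * t) k)%:E).

Definition is_stable_subordinator (alpha : R) (A : R -> T -> R) : Prop :=
  [/\ is_levy A,
      {ae P, forall w, forall s t : R, 0 <= s -> s <= t -> A s w <= A t w}
    & forall t theta : R, 0 <= t -> 0 <= theta ->
        ('E_P[fun w => (expR (- (theta * A t w)))%R] =
           (expR (- (theta `^ alpha * t)))%:E)%E ].

Definition inverse_process (A : R -> T -> R) : R -> T -> R :=
  fun t w => inf [set z : R | 0 <= z /\ t < A z w].

Definition time_change (E : Type) (X : R -> T -> E) (tau : R -> T -> R) :
    R -> T -> E :=
  fun t w => X (tau t w) w.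

Definition is_iid_exponential (beta : R) (Y : nat -> {RV P >-> R}) : Prop :=
  mutually_independent [set k | (1 <= k)%N]
    (fun k => preimage_set_system setT (Y k) measurable) /\
  (forall (k : nat) (B : set R), (1 <= k)%N -> measurable B ->
     distribution P (Y k) B = exponential_prob beta B).

Definition compound (N : R -> T -> nat) (Y : nat -> {RV P >-> R}) :
    R -> T -> R :=
  fun t w => \sum_(1 <= k < (N t w).+1) Y k w.

Definition pmf_at (Z : R -> T -> nat) (k : nat) (t : R) : R :=
  Pr [set w | Z t w = k].

End processes.

Arguments times {R}.

(* Main.v *)
(* Put psi(u) = (1 - u)^eta and c(u) = mu psi(u) / (beta + psi(u)).  Conditioning
   successively on the independent time changes gives the generating functions
     E u^N1eta(s) = exp (- s psi(u)),       E u^N1eta(S(s)) = exp (- s c(u)),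
     E u^N1eta(S(A(s))) = exp (- s c(u)^(1/nu)),
     E u^N1eta(S(L(s))) = E exp (- c(u) L(s));
   only one-dimensional laws matter.  By the binomial series (1 - B)^eta
   multiplies generating functions by psi(u), and it fixes the coefficient of
   index 0, so that the equations for k = 0 and k >= 1 have the same form and say
   that (beta + psi) D Q = - mu psi Q in (i) and (beta + psi) D Q = mu psi Q in
   (ii), that is D Q = -+ c Q.

   To avoid differentiating a generating function termwise, one divides by
   beta + psi: beta / (beta + psi) generates the law b of N1eta at an independent
   exponential time, so that multiplication by c(u) is x |-> mu (x - b * x) on
   coefficients.  In this way q (in (i)) and its fractional integral (in (ii)) are
   mu (y - b * y) where y is a tail integral of nonnegative functions, which can
   be differentiated coefficientwise.  In (ii) y is an iterated tail integral of
   q.  In (i) self-similarity gives L(t) ~ t^nu W with W = A(1)^(- nu), and y is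
   the tail integral of nu s^(nu - 1) E[W r_k(s^nu W)] with r the law of
   N1eta(S); its fractional integral is identified through its Laplace transform
   in t, which determines a continuous function. *)
Require Import Defs.
From HB Require Import structures.
From mathcomp Require Import all_boot all_order all_algebra finmap.
From mathcomp Require Import ring lra.
From mathcomp Require Import all_classical all_reals all_analysis.
From mathcomp Require Import measurable_realfun.
Import Order.TTheory GRing.Theory Num.Theory.
Import numFieldNormedType.Exports.
Local Open Scope classical_set_scope.
Local Open Scope ring_scope.

Set Implicit Arguments.
Unset Strict Implicit.
Unset Printing Implicit Defensive.

(** * Generating functions *)

Section generating_functions.
Context {R : realType}.
Implicit Types (a b : nat -> R) (F G : R -> R) (u : R).

(** The coefficients of (1 - B)^eta have both signs, so nothing that must be integrated term by term
    is multiplied by psi: apart from finite combinations taken at the end, series and integrals are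
    exchanged for nonnegative sequences only, by Tonelli. The fractional exponents cancel as
    follows. In (ii), with phi = c^(1/nu), the Riemann-Liouville integral of order m - nu produces
    phi^(nu - m) exp(- phi t) = c phi^(- m) exp(- phi t), and phi^(- m) is the effect of m tail
    integrals. In (i), with v(c, s) = E[W exp(- c s^nu W)], the function nu s^(nu - 1) v(c, s) has
    Laplace transform 1 / (c + th^nu) and the kernel t^(- nu) has Gamma(1 - nu) th^(nu - 1); the
    product is Gamma(1 - nu) times the transform of E exp(- c L(t)). Since paths are regular only
    almost surely, the probabilistic part runs on the completion of P, and independence is used only
    on elementary events: a process in a given state, or a value in an interval. *)

Definition genfun a F : Prop := forall u, 0 < u -> u < 1 ->
  [series a k * u ^+ k]_k @ \oo --> F u.

Definition conv a b (k : nat) : R := \sum_(j < k.+1) a j * b (k - j)%N.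

Lemma genfun_ext a F G : (forall u, 0 < u -> u < 1 -> F u = G u) ->
  genfun a F -> genfun a G.
Proof. by move=> FG aF u u0 u1; rewrite -FG//; exact: aF. Qed.

Lemma genfunD a b F G : genfun a F -> genfun b G ->
  genfun (fun k => a k + b k) (fun u => F u + G u).
Proof.
move=> aF bG u u0 u1.
rewrite (_ : [series _]_k = [series a k * u ^+ k]_k \+ [series b k * u ^+ k]_k).
  by apply: cvgD; [exact: aF|exact: bG].
by apply/funext => n; rewrite /series/= -big_split/=; apply: eq_bigr => i _; rewrite mulrDl.
Qed.

Lemma genfunZ (x : R) a F : genfun a F ->
  genfun (fun k => x * a k) (fun u => x * F u).
Proof.
move=> aF u u0 u1.
rewrite (_ : [series _]_k = (fun n => x * [series a k * u ^+ k]_k n)).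
  by apply: cvgMr; exact: aF.
by apply/funext => n; rewrite /series/= big_distrr/=; apply: eq_bigr => i _; rewrite mulrA.
Qed.

Lemma genfunB a b F G : genfun a F -> genfun b G ->
  genfun (fun k => a k - b k) (fun u => F u - G u).
Proof.
move=> aF bG; have := genfunD aF (@genfunZ (-1) _ _ bG).
by under eq_fun do rewrite mulN1r; under [X in genfun _ X]eq_fun do rewrite mulN1r.
Qed.

Lemma genfun_rescale a F (v : R) : 0 < v -> v < 1 -> genfun a F ->
  genfun (fun k => a k * v ^+ k) (fun u => F (v * u)).
Proof.
move=> v0 v1 aF u u0 u1; under eq_fun do rewrite -mulrA -exprMn.
by apply: aF; rewrite ?mulr_gt0// (lt_trans _ v1)// -[ltRHS]mulr1 ltr_pM2l.
Qed.

Lemma genfun_coef_bounded a F (v : R) : 0 < v -> v < 1 -> genfun a F ->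
  exists2 M : R, 0 <= M & forall k, `|a k * v ^+ k| <= M.
Proof.
move=> v0 v1 aF; have [M [Mreal MP]] := cvg_series_bounded (cvgP _ (aF v v0 v1)).
exists (`|M| + 1); first by rewrite addr_ge0.
by move=> k; apply: (MP (`|M| + 1)) => //; rewrite (le_lt_trans (ler_norm _))// ltrDl.
Qed.

Lemma geometric_partial_le (q : R) n : 0 <= q -> q < 1 ->
  \sum_(0 <= i < n) q ^+ i <= (1 - q)^-1.
Proof.
move=> q0 q1; have q10 : 0 < 1 - q by rewrite subr_gt0.
have -> : \sum_(0 <= i < n) q ^+ i = (1 - q ^+ n) / (1 - q).
  have := @geometric_seriesE R 1 q; rewrite lt_eqF// => /(_ erefl) /(congr1 (fun f => f n)).
  rewrite /series /geometric/= mul1r => <-.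
  by under [RHS]eq_bigr do rewrite mul1r.
by rewrite ler_pdivrMr// mulVf ?gt_eqF// gerDl oppr_le0 exprn_ge0.
Qed.

(** The rest of the series is dominated by M (u + u^2 + ...). The estimate depends on the sequence
    through M alone, hence is uniform over a family with a common bound. *)
Lemma genfun_coef0 a F (M u : R) : (forall k, `|a k| <= M) ->
  genfun a F -> 0 < u -> u < 1 -> `|F u - a 0%N| <= M * (u / (1 - u)).
Proof.
move=> aM aF u0 u1; have M0 : 0 <= M := le_trans (normr_ge0 _) (aM 0%N).
have : (fun n => `|[series a k * u ^+ k]_k n - a 0%N|) @ \oo --> `|F u - a 0%N|.
  by apply: cvg_norm; apply: cvgB; [exact: aF|exact: cvg_cst].
move=> /cvg_lim <- //.
apply: limr_le; last first.
  near=> n; have : (0 < n)%N by near: n; exists 1%N.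
  case: (n) => // i _; rewrite /series/=.
  rewrite big_nat_recl// expr0 mulr1 addrC addKr.
  rewrite (le_trans (ler_norm_sum _ _ _))//.
  apply: (@le_trans _ _ (\sum_(0 <= j < i) M * u * u ^+ j)).
    apply: ler_sum => j _; rewrite normrM [X in _ * X <= _]ger0_norm ?exprn_ge0 ?(ltW u0)// exprS mulrA.
    by rewrite ler_wpM2r ?exprn_ge0 ?(ltW u0)// ler_wpM2r// ltW.
  by rewrite -big_distrr/= mulrA ler_wpM2l ?mulr_ge0 ?(ltW u0)//; apply: geometric_partial_le => //; exact: ltW.
apply: is_cvg_norm; apply: is_cvgB; [exact: cvgP (aF u u0 u1)|exact: is_cvg_cst].
Unshelve. all: by end_near. Qed.

Lemma genfun_shift a F : genfun a F ->
  genfun (fun k => a k.+1) (fun u => (F u - a 0%N) / u).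
Proof.
move=> aF u u0 u1.
have -> : [series a k.+1 * u ^+ k]_k = (fun n => ([series a k * u ^+ k]_k n.+1 - a 0%N) / u).
  apply/funext => n; rewrite /series/= big_nat_recl// expr0 mulr1 [X in X - _]addrC addrK big_distrl/=.
  by apply: eq_bigr => i _; rewrite exprS; field; rewrite gt_eqF.
apply: cvgMl; apply: cvgB; last exact: cvg_cst.
by have := aF u u0 u1; rewrite -(cvg_shiftS).
Qed.

Lemma genfun_coef0_cvg (I : Type) (X : set_system I) {FX : Filter X}
    (a : I -> nat -> R) (F : I -> R -> R) a0 F0 (M : R) :
  (\forall i \near X, (forall k, `|a i k| <= M) /\ genfun (a i) (F i)) ->
  (forall k, `|a0 k| <= M) -> genfun a0 F0 ->
  (forall u, 0 < u -> u < 1 -> F i u @[i --> X] --> F0 u) ->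
  a i 0%N @[i --> X] --> a0 0%N.
Proof.
move=> aF a0M a0F0 FF0.
have M0 : 0 <= M := le_trans (normr_ge0 _) (a0M 0%N).
apply/cvgrPdist_le => /= e e0.
have [u [u0 u1 ue]] : exists u : R, [/\ 0 < u, u < 1 & M * (u / (1 - u)) <= e / 3].
  (* This u satisfies u / (1 - u) = e / (3 (M + 1)); M + 1 replaces M so that M = 0 is covered. *)
  exists (e / (e + 3 * (M + 1))).
  have h : 0 < e + 3 * (M + 1) by lra.
  split; first by rewrite divr_gt0.
    by rewrite ltr_pdivrMr// mul1r; lra.
  have -> : e / (e + 3 * (M + 1)) / (1 - e / (e + 3 * (M + 1))) = e / (3 * (M + 1)).
    by field; repeat (apply/andP; split); rewrite gt_eqF//; lra.
  rewrite mulrA ler_pdivrMr ?mulr_gt0//; last lra.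
  have -> : e / 3 * (3 * (M + 1)) = e * (M + 1) by field.
  nra.
have /cvgrPdist_le/(_ (e / 3)) FF := FF0 u u0 u1.
have e30 : 0 < e / 3 by lra.
near=> i.
have [aiM aiF] : (forall k, `|a i k| <= M) /\ genfun (a i) (F i) by near: i.
have Fi : `|F0 u - F i u| <= e / 3 by near: i; exact: FF.
have h1 := genfun_coef0 a0M a0F0 u0 u1.
have h2 := genfun_coef0 aiM aiF u0 u1.
have -> : a0 0%N - a i 0%N = (F0 u - F i u) - (F0 u - a0 0%N) + (F i u - a i 0%N) by ring.
rewrite (le_trans (ler_normD _ _))//.
rewrite (le_trans (lerD (ler_normB _ _) (lexx _)))//.
lra.
Unshelve. all: by end_near. Qed.

(* Peel the coefficients off one at a time by letting [u] tend to [0]. *)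
Lemma genfun_coef_cvg (I : Type) (X : set_system I) {FX : Filter X}
    (a : I -> nat -> R) (F : I -> R -> R) a0 F0 (M : R) :
  (\forall i \near X, (forall k, `|a i k| <= M) /\ genfun (a i) (F i)) ->
  (forall k, `|a0 k| <= M) -> genfun a0 F0 ->
  (forall u, 0 < u -> u < 1 -> F i u @[i --> X] --> F0 u) ->
  forall k, a i k @[i --> X] --> a0 k.
Proof.
move=> aF a0M a0F0 FF0 k; elim: k a F a0 F0 aF a0M a0F0 FF0 => [|k IH] a F a0 F0 aF a0M a0F0 FF0.
  exact: genfun_coef0_cvg aF a0M a0F0 FF0.
apply: (IH (fun i k => a i k.+1) (fun i u => (F i u - a i 0%N) / u) (fun k => a0 k.+1)
  (fun u => (F0 u - a0 0%N) / u)).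
- by apply: filterS aF => i [aM aF]; split => [j|]; [exact: aM|exact: genfun_shift].
- by move=> j; exact: a0M.
- exact: genfun_shift.
- move=> u u0 u1; apply: cvgMl; apply: cvgB; first exact: FF0.
  exact: genfun_coef0_cvg aF a0M a0F0 FF0.
Qed.

(** The difference generates 0. Rescaling u by 1/2 makes its coefficients bounded, and the
    convergence of coefficients, applied to a constant family, then identifies them with 0. *)
Lemma genfun_inj a b F : genfun a F -> genfun b F -> a =1 b.
Proof.
move=> aF bF k.
have ab0 : genfun (fun k => a k - b k) (fun=> 0).
  by apply: genfun_ext (genfunB aF bF) => u _ _; rewrite subrr.
have v0 : 0 < 2^-1 :> R by [].
have v1 : 2^-1 < 1 :> R by rewrite invf_lt1// ltr1n.
have [M M0 cM] := genfun_coef_bounded v0 v1 ab0.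
have c0 := genfun_rescale v0 v1 ab0.
have z0 : genfun (fun=> 0 : R) (fun=> 0).
  move=> u _ _; rewrite (_ : [series _]_k = cst 0); first exact: cvg_cst.
  by apply/funext => n; rewrite /series/= big1// => i _; rewrite mul0r.
have : (fun=> (a k - b k) * 2^-1 ^+ k) @ \oo --> (0 : R).
  apply: (@genfun_coef_cvg nat \oo _ (fun _ k => (a k - b k) * 2^-1 ^+ k)
    (fun _ => fun=> 0) (fun=> 0) (fun=> 0) M) => //.
  - by apply: nearW => _; split.
  - by move=> _; rewrite normr0.
  - by move=> *; exact: cvg_cst.
move=> /cvg_lim => /(_ (@Rhausdorff R)); rewrite lim_cst// => /eqP.
by rewrite mulf_eq0 expf_eq0 invr_eq0 pnatr_eq0 andbF orbF subr_eq0 => /eqP.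
Qed.

(** Bernoulli's inequality for (1 / q)^n = (1 + (1 / q - 1))^n. *)
Lemma natr_exprn_le (q : R) n : 0 < q -> q < 1 -> n%:R * q ^+ n <= (q^-1 - 1)^-1.
Proof.
move=> q0 q1.
have x0 : 0 < q^-1 - 1 by rewrite subr_gt0 invf_gt1.
have h : n%:R * (q^-1 - 1) <= q^-1 ^+ n.
  have : 1 + n%:R * (q^-1 - 1) <= (1 + (q^-1 - 1)) ^+ n.
    elim: n => [|n IHn]; first by rewrite mul0r addr0 expr0.
    rewrite exprS -nat1r; apply: (@le_trans _ _ ((1 + (q^-1 - 1)) * (1 + n%:R * (q^-1 - 1)))).
      have : 0 <= n%:R * (q^-1 - 1) * (q^-1 - 1) by rewrite !mulr_ge0// ltW.
      lra.
    by rewrite ler_wpM2l// addrC subrK invr_ge0 ltW.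
  by rewrite [X in X ^+ n]addrC subrK; lra.
rewrite -ler_pdivlMr ?exprn_gt0//; rewrite -ler_pdivlMr// in h.
by rewrite -exprVn mulrC.
Qed.

Lemma natr_exprn_cvg0 (q : R) : 0 < q -> q < 1 ->
  (fun n => n%:R * q ^+ n) @ \oo --> (0 : R).
Proof.
(* With q = r^2, one factor r^n absorbs n and the other tends to 0. *)
move=> q0 q1; pose r := Num.sqrt q.
have r0 : 0 < r by rewrite sqrtr_gt0.
have r1 : r < 1 by rewrite -sqrtr1 ltr_sqrt.
have rr : q = r * r by rewrite -expr2 sqr_sqrtr// ltW.
apply: (@squeeze_cvgr _ _ _ _ (cst 0) (fun n => (r^-1 - 1)^-1 * r ^+ n)).
- apply: nearW => n; rewrite mulr_ge0 ?exprn_ge0 ?(ltW q0)//=.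
  by rewrite rr exprMn mulrA ler_wpM2r ?exprn_ge0 ?(ltW r0)// natr_exprn_le.
- exact: cvg_cst.
- by rewrite -(mulr0 ((r^-1 - 1)^-1)); apply: cvgMr; apply: cvg_expr; rewrite gtr0_norm.
Qed.

Lemma conv_expr a b u k : conv a b k * u ^+ k =
  \sum_(j < k.+1) (a j * u ^+ j) * (b (k - j)%N * u ^+ (k - j)).
Proof.
rewrite /conv big_distrl/=; apply: eq_bigr => j _.
by rewrite mulrACA -exprD subnKC// -ltnS.
Qed.

Lemma sum_conv a b n :
  \sum_(0 <= k < n) \sum_(j < k.+1) a j * b (k - j)%N =
  \sum_(0 <= j < n) a j * \sum_(0 <= i < n - j) b i.
Proof.
elim: n => [|n IHn]; first by rewrite !big_nil.
rewrite big_nat_recr//= IHn [in RHS]big_nat_recr//= subSnn big_nat1.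
rewrite big_ord_recr/= subnn addrA; congr (_ + _).
rewrite -(big_mkord xpredT (fun j => a j * b (n - j)%N)) -big_split/=.
by apply: eq_big_nat => j /andP[_ jn]; rewrite subSn ?(ltnW jn)// big_nat_recr//= mulrDr.
Qed.

(** The terms are bounded at some v with u < v < 1, so at u they decay like q^n with q = u / v. In
    the partial sum of the Cauchy product, a_j u^j multiplies a partial sum of length n - j of the
    second series, whose error is O(q^(n - j)); the total error is O(n q^n). *)
Lemma genfun_conv a b F G : genfun a F -> genfun b G ->
  genfun (conv a b) (fun u => F u * G u).
Proof.
move=> aF bG u u0 u1.
have [v uv v1] : exists2 v, u < v & v < 1.
  by exists ((u + 1) / 2); lra.
have v0 : 0 < v by lra.
have [Ma Ma0 aM] := genfun_coef_bounded v0 v1 aF.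
have [Mb Mb0 bM] := genfun_coef_bounded v0 v1 bG.
pose q := u / v.
have q0 : 0 < q by rewrite divr_gt0.
have q1 : q < 1 by rewrite ltr_pdivrMr// mul1r.
have bd (c : nat -> R) (M : R) k : `|c k * v ^+ k| <= M -> `|c k * u ^+ k : R| <= M * q ^+ k.
  move=> h; have -> : c k * u ^+ k = (c k * v ^+ k) * q ^+ k.
    by rewrite /q exprMn exprVn mulrCA -!mulrA mulfV ?mulr1 ?expf_neq0 ?gt_eqF// mulrC.
  by rewrite normrM [X in _ * X <= _]ger0_norm ?exprn_ge0 ?(ltW q0)// ler_wpM2r// exprn_ge0 ?(ltW q0).
pose A := [series a k * u ^+ k]_k; pose B := [series b k * u ^+ k]_k.
have tail m : `|B m - G u| <= Mb / (1 - q) * q ^+ m.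
  have : (fun n => `|B m - B n|) @ \oo --> `|B m - G u|.
    by apply: cvg_norm; apply: cvgB; [exact: cvg_cst|exact: bG].
  move=> /cvg_lim <- //; apply: limr_le.
    by apply: is_cvg_norm; apply: is_cvgB; [exact: is_cvg_cst|exact: cvgP (bG u u0 u1)].
  near=> n; have mn : (m <= n)%N by near: n; exists m.
  rewrite distrC /B sub_series_geq//.
  rewrite (le_trans (ler_norm_sum _ _ _))//.
  apply: (@le_trans _ _ (\sum_(m <= i < n) Mb * q ^+ i)).
    by apply: ler_sum => i _; exact: bd.
  rewrite -big_distrr/= -mulrA ler_wpM2l//.
  rewrite -{1}[m]add0n big_addn; under eq_bigr do rewrite addnC exprD.
  by rewrite -big_distrr/= mulrC ler_wpM2r ?exprn_ge0 ?(ltW q0)// geometric_partial_le// ltW.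
have -> : [series conv a b k * u ^+ k]_k =
    (fun n => A n * G u + \sum_(0 <= j < n) (a j * u ^+ j) * (B (n - j)%N - G u)).
  apply/funext => n; rewrite /series/=; under eq_bigr do rewrite conv_expr.
  rewrite (sum_conv (fun j => a j * u ^+ j) (fun j => b j * u ^+ j)).
  rewrite /A /series/= big_distrl/= -big_split/=; apply: eq_bigr => j _.
  by rewrite -mulrDr addrC subrK.
rewrite -[F u * G u]addr0; apply: cvgD; first by apply: cvgMl; exact: aF.
apply/norm_cvg0P.
apply: (@squeeze_cvgr _ _ _ _ (cst 0) (fun n => Ma * (Mb / (1 - q)) * (n%:R * q ^+ n))).
- apply: nearW => n; rewrite normr_ge0/= (le_trans (ler_norm_sum _ _ _))//.
  apply: (@le_trans _ _ (\sum_(0 <= j < n) Ma * (Mb / (1 - q)) * q ^+ n)).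
    apply: ler_sum_nat => j /andP[_ jn]; rewrite normrM.
    apply: (@le_trans _ _ ((Ma * q ^+ j) * (Mb / (1 - q) * q ^+ (n - j)))).
      by apply: ler_pM => //; exact: bd.
    by rewrite mulrACA -exprD subnKC// ltnW.
  by rewrite sumr_const_nat subn0 -[leLHS]mulr_natl mulrCA.
- exact: cvg_cst.
- by rewrite -(mulr0 (Ma * (Mb / (1 - q)))); apply: cvgMr; exact: natr_exprn_cvg0.
Unshelve. all: by end_near. Qed.

End generating_functions.

Lemma nneseries_cvgP {R : realType} (a : nat -> R) (l : R) : (forall k, 0 <= a k) ->
  series a @ \oo --> l <-> (\sum_(k <oo) (a k)%:E = l%:E)%E.
Proof.
move=> a0; have aE : (fun n => \sum_(0 <= k < n) (a k)%:E)%E = EFin \o series a.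
  by apply/funext => n /=; rewrite /series/= sumEFin.
split => [al|al].
  by apply/cvg_lim => //; rewrite aE; apply: cvg_EFin => //; exact: nearW.
have : (fun n => \sum_(0 <= k < n) (a k)%:E)%E @ \oo --> l%:E.
  by rewrite -al; apply: is_cvg_nneseries => n _ _; rewrite lee_fin.
by rewrite aE => /fine_cvg.
Qed.

Section generating_function_integral.
Context d (T : measurableType d) (R : realType).
Variables (m : {measure set T -> \bar R}) (D : set T) (mD : measurable D).

(* Tonelli for nonnegative series. *)
Lemma genfun_integral (f : nat -> T -> R) (F : R -> T -> R) :
  (forall k, measurable_fun D (f k)) -> (forall k x, D x -> 0 <= f k x) ->
  (forall x, D x -> genfun (f ^~ x) (F ^~ x)) ->
  (forall u : R, 0 < u -> u < 1 -> (\int[m]_(x in D) (F u x)%:E < +oo)%E) ->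
  (forall k, m.-integrable D (EFin \o f k)) /\
  genfun (fun k => \int[m]_(x in D) f k x) (fun u => \int[m]_(x in D) F u x).
Proof.
move=> mf f0 fF Foo.
have fu0 (u : R) k x : 0 < u -> D x -> 0 <= f k x * u ^+ k.
  by move=> u0 Dx; rewrite mulr_ge0 ?f0// exprn_ge0 ?ltW.
have intE (u : R) : 0 < u -> u < 1 -> (\int[m]_(x in D) (F u x)%:E =
    \sum_(k <oo) \int[m]_(x in D) (f k x * u ^+ k)%:E)%E.
  move=> u0 u1; rewrite -integral_nneseries//.
  - apply: eq_integral => x /set_mem Dx; apply/esym/nneseries_cvgP; last exact: fF.
    by move=> k; exact: fu0.
  - by move=> k; apply/measurable_EFinP; apply: measurable_funM.
  - by move=> k x Dx; rewrite lee_fin fu0.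
have intZ (u : R) k : 0 < u -> (\int[m]_(x in D) (f k x * u ^+ k)%:E =
    (u ^+ k)%:E * \int[m]_(x in D) (f k x)%:E)%E.
  move=> u0; rewrite -ge0_integralZl//.
  - by apply: eq_integral => x _; rewrite -EFinM mulrC.
  - exact/measurable_EFinP.
  - by move=> x Dx; rewrite lee_fin f0.
  - by rewrite lee_fin exprn_ge0 ?ltW.
have int_ge0 k : (0 <= \int[m]_(x in D) (f k x)%:E)%E.
  by apply: integral_ge0 => x Dx; rewrite lee_fin f0.
have foo k : (\int[m]_(x in D) (f k x)%:E < +oo)%E.
  have h0 : 0 < 2^-1 :> R by [].
  have h1 : 2^-1 < 1 :> R by rewrite invf_lt1// ltr1n.
  have : ((2^-1 ^+ k)%:E * \int[m]_(x in D) (f k x)%:E < +oo)%E.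
    apply: le_lt_trans (Foo _ h0 h1); rewrite intE// -intZ//.
    apply: (le_trans _ (nneseries_lim_ge k.+1 _)); last first.
      by move=> i _ _; apply: integral_ge0 => x Dx; rewrite lee_fin fu0.
    rewrite big_nat_recr//= leeDr// sume_ge0// => i _.
    by apply: integral_ge0 => x Dx; rewrite lee_fin fu0.
  have := int_ge0 k; case: (\int[m]_(x in D) _)%E => // [r _ _|_]; first by rewrite ltry.
  by rewrite gt0_muley// lte_fin exprn_gt0.
split=> [k|].
  apply/integrableP; split; first exact/measurable_EFinP.
  under eq_integral => x /set_mem Dx do rewrite /= ger0_norm ?f0//.
  exact: foo.
have ffin k : (\int[m]_(x in D) (f k x)%:E \is a fin_num)%E.
  by rewrite ge0_fin_numE.
move=> u u0 u1; apply/nneseries_cvgP.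
  by move=> k; rewrite mulr_ge0 ?exprn_ge0 ?(ltW u0)//; apply: fine_ge0.
rewrite /Rintegral fineK.
  by rewrite intE//; apply: eq_eseriesr => k _; rewrite intZ// EFinM fineK// muleC.
rewrite ge0_fin_numE; first exact: Foo.
apply: integral_ge0 => x Dx; rewrite lee_fin.
have /cvg_lim <- // := fF x Dx u u0 u1.
apply: limr_ge; first exact: cvgP (fF x Dx u u0 u1).
by apply: nearW => n; rewrite /series/= sumr_ge0// => i _; rewrite fu0.
Qed.

End generating_function_integral.

Lemma gt0_powRD (R : realType) (x a b : R) : 0 < x -> x `^ (a + b) = x `^ a * x `^ b.
Proof. by move=> x0; rewrite powRD// (gt_eqF x0) implybT. Qed.

Lemma gt0_mulr_powRB1 (R : realType) (x a : R) : 0 < x -> x * x `^ (a - 1) = x `^ a.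
Proof. by move=> x0; rewrite -{1}(powRr1 (ltW x0)) -gt0_powRD// addrC subrK. Qed.

(** * The binomial series of (1 - u)^eta on (0, 1) *)

Section binomial_series.
Context {R : realType}.
Variable eta : R.
Hypotheses (eta0 : 0 < eta) (eta1 : eta < 1).

Let g (j : nat) : R := (-1) ^+ j * gbinom eta j.

(** This recursion yields both the bound of the coefficients by 1 and the differential equation of
    the series. *)
Lemma gbinomS j : j.+1%:R * ((-1) ^+ j.+1 * gbinom eta j.+1) =
  (j%:R - eta) * ((-1) ^+ j * gbinom eta j).
Proof.
rewrite /gbinom big_ord_recr/= factS natrM exprS.
have h1 : j.+1%:R != 0 :> R by rewrite pnatr_eq0.
have h2 : j`!%:R != 0 :> R by rewrite pnatr_eq0 -lt0n fact_gt0.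
move: (j.+1%:R : R) (j`!%:R : R) (j%:R : R) ((-1) ^+ j : R) h1 h2 => x y z s h1 h2.
by field; rewrite h1 h2.
Qed.

Let g_le1 j : `|g j| <= 1.
Proof.
elim: j => [|j IH]; first by rewrite /g /gbinom big_ord0 fact0 expr0 !mul1r invr1 normr1.
rewrite -(@ler_pM2l _ j.+1%:R)// mulr1 -[X in X * _]gtr0_norm// -normrM /g gbinomS normrM.
apply: (@le_trans _ _ (`|j%:R - eta| * 1)); first by rewrite ler_wpM2l.
have h : 0 <= j%:R :> R by [].
by rewrite mulr1 ler_norml -natr1; move: (j%:R : R) h eta0 eta1 => x h e0 e1; apply/andP; split; lra.
Qed.

Lemma bounded_pseries_cvg (c : nat -> R) (M K : R) : (forall j, `|c j| <= M) -> 0 <= K -> K < 1 ->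
  cvgn (pseries c K).
Proof.
move=> cM K0 K1; have M0 : 0 <= M := le_trans (normr_ge0 _) (cM 0%N).
apply: normed_cvg; apply: (@series_le_cvg _ _ (fun j => M * K ^+ j)).
- by move=> n; exact: normr_ge0.
- by move=> n; rewrite mulr_ge0 ?exprn_ge0.
- by move=> n /=; rewrite normrM (ger0_norm (exprn_ge0 _ K0)) ler_wpM2r ?exprn_ge0.
- by apply: is_cvg_geometric_series; rewrite ger0_norm.
Qed.

(** Take K < v < w < 1: the terms are bounded at w, the index brought down by differentiation is
    absorbed by (v / w)^j, and the geometric ratio K / v remains for convergence. *)
Lemma pseries_diffs_cvg (c : nat -> R) :
  (forall K, 0 <= K -> K < 1 -> cvgn (pseries c K)) ->
  forall K, 0 <= K -> K < 1 -> cvgn (pseries (pseries_diffs c) K).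
Proof.
move=> cc K K0 K1.
have [v Kv v1] : exists2 v, K < v & v < 1 by exists ((K + 1) / 2); lra.
have v0 : 0 < v by lra.
have [w vw w1] : exists2 w, v < w & w < 1 by exists ((v + 1) / 2); lra.
have w0 : 0 < w by lra.
have [M [Mr MP]] := cvg_series_bounded (cc w (ltW w0) w1).
have cM j : `|c j * w ^+ j| <= `|M| + 1.
  by apply: (MP (`|M| + 1)) => //; rewrite (le_lt_trans (ler_norm _))// ltrDl.
pose q := v / w.
have q0 : 0 < q by rewrite divr_gt0.
have q1 : q < 1 by rewrite ltr_pdivrMr// mul1r.
have bd j : `|pseries_diffs c j * v ^+ j| <= (`|M| + 1) * (q^-1 - 1)^-1 / v.
  have -> : pseries_diffs c j * v ^+ j = (c j.+1 * w ^+ j.+1) * (j.+1%:R * q ^+ j.+1) / v.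
    rewrite /pseries_diffs /q exprMn exprVn [v ^+ j.+1]exprS.
    by field; rewrite expf_neq0 ?gt_eqF.
  rewrite normrM [X in _ * X]ger0_norm ?invr_ge0 ?(ltW v0)// ler_wpM2r ?invr_ge0 ?(ltW v0)//.
  rewrite normrM ler_pM// ger0_norm ?mulr_ge0 ?exprn_ge0 ?(ltW q0)//.
  exact: natr_exprn_le.
have := @bounded_pseries_cvg (fun j => pseries_diffs c j * v ^+ j) _ (K / v) bd.
rewrite divr_ge0 ?(ltW v0)// ltr_pdivrMr// mul1r => /(_ erefl Kv).
rewrite (_ : pseries _ _ = pseries (pseries_diffs c) K)//.
rewrite /pseries; congr series; apply/funext => j /=.
by rewrite exprMn exprVn; field; rewrite expf_neq0 ?gt_eqF.
Qed.

(** The sum f satisfies (1 - x) f' = - eta f and f(0) = 1, so f(x) (1 - x)^(- eta) has zero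
    derivative and keeps its value 1. *)
Lemma genfun_binomial : genfun g (fun u => (1 - u) `^ eta).
Proof.
have c0 (K : R) : 0 <= K -> K < 1 -> cvgn (pseries g K) by move=> *; exact: (bounded_pseries_cvg g_le1).
have c1 := pseries_diffs_cvg c0.
have c2 := pseries_diffs_cvg c1.
pose f (x : R) : R := limn (pseries g x); pose f' (x : R) : R := limn (pseries (pseries_diffs g) x).
have df (x : R) : 0 <= x -> x < 1 -> is_derive x 1 f (f' x).
  move=> x0 x1.
  have [v xv v1] : exists2 v, x < v & v < 1 by exists ((x + 1) / 2); lra.
  have v0 : 0 < v by lra.
  apply: (@pseries_snd_diffs _ _ v); [exact/c0/v1/ltW|exact/c1/v1/ltW|exact/c2/v1/ltW|].
  by rewrite !ger0_norm// ltW.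
have ode (x : R) : 0 <= x -> x < 1 -> (1 - x) * f' x = - eta * f x.
  move=> x0 x1.
  have h1 := c1 x x0 x1.
  have h2 := pseries_diffs_equiv h1.
  have h3 : (fun n => pseries (pseries_diffs g) x n -
      x * series (fun i => i%:R * g i * x ^+ i.-1) n) @ \oo --> f' x - x * f' x.
    by apply: cvgB => //; apply: cvgMr.
  have h4 : (fun n => - eta * pseries g x n) @ \oo --> - eta * f x.
    by apply: cvgMr; exact: c0.
  rewrite mulrBl mul1r.
  suff E : (fun n => pseries (pseries_diffs g) x n -
      x * series (fun i => i%:R * g i * x ^+ i.-1) n) = (fun n => - eta * pseries g x n).
    by rewrite E in h3; exact: (cvg_unique _ h3 h4).
  apply/funext => n; rewrite /pseries /series/= !big_distrr/= -sumrB.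
  apply: eq_bigr => i _; rewrite /pseries_diffs /g gbinomS.
  by case: i => [|i]/=; rewrite ?expr0 ?exprS; ring.
have f0 : f 0 = 1.
  apply/cvg_lim => //; rewrite -(cvg_shiftS _).
  rewrite (_ : (fun n => _) = cst 1); first exact: cvg_cst.
  apply/funext => n; rewrite /pseries /series/= big_nat_recl// expr0 mulr1.
  rewrite big1 ?addr0; last by move=> i _; rewrite exprS mul0r mulr0.
  by rewrite /g /gbinom big_ord0 fact0 expr0 !mul1r invr1.
pose h (x : R) := f x * (1 - x) `^ (- eta).
have dh (x : R) : 0 <= x -> x < 1 -> is_derive x 1 h 0.
  move=> x0 x1.
  have p1 : 0 < 1 - x by lra.
  have d1 := df x x0 x1.
  have d2 : is_derive x 1 (fun x => (1 - x) `^ (- eta)) ((-1) * (- eta * (1 - x) `^ (- eta - 1))).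
    have d3 : is_derive x 1 (fun x : R => 1 - x) (-1) by rewrite -[-1]sub0r; exact: is_deriveB.
    have d4 := is_derive1_powR (- eta) p1.
    have := is_derive1_comp (f := @powR R ^~ (- eta)) (g := fun x => 1 - x) d4 d3.
    by rewrite mulrC.
  apply: (is_derive_eq (is_deriveM d1 d2)).
  rewrite /GRing.scale/=.
  rewrite -(gt0_mulr_powRB1 (- eta) p1).
  rewrite mulrAC; have := ode x x0 x1.
  move: ((1 - x) `^ (- eta - 1)) => y.
  by move=> ->; ring.
move=> u u0 u1.
have [||c _] := @MVT_segment _ h (fun=> 0) 0 u (ltW u0).
- by move=> x; rewrite in_itv/= => /andP[x0 xu]; apply: dh; rewrite ?ltW// (lt_trans xu).
- apply: derivable_within_continuous => x; rewrite in_itv/= => /andP[x0 xu].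
  by have [] := dh x x0 (le_lt_trans xu u1).
rewrite mul0r /h f0 subr0 powR1 mulr1 => /eqP; rewrite subr_eq add0r => /eqP hu.
have -> : (1 - u) `^ eta = f u.
  apply: (@mulIf _ ((1 - u) `^ (- eta))); first by rewrite gt_eqF// powR_gt0// subr_gt0.
  by rewrite hu -gt0_powRD ?subrr ?powRr0// subr_gt0.
by apply: c0 => //; exact: ltW.
Qed.

End binomial_series.

(** * Integrals on the half-line *)

Lemma near_eq_continuous (R : realType) (f g : R -> R) (x : R) :
  (\forall y \near x, f y = g y) -> {for x, continuous f} -> {for x, continuous g}.
Proof.
move=> fg cf; rewrite /prop_for /continuous_at -(nbhs_singleton fg).
by apply: cvg_trans cf; apply: near_eq_cvg.
Qed.

Lemma gt_nbhs (R : realType) (a x : R) : a < x -> \forall y \near x, a < y.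
Proof. by move=> ax; exact: lt_nbhsr. Qed.

Section tonelli_on_sets.
Local Open Scope ereal_scope.
Context d1 d2 (T1 : measurableType d1) (T2 : measurableType d2) (R : realType).
Variable m1 : {sigma_finite_measure set T1 -> \bar R}.
Variable m2 : {sigma_finite_measure set T2 -> \bar R}.
Variables (D1 : set T1) (D2 : set T2) (mD1 : measurable D1) (mD2 : measurable D2).
Variable f : T1 -> T2 -> \bar R.
Hypothesis mf : measurable_fun (D1 `*` D2) (fun z => f z.1 z.2).
Hypothesis f0 : forall x y, D1 x -> D2 y -> 0 <= f x y.

Let h : T1 * T2 -> \bar R := (fun z => f z.1 z.2) \_ (D1 `*` D2).

Let mh : measurable_fun setT h.
Proof. by apply/(measurable_restrictT _ (measurableX mD1 mD2)). Qed.

Let h0 z : 0 <= h z.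
Proof.
by apply: erestrict_ge0 => -[x y] [/= Dx Dy]; exact: f0.
Qed.

Let hE x y : h (x, y) = if x \in D1 then (f x \_ D2) y else 0.
Proof.
rewrite /h /patch; have [/set_mem xD|/negP xD] := boolP (x \in D1).
  case: ifPn => [/set_mem[_ /= yD]|/negP yD]; first by rewrite mem_set.
  by case: ifPn => // /set_mem Dy; exfalso; apply: yD; apply/mem_set.
by case: ifPn => // /set_mem[/= xD1 _]; exfalso; apply: xD; apply/mem_set.
Qed.

Let hE' x y : h (x, y) = if y \in D2 then ((f ^~ y) \_ D1) x else 0.
Proof. by rewrite hE /patch; case: ifP => //; case: ifP. Qed.

Lemma tonelli_sets : \int[m1]_(x in D1) \int[m2]_(y in D2) f x y =
  \int[m2]_(y in D2) \int[m1]_(x in D1) f x y.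
Proof.
have := fubini_tonelli (m1 := m1) (m2 := m2) h mh h0.
rewrite /fubini_F /fubini_G => E.
rewrite [LHS]integral_mkcond [RHS]integral_mkcond.
transitivity (\int[m1]_x \int[m2]_y h (x, y)).
  apply: eq_integral => x _; rewrite /patch; case: ifPn => xD.
    by rewrite integral_mkcond; apply: eq_integral => y _; rewrite hE xD.
  by rewrite integral0_eq// => y _; rewrite hE (negbTE xD).
rewrite E; apply: eq_integral => y _; rewrite /patch; case: ifPn => yD.
  by rewrite [RHS]integral_mkcond; apply: eq_integral => x _; rewrite hE' yD.
by rewrite integral0_eq// => x _; rewrite hE' (negbTE yD).
Qed.

End tonelli_on_sets.

Section half_line.
Context {R : realType}.
Notation leb := (@lebesgue_measure R).

Lemma bigcup_itvcc (a : R) (u v : nat -> R) :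
  (forall n, a < u n) -> u @ \oo --> a -> v @ \oo --> +oo ->
  \bigcup_n `[u n, v n]%classic = `]a, +oo[%classic.
Proof.
move=> au ua vy; apply/seteqP; split => x /=.
  by move=> [n _] /=; rewrite !in_itv/= andbT => /andP[ux _]; exact: lt_le_trans (au n) ux.
rewrite in_itv/= andbT => ax.
near \oo => n; exists n => //=; rewrite in_itv/=; apply/andP; split.
  by near: n; exact: (cvgr_le _ ua).
by near: n; move/cvgryPge : vy; exact.
Unshelve. all: by end_near. Qed.

Lemma continuous_measurable_itvoy (a : R) (G : R -> R) :
  (forall x, a < x -> {for x, continuous G}) -> measurable_fun `]a, +oo[ G.
Proof.
move=> cG; apply: open_continuous_measurable_fun; first exact: interval_open.
by move=> x; rewrite inE/= in_itv/= andbT => ax; exact: cG.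
Qed.

Lemma cvg_integral_bigcup_itvcc (u v : nat -> R) (G : R -> R) :
  {homo u : m n / (m <= n)%N >-> n <= m} -> {homo v : m n / (m <= n)%N >-> m <= n} ->
  (forall n, measurable_fun `[u n, v n] G) -> (forall n x, x \in `[u n, v n] -> 0 <= G x) ->
  (\int[leb]_(x in `[u n, v n]) (G x)%:E)%E @[n --> \oo] -->
  (\int[leb]_(x in \bigcup_n `[u n, v n]%classic) (G x)%:E)%E.
Proof.
move=> uni vnd mG G0.
apply: ge0_nondecreasing_set_cvg_integral => //.
- move=> m n mn; apply/subsetPset; apply: subset_itv; rewrite bnd_simp; [exact: uni|exact: vnd].
- by move=> n; apply/measurable_EFinP; exact: mG.
Qed.

(** The half-line is exhausted by the intervals [a + 1/(n+1), a + n + 1], on which the compact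
    substitution rule applies; monotone convergence passes to the limit on both sides. The image [D]
    is left general because it is a half-line for powers and shifts but a bounded interval for the
    substitution that treats convolutions. *)
Lemma ge0_integration_by_substitution_itvoy (a : R) (D : set R) (F f G : R -> R) :
  is_interval D -> (forall x, a < x -> D (F x)) ->
  (forall y, D y -> exists2 x, a < x & F x = y) ->
  (forall x y, a < x -> x < y -> F x < F y) ->
  (forall x, a < x -> is_derive x 1 F (f x)) ->
  (forall x, a < x -> {for x, continuous f}) -> (forall x, a < x -> 0 <= f x) ->
  (forall x, D x -> {for x, continuous G}) -> (forall x, D x -> 0 <= G x) ->
  (\int[leb]_(y in D) (G y)%:E = \int[leb]_(x in `]a, +oo[) (G (F x) * f x)%:E)%E.
Proof.
move=> iD DF FD Finc dF cf f0 cG G0.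
pose u n : R := a + n.+1%:R^-1; pose v n : R := a + n.+1%:R.
have au n : a < u n by rewrite ltrDl invr_gt0.
have uv n : u n <= v n.
  by rewrite lerD2l (@le_trans _ _ 1)// ?invf_le1 ?ler1n// -[leLHS]invr1 lef_pV2 ?posrE// ler1n.
have ua : u @ \oo --> a.
  by rewrite -[X in _ --> X]addr0; apply: cvgD; [exact: cvg_cst|exact: cvg_harmonic].
have vy : v @ \oo --> +oo.
  apply/cvgryPge => r; near=> n; rewrite -lerBlDl -natr1 -lerBlDr; near: n.
  exact: nbhs_infty_ger.
have uni : {homo u : m n / (m <= n)%N >-> n <= m}.
  by move=> m n mn; rewrite lerD2l lef_pV2 ?posrE// ler_nat.
have vnd : {homo v : m n / (m <= n)%N >-> m <= n}.
  by move=> m n mn; rewrite lerD2l ler_nat.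
have Fnd x y : a < x -> x <= y -> F x <= F y.
  by move=> ax; rewrite le_eqVlt => /predU1P[->//|xy]; exact/ltW/Finc.
have cF x : a < x -> {for x, continuous F}.
  by move=> ax; apply/differentiable_continuous/derivable1_diffP; have [] := dF x ax.
have dFf x : a < x -> derive1 F x = f x by move=> ax; rewrite derive1E; have [_ ->] := dF x ax.
have cdF x : a < x -> {for x, continuous (derive1 F)}.
  move=> ax; apply: near_eq_continuous (cf x ax).
  by near=> y; rewrite dFf//; near: y; exact: gt_nbhs.
have cGF x : a < x -> {for x, continuous (fun x => G (F x) * f x)}.
  move=> ax; apply: continuousM; last exact: cf.
  by apply: continuous_comp; [exact: cF|exact/cG/DF].
have DE : \bigcup_n `[F (u n), F (v n)]%classic = D.
  apply/seteqP; split => y.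
    move=> [n _] /=; rewrite in_itv/=; apply: iD; first exact/DF/au.
    by apply: DF; exact: lt_le_trans (uv n).
  move=> /FD[x ax <-].
  have : `]a, +oo[%classic x by rewrite /= in_itv/= ax.
  rewrite -(bigcup_itvcc au ua vy) => -[n _] /=; rewrite in_itv/= => /andP[ux xv].
  by exists n => //=; rewrite in_itv/= !Fnd// au.
have Duv n x : x \in `[F (u n), F (v n)] -> D x.
  by move=> xuv; rewrite -DE; exists n.
have mG n : measurable_fun `[F (u n), F (v n)] G.
  apply: subspace_continuous_measurable_fun => //; apply: continuous_in_subspaceT => x.
  by rewrite inE => /Duv; exact: cG.
have GF0 x : a < x -> 0 <= G (F x) * f x by move=> ax; rewrite mulr_ge0// ?G0 ?f0//; exact: DF.
have H1 := @cvg_integral_bigcup_itvcc (F \o u) (F \o v) G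
  (fun m n mn => Fnd _ _ (au n) (uni _ _ mn))
  (fun m n mn => Fnd _ _ (lt_le_trans (au m) (uv m)) (vnd _ _ mn)) mG (fun n x xuv => G0 _ (Duv n x xuv)).
have mGF n : measurable_fun `[u n, v n] (fun x => G (F x) * f x).
  apply: subspace_continuous_measurable_fun => //; apply: continuous_in_subspaceT => x.
  by rewrite inE/= in_itv/= => /andP[ux _]; apply: cGF; exact: lt_le_trans ux.
have H2 := @cvg_integral_bigcup_itvcc u v _ uni vnd mGF.
rewrite -DE -(bigcup_itvcc au ua vy).
apply: (cvg_unique _ H1) => //=.
suff -> : (fun n => \int[leb]_(x in `[F (u n), F (v n)]) (G x)%:E)%E =
    (fun n => \int[leb]_(x in `[u n, v n]) (G (F x) * f x)%:E)%E.
  by apply: H2 => n x /=; rewrite in_itv/= => /andP[ux _]; apply: GF0; exact: lt_le_trans ux.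
apply/funext => n.
rewrite integration_by_substitution_increasing//.
- apply: eq_integral => x; rewrite inE/= in_itv/= => /andP[ux _].
  by rewrite -(dFf x)//; exact: lt_le_trans (au n) ux.
- move=> x y; rewrite !in_itv/= => /andP[ux _] _ xy; apply: Finc => //.
  exact: lt_le_trans ux.
- by move=> x; rewrite in_itv/= => /andP[ux _]; apply: cdF; exact: lt_trans ux.
- apply: (cvgP (derive1 F (u n))); apply: cvg_at_right_filter; exact: cdF.
- apply: (cvgP (derive1 F (v n))); apply: cvg_at_left_filter; apply: cdF; exact: lt_le_trans (uv n).
- split.
  + by move=> x; rewrite in_itv/= => /andP[ux _]; have [] := dF x (lt_trans (au n) ux).
  + by apply: cvg_at_right_filter; exact: cF.
  + by apply: cvg_at_left_filter; apply: cF; exact: lt_le_trans (uv n).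
- apply: continuous_in_subspaceT => x; rewrite inE => /Duv; exact: cG.
Unshelve. all: by end_near. Qed.

Lemma continuous_powR (rho x : R) : 0 < x -> {for x, continuous (@powR R ^~ rho)}.
Proof.
move=> x0; apply/differentiable_continuous/derivable1_diffP.
by have [] := is_derive1_powR rho x0.
Qed.

Lemma ge0_integration_by_powR_itvoy (t K rho : R) (G : R -> R) : 0 <= t -> 0 < K -> 0 < rho ->
  (forall x, K * t `^ rho < x -> {for x, continuous G}) -> (forall x, K * t `^ rho < x -> 0 <= G x) ->
  (\int[leb]_(y in `](K * t `^ rho)%R, +oo[) (G y)%:E =
   \int[leb]_(x in `]t, +oo[) (G (K * x `^ rho) * (K * (rho * x `^ (rho - 1))))%:E)%E.
Proof.
move=> t0 K0 r0 cG G0; apply: (ge0_integration_by_substitution_itvoy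
  (F := fun x => K * x `^ rho) (f := fun x => K * (rho * x `^ (rho - 1)))) => //.
- exact: interval_is_interval.
- move=> x tx; rewrite /= in_itv/= andbT ltr_pM2l// gt0_ltr_powR ?nnegrE//.
  by rewrite ltW// (le_lt_trans t0).
- move=> y; rewrite /= in_itv/= andbT => ty.
  have y0 : 0 <= y / K by rewrite divr_ge0 ?(ltW K0)// ltW// (le_lt_trans _ ty)// mulr_ge0 ?powR_ge0// ltW.
  have yE : y = K * ((y / K) `^ rho^-1) `^ rho.
    by rewrite -powRrM mulVf ?gt_eqF// powRr1// mulrC divfK// gt_eqF.
  exists ((y / K) `^ rho^-1) => //.
  rewrite yE ltr_pM2l// in ty; rewrite ltNge; apply/negP => h.
  by move: ty; rewrite ltNge => /negP; apply; apply: ge0_ler_powR; rewrite ?nnegrE ?powR_ge0// ltW.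
- move=> x y tx xy; have x0 := le_lt_trans t0 tx.
  by rewrite ltr_pM2l// gt0_ltr_powR ?nnegrE// ltW// (lt_trans x0).
- by move=> x tx; apply: is_deriveZ; apply: is_derive1_powR; exact: le_lt_trans tx.
- move=> x tx; have x0 := le_lt_trans t0 tx; apply: continuousM; first exact: cst_continuous.
  by apply: continuousM; [exact: cst_continuous|exact: continuous_powR].
- by move=> x tx; rewrite !mulr_ge0 ?powR_ge0// ltW.
- by move=> x /=; rewrite in_itv/= andbT; exact: cG.
- by move=> x /=; rewrite in_itv/= andbT; exact: G0.
Qed.

Lemma ge0_integration_by_powR (K rho : R) (G : R -> R) : 0 < K -> 0 < rho ->
  (forall x, 0 < x -> {for x, continuous G}) -> (forall x, 0 < x -> 0 <= G x) ->
  (\int[leb]_(y in `]0%R, +oo[) (G y)%:E =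
   \int[leb]_(x in `]0%R, +oo[) (G (K * x `^ rho) * (K * (rho * x `^ (rho - 1))))%:E)%E.
Proof.
move=> K0 r0 cG G0; have := @ge0_integration_by_powR_itvoy 0 K rho G (lexx 0) K0 r0.
by rewrite powR0 ?gt_eqF// mulr0; apply.
Qed.

Lemma ge0_integration_by_shift (t : R) (G : R -> R) :
  (forall x, t < x -> {for x, continuous G}) -> (forall x, t < x -> 0 <= G x) ->
  (\int[leb]_(y in `]t, +oo[) (G y)%:E = \int[leb]_(x in `]0%R, +oo[) (G (t + x))%:E)%E.
Proof.
move=> cG G0; transitivity (\int[leb]_(x in `]0%R, +oo[) (G (t + x) * 1)%:E)%E; last first.
  by apply: eq_integral => x _; rewrite mulr1.
apply: (ge0_integration_by_substitution_itvoy (F := fun x => t + x) (f := fun=> 1)) => //.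
- exact: interval_is_interval.
- by move=> x x0; rewrite /= in_itv/= andbT ltrDl.
- by move=> y; rewrite /= in_itv/= andbT => ty; exists (y - t); rewrite ?subr_gt0// addrC subrK.
- by move=> x y _ xy; rewrite ltrD2l.
- by move=> x x0; have := is_deriveD (is_derive_cst t x 1) (is_derive_id x 1); rewrite add0r.
- by move=> x _; exact: cst_continuous.
- by move=> x /=; rewrite in_itv/= andbT; exact: cG.
- by move=> x /=; rewrite in_itv/= andbT; exact: G0.
Qed.

(* The substitution [s = t y / (1 + y)] makes the dependence on [t] of the
   convolution of [s `^ (nu - 1) * h s] with [s `^ (- nu)] lie in [h] alone. *)
Lemma ge0_integration_by_beta (t nu : R) (h : R -> R) : 0 < t ->
  (forall x, 0 < x -> {for x, continuous h}) -> (forall x, 0 < x -> 0 <= h x) ->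
  (\int[leb]_(s in `]0%R, t[) ((t - s) `^ (- nu) * (s `^ (nu - 1) * h s))%:E =
   \int[leb]_(y in `]0%R, +oo[) (y `^ (nu - 1) * (1 + y)^-1 * h (t * (y / (1 + y))))%:E)%E.
Proof.
move=> t0 ch h0.
have y10 (y : R) : 0 < y -> 0 < 1 + y by move=> y0; rewrite addr_gt0.
transitivity (\int[leb]_(y in `]0%R, +oo[)
   ((t - t * (y / (1 + y))) `^ (- nu) * ((t * (y / (1 + y))) `^ (nu - 1) * h (t * (y / (1 + y)))) *
    (t * (1 + y) ^- 2))%:E)%E; last first.
  apply: eq_integral => y; rewrite inE/= in_itv/= andbT => y0; congr EFin.
  have z0 := y10 y y0; have zi0 : 0 < (1 + y)^-1 by rewrite invr_gt0.
  have -> : t - t * (y / (1 + y)) = t * (1 + y)^-1 by field; rewrite gt_eqF.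
  set X := h _.
  rewrite !powRM ?(ltW t0) ?(ltW zi0) ?(ltW y0) ?mulr_ge0 ?(ltW zi0) ?(ltW y0)//.
  have E (x : R) : 0 < x -> x `^ (- nu) * x `^ (nu - 1) * x = 1.
    move=> x0; rewrite -{3}(powRr1 (ltW x0)) -!gt0_powRD// (_ : _ + _ = 0) ?powRr0//; ring.
  rewrite exprSr expr1 invfM.
  transitivity ((t `^ (- nu) * t `^ (nu - 1) * t) *
    ((1 + y)^-1 `^ (- nu) * (1 + y)^-1 `^ (nu - 1) * (1 + y)^-1) *
    (y `^ (nu - 1) * (1 + y)^-1 * X)); first by ring.
  by rewrite !E// !mul1r.
apply: (ge0_integration_by_substitution_itvoy (F := fun y => t * (y / (1 + y)))
  (f := fun y => t * (1 + y) ^- 2) (G := fun s => (t - s) `^ (- nu) * (s `^ (nu - 1) * h s))) => //.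
- exact: interval_is_interval.
- move=> y y0; rewrite /= in_itv/= mulr_gt0 ?divr_gt0 ?y10//= gtr_pMr// ltr_pdivrMr ?y10// mul1r.
  by rewrite ltrDr.
- move=> s; rewrite /= in_itv/= => /andP[s0 st]; have ts : 0 < t - s by rewrite subr_gt0.
  exists (s / (t - s)); first by rewrite divr_gt0.
  by field; rewrite !gt_eqF//= subrK.
- move=> x y x0 xy; rewrite ltr_pM2l// ltr_pdivrMr ?y10// mulrAC ltr_pdivlMr ?y10//; last exact: lt_trans xy.
  lra.
- move=> y y0; have z0 : 1 + y != 0 by rewrite gt_eqF// y10.
  have -> : t * (1 + y) ^- 2 = t *: (y *: (- (1 + y) ^- 2 *: (0 + 1)) + (1 + y)^-1 *: 1).
    by rewrite /GRing.scale/=; field.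
  apply: is_deriveZ; apply: is_deriveM.
- move=> y y0; apply: continuousM; first exact: cst_continuous.
  apply: continuousV; first by rewrite expf_neq0// gt_eqF// y10.
  by apply: continuousM; apply: continuousD => //; exact: cst_continuous.
- by move=> y y0; rewrite mulr_ge0 ?(ltW t0)// invr_ge0 exprn_ge0// ltW// y10.
- move=> s /=; rewrite in_itv/= => /andP[s0 st]; apply: continuousM.
    apply: (@continuous_comp _ _ _ (fun s => t - s) (fun s => s `^ (- nu))).
      by apply: continuousB; [exact: cvg_cst|exact: cvg_id].
    by apply: continuous_powR; rewrite subr_gt0.
  by apply: continuousM; [exact: continuous_powR|exact: ch].
- by move=> s /=; rewrite in_itv/= => /andP[s0 st]; rewrite !mulr_ge0 ?powR_ge0// h0.
Qed.

Lemma is_derive_expRN (c x : R) : is_derive x 1 (fun x => expR (- (c * x))) (- c * expR (- (c * x))).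
Proof.
have d1 : is_derive x 1 (fun x => - (c * x)) (- c).
  by rewrite -[X in - X]mulr1; apply: is_deriveN; exact: is_deriveZ.
by have := is_derive1_comp (f := expR) (g := fun x => - (c * x)) (is_derive_expR (- (c * x))) d1; rewrite mulrC.
Qed.

Lemma continuous_expRN (c : R) : continuous (fun x => expR (- (c * x))).
Proof.
by move=> x; apply/differentiable_continuous/derivable1_diffP; have [] := is_derive_expRN c x.
Qed.

Lemma expRN_cvg0 (c : R) : 0 < c -> expR (- (c * x)) @[x --> +oo] --> 0.
Proof.
move=> c0; apply: (@cvg_comp _ _ _ (fun x => c * x) (fun x => expR (- x)) _ +oo).
  by apply: gt0_cvgMry.
exact: cvgr_expR.
Qed.

Lemma integral_expRN (t c : R) : 0 < c ->
  (\int[leb]_(x in `]t, +oo[) (expR (- (c * x)))%:E = (expR (- (c * t)) / c)%:E)%E.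
Proof.
move=> c0; rewrite integral_itv_obnd_cbnd; last first.
  apply/measurable_EFinP; apply: measurable_funTS.
  by apply: continuous_measurable_fun; exact: continuous_expRN.
have d1 (x : R) : is_derive x 1 (fun x => (- c^-1) * expR (- (c * x))) (expR (- (c * x))).
  have -> : expR (- (c * x)) = (- c^-1) *: (- c * expR (- (c * x))).
    by rewrite /GRing.scale/= mulrA mulrNN mulVf ?gt_eqF// mul1r.
  by apply: is_deriveZ; exact: is_derive_expRN.
rewrite (@ge0_continuous_FTC2y _ _ (fun x => (- c^-1) * expR (- (c * x))) _ 0).
- by rewrite -EFinB sub0r mulNr opprK mulrC.
- by move=> x _; exact: expR_ge0.
- exact/continuous_subspaceT/continuous_expRN.
- by rewrite -(mulr0 (- c^-1)); apply: cvgMr; exact: expRN_cvg0.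
- by move=> x _; have [] := d1 x.
- apply: cvg_at_right_filter; apply: cvgMr; exact: continuous_expRN.
- by move=> x _; rewrite derive1E; have [_ ->] := d1 x.
Qed.

Lemma integral_expRN_bounded (X c : R) (b : bool) : 0 <= X -> 0 < c ->
  (\int[leb]_(x in [set` Interval (BRight 0%R) (BSide b X)]) (c * expR (- (c * x)))%:E =
   (1 - expR (- (c * X)))%:E)%E.
Proof.
rewrite le_eqVlt => /predU1P[<- c0|X0 c0].
  by rewrite set_itv_ge ?bnd_simp ?ltxx//= ?integral_set0 ?mulr0 ?oppr0 ?expR0 ?subrr// -leNgt; case: b.
have cf : continuous (fun x : R => c * expR (- (c * x))).
  by move=> x; apply: cvgM; [exact: cvg_cst|exact: continuous_expRN].
have mf : measurable_fun `]0, X[ (fun x => c * expR (- (c * x))).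
  apply: measurable_funTS; apply: measurable_funM => //.
  by apply: continuous_measurable_fun; exact: continuous_expRN.
have d1 (x : R) : is_derive x 1 (fun x => - expR (- (c * x))) (c * expR (- (c * x))).
  by rewrite -[c * _]opprK -mulNr; apply: is_deriveN; exact: is_derive_expRN.
transitivity (\int[leb]_(x in `[0%R, X]) (c * expR (- (c * x)))%:E)%E.
  by rewrite (@integral_itv_bndoo _ 0 X _ false b) ?(@integral_itv_bndoo _ 0 X _ true false)//; exact/measurable_EFinP.
rewrite (@continuous_FTC2 _ _ (fun x => - expR (- (c * x))))//.
- by rewrite -EFinB opprK addrC mulr0 oppr0 expR0.
- exact: continuous_subspaceT.
- split.
  + by move=> x _; have [] := d1 x.
  + by apply: cvg_at_right_filter; apply: cvgN; exact: continuous_expRN.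
  + by apply: cvg_at_left_filter; apply: cvgN; exact: continuous_expRN.
- by move=> x _; rewrite derive1E; have [_ ->] := d1 x.
Qed.

End half_line.

(** * The Gamma integral for exponents in (0, 1] *)

Section gamma_function.
Context {R : realType}.
Notation leb := (@lebesgue_measure R).

Lemma continuous_gamma_integrand (a c x : R) : 0 < x ->
  {for x, continuous (fun s => s `^ a * expR (- (c * s)))}.
Proof.
by move=> x0; apply: continuousM; [exact: continuous_powR|exact: continuous_expRN].
Qed.

Lemma continuous_gamma_integrand1 (a x : R) : 0 < x ->
  {for x, continuous (fun s => s `^ a * expR (- s))}.
Proof.
move=> x0; rewrite (_ : (fun s => _) = (fun s => s `^ a * expR (- (1 * s)))).
  exact: continuous_gamma_integrand.
by apply/funext => s; rewrite mul1r.
Qed.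

(** The substitution s = z^(1/x) removes the singularity at 0, which leaves a bounded integrand to
    be estimated. *)
Lemma gamma_integral_powR (x : R) : 0 < x ->
  (\int[leb]_(s in `]0%R, +oo[) (s `^ (x - 1) * expR (- s))%:E =
   \int[leb]_(z in `]0%R, +oo[) (x^-1 * expR (- z `^ x^-1))%:E)%E.
Proof.
move=> x0.
rewrite (@ge0_integration_by_powR _ 1 x^-1 (fun s => s `^ (x - 1) * expR (- s))) ?invr_gt0//.
- apply: eq_integral => z; rewrite inE/= in_itv/= andbT => z0; congr EFin.
  rewrite !mul1r -powRrM mulrCA mulrAC -gt0_powRD// mulrBr mulr1 mulVf ?gt_eqF//.
  by rewrite addrA subrK subrr powRr0 mul1r.
- by move=> s s0; exact: continuous_gamma_integrand1.
- by move=> s s0; rewrite mulr_ge0 ?powR_ge0 ?expR_ge0.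
Qed.

Lemma measurable_gamma_integrand (a c : R) (D : set R) :
  measurable_fun D (fun s : R => s `^ a * expR (- (c * s))).
Proof.
apply: measurable_funTS; apply: measurable_funM; first exact: measurable_powR.
by apply: continuous_measurable_fun; exact: continuous_expRN.
Qed.

(** [Gamma] is a real-valued integral, equal to 0 if the integral diverges; finiteness has to be
    shown before its value means anything. The exponents that occur are nu, 1 - nu and m - nu, all
    in (0, 1]. *)
Lemma Gamma_gt0_lty (x : R) : 0 < x -> x <= 1 ->
  [/\ 0 < Gamma x &
  (\int[leb]_(s in `]0%R, +oo[) (s `^ (x - 1) * expR (- s))%:E = (Gamma x)%:E)%E].
Proof.
move=> x0 x1.
pose h (z : R) := x^-1 * expR (- z `^ x^-1).
have h0 z : 0 <= h z by rewrite mulr_ge0 ?invr_ge0 ?expR_ge0 ?ltW.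
have mh : measurable_fun setT h.
  apply: measurable_funM => //; apply: measurableT_comp => //.
  by apply: measurableT_comp => //; exact: measurable_powR.
(* As 1/x >= 1, z^(1/x) dominates z when z >= 1; the factor e pays for z < 1. *)
have hle (z : R) : 0 < z -> h z <= x^-1 * expR 1 * expR (- (1 * z)).
  move=> z0; rewrite -mulrA ler_wpM2l ?invr_ge0 ?(ltW x0)// -expRD ler_expR mul1r.
  have [z1|z1] := leP 1 z.
    rewrite (@le_trans _ _ (- z))//; last by rewrite lerDr.
    by rewrite lerN2 le1r_powR// invf_ge1.
  rewrite (@le_trans _ _ 0)//; last by rewrite subr_ge0 ltW.
  by rewrite oppr_le0 powR_ge0.
have fin : (\int[leb]_(z in `]0%R, +oo[) (h z)%:E < +oo)%E.
  apply: (@le_lt_trans _ _ (\int[leb]_(z in `]0%R, +oo[) (x^-1 * expR 1 * expR (- (1 * z)))%:E)%E).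
    apply: ge0_le_integral => //.
    - by move=> z _; rewrite lee_fin.
    - by apply/measurable_EFinP; exact: measurable_funTS.
    - apply/measurable_EFinP; apply: measurable_funTS; apply: measurable_funM => //.
      by apply: continuous_measurable_fun; exact: continuous_expRN.
    - by move=> z; rewrite /= in_itv/= andbT => z0; rewrite lee_fin hle.
  under eq_integral do rewrite EFinM.
  rewrite ge0_integralZl_EFin//.
  - by rewrite integral_expRN// -EFinM ltry.
  - by apply/measurable_EFinP; apply: measurable_funTS; apply: continuous_measurable_fun; exact: continuous_expRN.
  - by rewrite mulr_ge0 ?invr_ge0 ?expR_ge0// ltW.
have fn : (\int[leb]_(z in `]0%R, +oo[) (h z)%:E \is a fin_num)%E.
  by rewrite ge0_fin_numE//; apply: integral_ge0 => z _; rewrite lee_fin.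
have GE : (\int[leb]_(s in `]0%R, +oo[) (s `^ (x - 1) * expR (- s))%:E = (Gamma x)%:E)%E.
  by rewrite /Gamma /Rintegral gamma_integral_powR// fineK.
split => //.
rewrite -lte_fin -GE gamma_integral_powR//.
apply: (@lt_le_trans _ _ (\int[leb]_(z in `]0%R, 1%R[) (x^-1 * expR (- 1))%:E)%E).
  rewrite integral_cst//= lebesgue_measure_itv/= lte_fin ltr01 sube0 mule1 lte_fin.
  by rewrite mulr_gt0 ?invr_gt0 ?expR_gt0.
apply: (@le_trans _ _ (\int[leb]_(z in `]0%R, 1%R[) (h z)%:E)%E).
  apply: ge0_le_integral => //.
  - by move=> z _; rewrite lee_fin mulr_ge0 ?invr_ge0 ?expR_ge0// ltW.
  - by apply/measurable_EFinP; exact: measurable_funTS.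
  - move=> z; rewrite /= in_itv/= => /andP[z0 z1].
    rewrite lee_fin ler_wpM2l ?invr_ge0 ?(ltW x0)// ler_expR lerN2.
    apply: (@le_trans _ _ (1 `^ x^-1)); last by rewrite powR1.
    by apply: ge0_ler_powR; rewrite ?nnegrE ?invr_ge0 ?ltW.
apply: ge0_subset_integral => //.
- by apply/measurable_EFinP; exact: measurable_funTS.
- by move=> z _; rewrite lee_fin.
- by apply: subset_itvl.
Qed.

Lemma integral_powR_expR (x c : R) : 0 < x -> x <= 1 -> 0 < c ->
  (\int[leb]_(s in `]0%R, +oo[) (s `^ (x - 1) * expR (- (c * s)))%:E = (Gamma x * c `^ (- x))%:E)%E.
Proof.
move=> x0 x1 c0; have [G0 GE] := Gamma_gt0_lty x0 x1.
have : (\int[leb]_(s in `]0%R, +oo[) (c `^ x * (s `^ (x - 1) * expR (- (c * s))))%:E = (Gamma x)%:E)%E.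
  rewrite -GE [RHS](@ge0_integration_by_powR _ c 1 (fun s => s `^ (x - 1) * expR (- s)))//.
  - apply: eq_integral => z; rewrite inE/= in_itv/= andbT => z0; congr EFin.
    rewrite powRr1 ?(ltW z0)// subrr powRr0 !mulr1 powRM ?(ltW z0) ?(ltW c0)//.
    rewrite -(gt0_mulr_powRB1 x c0); ring.
  - by move=> s s0; exact: continuous_gamma_integrand1.
  - by move=> s s0; rewrite mulr_ge0 ?powR_ge0 ?expR_ge0.
under eq_integral do rewrite EFinM.
rewrite ge0_integralZl_EFin ?powR_ge0//; last 2 first.
- by move=> z _; rewrite lee_fin mulr_ge0 ?powR_ge0 ?expR_ge0.
- by apply/measurable_EFinP; exact: measurable_gamma_integrand.
move=> E; rewrite EFinM -E muleC muleA -EFinM -gt0_powRD// addNr powRr0 mul1e.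
by [].
Qed.

End gamma_function.

(** * Uniqueness of Laplace transforms *)

Lemma ge0_integrable d (T : measurableType d) (R : realType)
    (m : {measure set T -> \bar R}) (D : set T) (f : T -> R) : measurable D ->
  measurable_fun D f -> (forall x, D x -> 0 <= f x) ->
  (\int[m]_(x in D) (f x)%:E < +oo)%E -> m.-integrable D (EFin \o f).
Proof.
move=> mD mf f0 foo; apply/integrableP; split; first exact/measurable_EFinP.
by under eq_integral => x /set_mem Dx do rewrite /= ger0_norm ?f0//.
Qed.

Section laplace_uniqueness.
Context {R : realType}.
Notation leb := (@lebesgue_measure R).

Lemma bounded_mul_integrable (D : set R) (k h : R -> R) (M : R) : measurable D ->
  measurable_fun D k -> (forall t, D t -> `|k t| <= M) -> leb.-integrable D (EFin \o h) ->
  leb.-integrable D (EFin \o (fun t => k t * h t)).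
Proof.
move=> mD mk kM hi.
have mh : measurable_fun D h by apply/measurable_EFinP; exact: measurable_int hi.
apply: (@le_integrable _ _ _ leb D mD _ (fun t => M%:E * (EFin \o h) t)%E).
- by apply/measurable_EFinP; apply: measurable_funM.
- move=> t Dt; rewrite /= lee_fin !normrM ler_wpM2r//.
  by rewrite (le_trans (kM t Dt))// ler_norm.
- exact: integrableZl.
Qed.

(* Landau kernel: [(1 - (e^-t - y0)^2)^N] is a polynomial in [e^-t] that
   concentrates at the point where [e^-t = y0]. *)
Let landau (y0 : R) N (t : R) : R := (1 - (expR (- t) - y0) ^+ 2) ^+ N.

Let landau_bounds (y0 : R) N (t : R) : 0 < y0 -> y0 < 1 -> 0 < t -> 0 <= landau y0 N t <= 1.
Proof.
move=> y0_gt0 y0_lt1 t0.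
have e0 := expR_gt0 (- t); have e1 : expR (- t) < 1 by rewrite expR_lt1 oppr_lt0.
have h : 0 <= 1 - (expR (- t) - y0) ^+ 2 <= 1.
  move: (expR (- t)) e0 e1 => e e0 e1; apply/andP; split; last by rewrite gerDl oppr_le0 sqr_ge0.
  by rewrite -{1}(expr1n R 2) subr_sqr mulr_ge0//; lra.
by move/andP : h => [h0 h1]; rewrite /landau exprn_ge0//= exprn_ile1.
Qed.

Let measurable_landau (y0 : R) N (D : set R) : measurable_fun D (landau y0 N).
Proof.
apply: measurable_funTS; apply: measurable_funX; apply: measurable_funB => //.
apply: measurable_funX; apply: measurable_funB => //.
by apply: measurableT_comp => //; exact: measurableT_comp.
Qed.

Let landau_integrable y0 N n (h : R -> R) : 0 < y0 -> y0 < 1 ->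
  leb.-integrable `]0, +oo[ (EFin \o h) ->
  leb.-integrable `]0, +oo[ (EFin \o (fun t => landau y0 N t * expR (- (n%:R * t)) * h t)).
Proof.
move=> y00 y01 hi; apply: (@bounded_mul_integrable _ _ _ 1) => //.
- apply: measurable_funM; first exact: measurable_landau.
  by apply: measurable_funTS; apply: continuous_measurable_fun; exact: continuous_expRN.
- move=> t /=; rewrite in_itv/= andbT => t0.
  have /andP[l0 l1] := landau_bounds N y00 y01 t0.
  rewrite ger0_norm ?mulr_ge0 ?expR_ge0// mulr_ile1 ?expR_ge0//.
  by rewrite expR_le1 oppr_le0 mulr_ge0// ltW.
Qed.

(** The base of the kernel is (1 - y0^2) + 2 y0 e^-t - e^-2t, so one more factor merely shifts n by
    0, 1 or 2. Hence the induction on N treats all n at once. *)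
Let landau_orthogonal y0 N (h : R -> R) : 0 < y0 -> y0 < 1 ->
  leb.-integrable `]0, +oo[ (EFin \o h) ->
  (forall n : nat, \int[leb]_(t in `]0, +oo[) (expR (- (n%:R * t)) * h t) = 0) ->
  forall n : nat, \int[leb]_(t in `]0, +oo[) (landau y0 N t * expR (- (n%:R * t)) * h t) = 0.
Proof.
move=> y00 y01 hi h0; elim: N => [|N IHN] n.
  by rewrite -[RHS](h0 n); apply: eq_Rintegral => t _; rewrite /landau expr0 mul1r.
pose k j t := landau y0 N t * expR (- (j%:R * t)) * h t.
have ki j : leb.-integrable `]0, +oo[ (EFin \o k j) by exact: landau_integrable.
transitivity (\int[leb]_(t in `]0, +oo[) ((1 - y0 ^+ 2) * k n t + 2 * y0 * k n.+1 t - k n.+2 t)).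
  apply: eq_Rintegral => t _; rewrite /k /landau exprS.
  rewrite -[in n.+2%:R]addn2 -[in n.+1%:R]addn1 !natrD !mulrDl !opprD !expRD !mul1r.
  ring.
have i1 : leb.-integrable `]0, +oo[ (EFin \o (fun t => (1 - y0 ^+ 2) * k n t)).
  exact: integrableZl (ki n).
have i2 : leb.-integrable `]0, +oo[ (EFin \o (fun t => 2 * y0 * k n.+1 t)).
  exact: integrableZl (ki n.+1).
have i3 : leb.-integrable `]0, +oo[ (EFin \o (fun t => (1 - y0 ^+ 2) * k n t + 2 * y0 * k n.+1 t)).
  exact: integrableD i1 i2.
rewrite RintegralB// RintegralD// !RintegralZl//.
by rewrite /k !IHN !mulr0 addr0 subr0.
Qed.

(** If D t0 > 0, then D exceeds D t0 / 2 on a window to the right of t0. The Landau kernel centred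
    at the midpoint of the window is at least a^N on a subinterval J and at most b^N outside the
    window, with b < a, and D is positive in between. Orthogonality then bounds a positive multiple
    of a^N by a fixed multiple of b^N, which fails for large N. *)
Lemma laplace_orthogonal_sign (D : R -> R) (t0 : R) : 0 < t0 ->
  leb.-integrable `]0, +oo[ (EFin \o (fun t => expR (- t) * D t)) ->
  (forall n : nat, \int[leb]_(t in `]0, +oo[) (expR (- (n%:R * t)) * (expR (- t) * D t)) = 0) ->
  D x @[x --> t0^'+] --> D t0 -> D t0 <= 0.
Proof.
move=> t0_gt0 hi h0 cD; rewrite leNgt; apply/negP => D0.
pose h (t : R) := expR (- t) * D t.
have [d d0 Dd] : exists2 d : R, 0 < d & forall t, t0 < t -> t < t0 + d -> D t0 / 2 < D t.
  have D20 : 0 < D t0 / 2 by rewrite divr_gt0.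
  move/cvgrPdist_lt : cD => /(_ _ D20) [d /= d0 Hd].
  exists d => // t t0t td.
  have := Hd t; rewrite /ball_/= ltr0_norm ?subr_lt0// opprB ltrBlDl => /(_ td t0t).
  by move=> /(le_lt_trans (ler_norm _)); lra.
pose t1 := t0 + d / 2.
pose y0 := expR (- t1).
(* The largest radius around y0 that, in the variable e^-t, stays inside the image of the window. *)
pose rho := Num.min (expR (- t0) - y0) (y0 - expR (- (t0 + d))).
have rho0 : 0 < rho.
  rewrite lt_min !subr_gt0 !ltr_expR !ltrN2 /t1; apply/andP; split; lra.
have rho1 : rho <= expR (- t0) - y0 by rewrite ge_min lexx.
have rho2 : rho <= y0 - expR (- (t0 + d)) by rewrite ge_min lexx orbT.
have e_gt0 := expR_gt0 (- (t0 + d)).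
have y00 : 0 < y0 by exact: expR_gt0.
have y01 : y0 < 1 by rewrite expR_lt1 oppr_lt0 /t1; lra.
(* On J = [t1, t2] the variable e^-t runs over [y0 - rho / 2, y0]. *)
pose y2 := y0 - rho / 2.
have y20 : 0 < y2 by rewrite /y2; lra.
pose t2 := - ln y2.
have et2 : expR (- t2) = y2 by rewrite opprK lnK.
have t12 : t1 < t2 by rewrite -ltrN2 -ltr_expR et2 -/y0 /y2; lra.
have t2d : t2 < t0 + d by rewrite -ltrN2 -ltr_expR et2 /y2; lra.
(* The base of the kernel at distance rho / 2 and rho from its centre. *)
pose a := 1 - (rho / 2) ^+ 2; pose b := 1 - rho ^+ 2.
have b0 : 0 <= b by rewrite /b; nra.
have ba : b < a by rewrite /a /b; nra.
have a0 : 0 < a by exact: le_lt_trans ba.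
(* Lower bound of h on J: D is at least D t0 / 2 there, and e^-t at least y2. *)
pose e := D t0 / 2 * y2.
have e0 : 0 < e by rewrite mulr_gt0// divr_gt0.
pose J : set R := `[t1, t2]%classic.
have pw N (t : R) : 0 < t -> a ^+ N * e * \1_J t - b ^+ N * `|h t| <= landau y0 N t * h t.
  move=> t_gt0; have /andP[l0 l1] := landau_bounds N y00 y01 t_gt0.
  have bh0 : 0 <= b ^+ N * `|h t| by rewrite mulr_ge0 ?exprn_ge0.
  have [/andP[tJ1 tJ2]|tJ] := boolP ((t1 <= t) && (t <= t2)).
    have tt0 : t0 < t by rewrite (lt_le_trans _ tJ1)// /t1; lra.
    have ttd : t < t0 + d by exact: le_lt_trans t2d.
    have Dt := Dd t tt0 ttd.
    have l2 : a ^+ N <= landau y0 N t.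
      rewrite /landau lerXn2r ?nnegrE ?(ltW a0)//.
        by have /andP[] := landau_bounds 1 y00 y01 t_gt0; rewrite /landau expr1.
      have : y2 <= expR (- t) by rewrite -et2 ler_expR lerN2.
      have : expR (- t) <= y0 by rewrite ler_expR lerN2.
      rewrite /a /y2; move: (expR (- t)) => y; nra.
    have ht : e <= h t.
      rewrite /e /h mulrC ler_pM ?(ltW y20)//; [by rewrite divr_ge0 ?ltW| |exact: ltW].
      by rewrite -et2 ler_expR lerN2.
    rewrite indicE mem_set ?mulr1; last by rewrite /J/= in_itv/= tJ1 tJ2.
    rewrite (@le_trans _ _ (a ^+ N * e))//; first by rewrite gerDl oppr_le0.
    by rewrite ler_pM// ?exprn_ge0// ltW.
  have -> : \1_J t = 0 :> R.
    by rewrite indicE memNset// /J/= in_itv/=; exact/negP.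
  rewrite mulr0 sub0r.
  have [/andP[tt0 ttd]|tO] := boolP ((t0 < t) && (t < t0 + d)).
    rewrite (@le_trans _ _ 0) ?oppr_le0// mulr_ge0// /h mulr_ge0 ?expR_ge0//.
    by rewrite (ltW (lt_trans _ (Dd _ tt0 ttd)))// divr_gt0.
  have l2 : landau y0 N t <= b ^+ N.
    rewrite /landau lerXn2r ?nnegrE ?b0//.
      by have /andP[] := landau_bounds 1 y00 y01 t_gt0; rewrite /landau expr1.
    rewrite /b lerD2l lerN2.
    move: tO; rewrite negb_and -!leNgt => /orP[tt|tt].
      have : expR (- t0) <= expR (- t) by rewrite ler_expR lerN2.
      by move: (expR (- t)) => y; nra.
    have : expR (- t) <= expR (- (t0 + d)) by rewrite ler_expR lerN2.
    by move: (expR (- t)) (expR (- (t0 + d))) rho2 => y z *; nra.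
  rewrite lerNl -mulrN (le_trans (ler_norm _))// normrM normrN ger0_norm//.
  by rewrite ler_wpM2r.
pose B := \int[leb]_(t in `]0, +oo[) `|h t|.
have hin : leb.-integrable `]0, +oo[ (EFin \o (fun t => `|h t|)) by exact: integrable_norm.
have main N : a ^+ N * (e * (t2 - t1)) <= b ^+ N * B.
  have Ji : leb.-integrable `]0, +oo[ (EFin \o \1_J : R -> \bar R).
    apply: (@integrableS _ _ _ leb setT) => //.
    exact: integrable_indic_itv.
  have i1 : leb.-integrable `]0, +oo[ (EFin \o (fun t => a ^+ N * e * \1_J t)).
    exact: integrableZl Ji.
  have i2 : leb.-integrable `]0, +oo[ (EFin \o (fun t => b ^+ N * `|h t|)).
    exact: integrableZl hin.
  have i3 : leb.-integrable `]0, +oo[ (EFin \o (fun t => a ^+ N * e * \1_J t - b ^+ N * `|h t|)).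
    exact: integrableB i1 i2.
  have i4 : leb.-integrable `]0, +oo[ (EFin \o (fun t => landau y0 N t * h t)).
    have := landau_integrable N 0 y00 y01 hi; apply: eq_integrable => // t _.
    by rewrite /= mul0r oppr0 expR0 mulr1.
  have : \int[leb]_(t in `]0, +oo[) (a ^+ N * e * \1_J t - b ^+ N * `|h t|) <=
     \int[leb]_(t in `]0, +oo[) (landau y0 N t * h t).
    by apply: le_Rintegral => // t /=; rewrite in_itv/= andbT => /pw.
  have -> : \int[leb]_(t in `]0, +oo[) (landau y0 N t * h t) = 0.
    rewrite -[RHS](landau_orthogonal N y00 y01 hi h0 0).
    by apply: eq_Rintegral => t _; rewrite mul0r oppr0 expR0 mulr1.
  rewrite RintegralB// !RintegralZl//.
  have -> : \int[leb]_(t in `]0, +oo[) (\1_J t : R) = t2 - t1.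
    have -> : \int[leb]_(t in `]0, +oo[) \1_J t = fine (leb (J `&` `]0, +oo[)).
      by rewrite /Rintegral; congr fine; apply: integral_indic; exact: measurable_itv.
    rewrite setIidl; last first.
      move=> t; rewrite /J/= !in_itv/= andbT => /andP[t1t _].
      by rewrite (lt_le_trans _ t1t)// /t1; lra.
    by rewrite /J lebesgue_measure_itv/= lte_fin t12.
  by rewrite subr_le0 -mulrA.
pose q := b / a.
have q1 : `|q| < 1 by rewrite ger0_norm ?divr_ge0 ?(ltW a0)// ltr_pdivrMr// mul1r.
have A0 : 0 < e * (t2 - t1) by rewrite mulr_gt0// subr_gt0.
have : (fun N => q ^+ N * B) @ \oo --> (0 : R).
  by rewrite -(mul0r B); apply: cvgMl; exact: cvg_expr.
move=> /cvgrPdist_lt/(_ _ A0)[N _ /(_ N (leqnn N))] /=.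
rewrite sub0r normrN => /(le_lt_trans (ler_norm _)).
have -> : q ^+ N * B = b ^+ N * B / a ^+ N by rewrite /q exprMn exprVn mulrAC.
by rewrite ltr_pdivrMr ?exprn_gt0// ltNge mulrC main.
Qed.

(** The sign lemma is applied to f - g and to g - f. The weight e^-t makes the difference
    integrable, and turns the vanishing integer moments into equality of the transforms at the
    points n + 1. Right-continuity is the only regularity asked for, so that distribution functions
    qualify. *)
Lemma laplace_inj (f g : R -> R) (t0 : R) : 0 < t0 ->
  measurable_fun `](0 : R), +oo[ f -> measurable_fun `](0 : R), +oo[ g ->
  (forall t, 0 < t -> 0 <= f t) -> (forall t, 0 < t -> 0 <= g t) ->
  (forall th : R, 0 < th -> (\int[leb]_(t in `]0%R, +oo[) (expR (- (th * t)) * f t)%:E < +oo)%E) ->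
  (forall th : R, 0 < th -> (\int[leb]_(t in `]0%R, +oo[) (expR (- (th * t)) * f t)%:E =
     \int[leb]_(t in `]0%R, +oo[) (expR (- (th * t)) * g t)%:E)%E) ->
  f x @[x --> t0^'+] --> f t0 -> g x @[x --> t0^'+] --> g t0 ->
  f t0 = g t0.
Proof.
move=> t00 mf mg f0 g0 foo fg cf cg.
have me (th : R) D : measurable_fun D (fun t : R => expR (- (th * t))).
  by apply: measurable_funTS; apply: continuous_measurable_fun; exact: continuous_expRN.
have ii (k : R -> R) (th : R) : measurable_fun `](0 : R), +oo[ k -> (forall t, 0 < t -> 0 <= k t) ->
    (\int[leb]_(t in `]0%R, +oo[) (expR (- (th * t)) * k t)%:E < +oo)%E ->
    leb.-integrable `]0, +oo[ (EFin \o (fun t => expR (- (th * t)) * k t)).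
  move=> mk k0 koo; apply: ge0_integrable => //.
    by apply: measurable_funM => //; exact: me.
  by move=> t /=; rewrite in_itv/= andbT => t_gt0; rewrite mulr_ge0 ?expR_ge0 ?k0.
have fi (th : R) : 0 < th -> leb.-integrable `]0, +oo[ (EFin \o (fun t => expR (- (th * t)) * f t)).
  by move=> th0; apply: ii => //; exact: foo.
have gi (th : R) : 0 < th -> leb.-integrable `]0, +oo[ (EFin \o (fun t => expR (- (th * t)) * g t)).
  by move=> th0; apply: ii => //; rewrite -fg//; exact: foo.
have sub (k1 k2 : R -> R) (th : R) t : expR (- (th * t)) * (k1 t - k2 t) =
  expR (- (th * t)) * k1 t - expR (- (th * t)) * k2 t by rewrite mulrBr.
wlog suff main : f g mf mg f0 g0 foo fg cf cg fi gi / f t0 - g t0 <= 0.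
  apply/eqP; rewrite eq_le -subr_le0 main//= -subr_le0 main// => th th0.
    by rewrite -fg//; exact: foo.
  by rewrite fg.
apply: (laplace_orthogonal_sign t00 (D := fun t => f t - g t)) => //.
- have : leb.-integrable `]0, +oo[ (EFin \o (fun t => expR (- (1 * t)) * f t - expR (- (1 * t)) * g t)).
    exact: integrableB (fi 1 ltr01) (gi 1 ltr01).
  by apply: eq_integrable => // t _; rewrite /= -sub mul1r.
- move=> n; have n0 : 0 < n%:R + 1 :> R by rewrite ltr_wpDl.
  transitivity (\int[leb]_(t in `]0, +oo[) (expR (- ((n%:R + 1) * t)) * f t - expR (- ((n%:R + 1) * t)) * g t)).
    apply: eq_Rintegral => t _; rewrite -sub mulrA -expRD.
    by congr (expR _ * _); rewrite mulrDl opprD mul1r.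
  rewrite RintegralB//; [|exact: fi|exact: gi].
  by rewrite /Rintegral fg// subrr.
- exact: cvgB.
Qed.

End laplace_uniqueness.

(** * Independent time changes *)

Lemma cvg_dominated d (T : measurableType d) (R : realType)
    (m : {measure set T -> \bar R}) (D : set T) (mD : measurable D)
    (f_ : nat -> T -> \bar R) (f g : T -> \bar R) :
  (forall n, measurable_fun D (f_ n)) -> measurable_fun D f ->
  {ae m, forall x, D x -> f_ ^~ x @ \oo --> f x} -> m.-integrable D g ->
  {ae m, forall x n, D x -> (`|f_ n x| <= g x)%E} ->
  (\int[m]_(x in D) f_ n x)%E @[n --> \oo] --> (\int[m]_(x in D) f x)%E.
Proof. by move=> mf_ mf ff ig fg; have [] := dominated_convergence mD mf_ mf ff ig fg. Qed.

Section complete_probability.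
Context d (T : measurableType d) (R : realType) (P : probability T R).
Hypothesis Pc : measure_is_complete P.

Lemma ae_measurable_set (A B : set T) : measurable A ->
  {ae P, forall w, A w <-> B w} -> measurable B /\ P B = P A.
Proof.
move=> mA AB.
have mAB : measurable (A `\` B).
  by apply: Pc; apply: negligibleS AB => w [Aw Bw] /= h; apply: Bw; apply/h.
have nAB : P.-negligible (A `\` B).
  by apply: negligibleS AB => w [Aw Bw] /= h; apply: Bw; apply/h.
have nBA : P.-negligible (B `\` A).
  by apply: negligibleS AB => w [Bw Aw] /= h; apply: Aw; apply/h.
have mBA : measurable (B `\` A) by exact: Pc.
have BE : B = (A `\` (A `\` B)) `|` (B `\` A).
  by apply/seteqP; split => w /=; have := EM (A w); have := EM (B w); tauto.
have UE : B `|` (A `\` B) = A `|` (B `\` A).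
  by apply/seteqP; split => w /=; have := EM (A w); have := EM (B w); tauto.
have mB : measurable B by rewrite BE; apply: measurableU => //; exact: measurableD.
split => //.
rewrite -(@measureU0 _ _ _ P B (A `\` B))//; last exact/negligibleP.
by rewrite UE measureU0//; exact/negligibleP.
Qed.

Lemma ae_probability1 (A : set T) : {ae P, forall w, A w} -> measurable A /\ P A = 1%E.
Proof.
move=> Aae; rewrite -(probability_setT P); apply: ae_measurable_set => //.
by apply: filterS Aae => w Aw; split.
Qed.

End complete_probability.

Section time_change.
Context d (T : measurableType d) (R : realType) (P : probability T R).
Hypothesis Pc : measure_is_complete P.

(** The first multiple of 1/(n+1) strictly above x. Rounding goes upward because the paths are
    controlled only from the right. *)
Let tau_approx (n : nat) (x : R) : R := (Num.truncn (n.+1%:R * x)).+1%:R / n.+1%:R.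

Let tau_approx_gt n x : 0 <= x -> x < tau_approx n x <= x + n.+1%:R^-1.
Proof.
move=> x0; have nx0 : 0 <= n.+1%:R * x by rewrite mulr_ge0.
have /andP[h1 h2] := truncn_itv nx0.
rewrite /tau_approx ltr_pdivlMr// mulrC h2/= ler_pdivrMr// mulrDl mulVf// -natr1 [x * _]mulrC.
by rewrite lerD2r.
Qed.

Let tau_approx_cvg x : 0 <= x -> tau_approx ^~ x @ \oo --> x^'+.
Proof.
move=> x0 A [e /= e0 eA].
have : harmonic @ \oo --> (0 : R) by exact: cvg_harmonic.
move=> /cvgrPdist_lt/(_ _ e0); apply: filterS => n.
rewrite sub0r normrN /harmonic ger0_norm ?invr_ge0// => ne.
have /andP[h1 h2] := tau_approx_gt n x0.
apply: eA => //=; rewrite ltr0_norm ?subr_lt0// opprB ltrBlDl.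
by rewrite (le_lt_trans h2)// ltrD2l.
Qed.

Let I (n j : nat) : set R := `[j%:R / n.+1%:R, j.+1%:R / n.+1%:R[%classic.

Let IE n j x : 0 <= x -> I n j x <-> Num.truncn (n.+1%:R * x) = j.
Proof.
move=> x0; have nx0 : 0 <= n.+1%:R * x by rewrite mulr_ge0.
rewrite /I /= in_itv/= ler_pdivrMr// ltr_pdivlMr// ![x * _]mulrC -truncn_eq//.
by split => [/eqP//|->].
Qed.

Let I_ge0 n j x : I n j x -> 0 <= x.
Proof. by rewrite /I/= in_itv/= => /andP[+ _]; apply: le_trans; rewrite divr_ge0. Qed.

(** [Z s] stands for the event that the outer process is in a given state at time s, with
    probability [zeta s]. The extra event [C] carries independence through the composition, for the
    sake of a further time change. *)
Variables (Z : R -> set T) (tau : T -> R) (C : set T) (zeta : R -> R).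
Hypothesis mZ : forall s, 0 <= s -> measurable (Z s).
Hypothesis mtau : measurable_fun setT tau.
Hypothesis mC : measurable C.
Hypothesis tau0 : {ae P, forall w, 0 <= tau w}.
Hypothesis Zrc : {ae P, forall w, \forall s \near (tau w)^'+, Z s w <-> Z (tau w) w}.
Hypothesis PZ : forall s, 0 <= s -> P (Z s) = (zeta s)%:E.
Hypothesis zrc : forall s, 0 <= s -> zeta x @[x --> s^'+] --> zeta s.
Hypothesis indep : forall s a b, 0 <= s ->
  (P (Z s `&` (tau @^-1` `[a, b[ `&` C)) = P (Z s) * (P (tau @^-1` `[a, b[) * P C))%E.

Let D : set T := tau @^-1` `[0, +oo[.

Let mD : measurable D.
Proof. by rewrite -[D]setTI; apply: mtau => //. Qed.

Let Dge0 w : D w = (0 <= tau w) :> Prop.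
Proof. by rewrite /D /= in_itv/= andbT. Qed.

Let J n j : set T := tau @^-1` (I n j).

Let mJ n j : measurable (J n j).
Proof. by rewrite -[J n j]setTI; apply: mtau => //; exact: measurable_itv. Qed.

Let tJ n : trivIset setT (J n).
Proof.
apply/trivIsetP => i j _ _ /eqP ij; rewrite -subset0 => w [hi hj]; have t0 := I_ge0 hi.
by apply: ij; rewrite -(proj1 (IE n i t0) hi) -(proj1 (IE n j t0) hj).
Qed.

Let DJ n : D = \bigcup_j J n j.
Proof.
apply/seteqP; split => [w|w [j _ /I_ge0]]; rewrite Dge0// => t0.
by exists (Num.truncn (n.+1%:R * tau w)) => //; apply/IE.
Qed.

Let zeta01 s : 0 <= s -> 0 <= zeta s <= 1.
Proof.
by move=> s0; rewrite -!lee_fin -PZ// measure_ge0/= probability_le1//; exact: mZ.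
Qed.

(** The event with the random time rounded to the grid. It is a countable union over grid cells,
    hence measurable from the measurability of each [Z s] alone, without joint measurability in
    time. *)
Let En n : set T := \bigcup_j (Z (j.+1%:R / n.+1%:R) `&` J n j).

Let mEn n : measurable (En n).
Proof.
apply: bigcupT_measurable => j; apply: measurableI => //; apply: mZ.
by rewrite divr_ge0.
Qed.

Let EnE n w : 0 <= tau w -> En n w <-> Z (tau_approx n (tau w)) w.
Proof.
move=> t0; split => [[j _ [Zw /(IE _ _ t0) E]]|Zw]; first by rewrite /tau_approx E.
by exists (Num.truncn (n.+1%:R * tau w)) => //; split => //; exact/IE.
Qed.

Let E : set T := [set w | Z (tau w) w].

Let En_cvg : {ae P, forall w, 0 <= tau w /\ \forall n \near \oo, En n w <-> E w}.
Proof.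
apply: filterS2 tau0 Zrc => w t0 /(tau_approx_cvg t0) h; split => //.
have h' : \forall n \near \oo, Z (tau_approx n (tau w)) w <-> Z (tau w) w := h.
by apply: filterS h' => n hn; rewrite -[E w]/(Z (tau w) w) -hn; exact: EnE.
Qed.

(** Almost surely [E] coincides with the lower limit of the sets [En]; completeness turns this into
    measurability. *)
Let mE : measurable E.
Proof.
have mA : measurable (\bigcup_N \bigcap_(n in [set n | (N <= n)%N]) En n).
  by apply: bigcupT_measurable => N; apply: bigcap_measurable => //; exists N => /=.
apply: (proj1 (ae_measurable_set Pc mA _)).
apply: filterS En_cvg => w [_ [N _ NE]]; split => [[M _ ME]|Ew].
  by apply/(NE (maxn N M)); [exact: leq_maxl|apply: ME; exact: leq_maxr].
by exists N => // n Nn; apply/NE.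
Qed.

Let zeta_approx n w : R := zeta (tau_approx n (tau w)).

Let zeta_approxJ n j w : J n j w -> zeta_approx n w = zeta (j.+1%:R / n.+1%:R).
Proof. by move=> /[dup] /I_ge0 t0 /(IE _ _ t0) jE; rewrite /zeta_approx /tau_approx jE. Qed.

Let mzeta_approx n : measurable_fun D (zeta_approx n).
Proof.
move=> _ Y mY; rewrite [X in measurable X](_ : _ =
    \bigcup_(j in [set j | Y (zeta (j.+1%:R / n.+1%:R))]) J n j).
  exact: bigcup_measurable.
apply/seteqP; split => [w [Dw Yw]|w [j /= Yj Jw]].
  move: (Dw); rewrite (DJ n) => -[j _ Jw]; exists j => //=.
  by rewrite -(zeta_approxJ Jw).
by split; [rewrite Dge0; exact: I_ge0 Jw|rewrite /= (zeta_approxJ Jw)].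
Qed.

Let zeta_approx_cvg w : D w -> zeta_approx ^~ w @ \oo --> zeta (tau w).
Proof.
by rewrite Dge0 => t0; apply: cvg_comp (zrc t0); exact: tau_approx_cvg.
Qed.

Lemma measurable_time_change : measurable_fun D (zeta \o tau).
Proof. exact: (measurable_fun_cvg mzeta_approx). Qed.

Let PEn n : (P (En n `&` C) = (\int[P]_(w in D) (zeta_approx n w)%:E) * P C)%E.
Proof.
rewrite setIC /En setI_bigcupr measure_semi_bigcup; last 3 first.
- by move=> j; apply: measurableI => //; apply: measurableI => //; apply: mZ; rewrite divr_ge0.
- exact/trivIset_setIl/trivIset_setIl/tJ.
- apply: bigcupT_measurable => j.
  by apply: measurableI => //; apply: measurableI => //; apply: mZ; rewrite divr_ge0.
have -> : (\int[P]_(w in D) (zeta_approx n w)%:E = \sum_(j <oo) (zeta (j.+1%:R / n.+1%:R))%:E * P (J n j))%E.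
  rewrite (DJ n) ge0_integral_bigcup//; last 2 first.
  - by rewrite -(DJ n); apply/measurable_EFinP; exact: mzeta_approx.
  - rewrite -(DJ n) => w; rewrite Dge0 => t0; rewrite lee_fin.
    by have /andP[] := zeta01 (ltW (le_lt_trans t0 (proj1 (andP (tau_approx_gt n t0))))).
  apply: eq_eseriesr => j _; rewrite -integral_cst//; apply: eq_integral => w /set_mem Jw.
  by rewrite (zeta_approxJ Jw).
rewrite muleC.
have z0 (j : nat) : 0 <= zeta (j.+1%:R / n.+1%:R).
  have s0 : 0 <= j.+1%:R / n.+1%:R :> R by rewrite divr_ge0.
  by have /andP[] := zeta01 s0.
have PC : P C = (fine (P C))%:E by rewrite fineK// fin_num_measure.
rewrite [in RHS]PC -nneseriesZl//; last by move=> j _; rewrite mule_ge0 ?lee_fin.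
apply: eq_eseriesr => j _.
have s0 : 0 <= j.+1%:R / n.+1%:R :> R by rewrite divr_ge0.
have indepJ : (P (Z (j.+1%:R / n.+1%:R) `&` (J n j `&` C)) =
    P (Z (j.+1%:R / n.+1%:R)) * (P (J n j) * P C))%E by exact: indep.
have -> : C `&` (Z (j.+1%:R / n.+1%:R) `&` J n j) = Z (j.+1%:R / n.+1%:R) `&` (J n j `&` C).
  by rewrite setIC setIA.
apply: (etrans indepJ); rewrite -PC PZ// [RHS]muleCA; congr (_ * _)%E.
by rewrite muleC.
Qed.

(** For the rounded time the identity is independence summed over the grid cells. Right-continuity
    of the paths on one side and of [zeta] on the other allow dominated convergence as the grid is
    refined. *)
Lemma probability_time_change : measurable E /\
  (P (E `&` C) = (\int[P]_(w in D) (zeta (tau w))%:E) * P C)%E.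
Proof.
split => //.
have h1 : (fun n => P (En n `&` C)) @ \oo --> P (E `&` C).
  have iE (A : set T) : measurable A -> (P (A `&` C) = \int[P]_(w in C) (\1_A w)%:E)%E.
    by move=> mA; rewrite integral_indic.
  rewrite iE//; under eq_fun do rewrite iE//.
  apply: (@cvg_dominated _ _ _ P C mC (fun n w => (\1_(En n) w)%:E) _ (cst 1%E)) => //.
  - by move=> n; apply/measurable_EFinP; exact: measurable_indic.
  - by apply/measurable_EFinP; exact: measurable_indic.
  - apply: filterS En_cvg => w [_ h] _; apply: cvg_near_cst.
    apply: filterS h => n h; congr EFin; rewrite !indicE; congr (nat_of_bool _)%:R.
    by apply/idP/idP => /set_mem/h/mem_set.
  - exact: finite_measure_integrable_cst.
  - apply: aeW => w n _; rewrite /= lee_fin indicE ger0_norm//.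
    by case: (_ \in _).
have h2 : (fun n => (\int[P]_(w in D) (zeta_approx n w)%:E) * P C)%E @ \oo -->
    ((\int[P]_(w in D) (zeta (tau w))%:E) * P C)%E.
  apply: cvgeZr; first exact: fin_num_measure.
  apply: (@cvg_dominated _ _ _ P D mD (fun n w => (zeta_approx n w)%:E) _ (cst 1%E)) => //.
  - by move=> n; apply/measurable_EFinP; exact: mzeta_approx.
  - by apply/measurable_EFinP; exact: measurable_time_change.
  - apply: aeW => w Dw; apply: cvg_EFin; first exact: nearW.
    exact: zeta_approx_cvg.
  - exact: finite_measure_integrable_cst.
  - apply: aeW => w n; rewrite Dge0 => t0; rewrite /= lee_fin.
    have /andP[t1 _] := tau_approx_gt n t0.
    by have /andP[z1 z2] := zeta01 (ltW (le_lt_trans t0 t1)); rewrite ger0_norm.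
have EE : (fun n => P (En n `&` C)) = (fun n => (\int[P]_(w in D) (zeta_approx n w)%:E) * P C)%E.
  by apply/funext => n; exact: PEn.
by rewrite EE in h1; exact: (cvg_unique _ h1 h2).
Qed.

End time_change.

(** * Families of laws with generating function exp(- s psi(u)) *)

Section exponential_families.
Context {R : realType}.
Implicit Types (zeta : nat -> R -> R) (psi : R -> R).

(** The one-dimensional laws, at all times s >= 0, of an integer-valued process whose generating
    function is exponential in time, without reference to the process. The bounds 0 and 1 provide
    the positivity for Tonelli and the uniform bound for the convergence of coefficients. *)
Definition expfam zeta psi : Prop := forall s, 0 <= s ->
  (forall k, 0 <= zeta k s <= 1) /\ genfun (zeta ^~ s) (fun u => expR (- (psi u * s))).

(** The generating functions are continuous in time and the coefficients follow. The filter is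
    arbitrary so as to cover right limits at any s >= 0 and two-sided limits at s > 0. *)
Lemma expfam_cvg zeta psi (X : set_system R) {FX : Filter X} (s : R) k :
  expfam zeta psi -> 0 <= s -> (\forall x \near X, 0 <= x) -> X --> s ->
  zeta k x @[x --> X] --> zeta k s.
Proof.
move=> ez s0 X0 Xs.
have [z01 zs] := ez s s0.
apply: (genfun_coef_cvg (a := fun x k => zeta k x) (F := fun x u => expR (- (psi u * x))) (M := 1) _ _ zs).
- apply: filterS X0 => x x0; have [x01 zx] := ez x x0; split => // j.
  by have /andP[h1 h2] := x01 j; rewrite ger0_norm.
- by move=> j; have /andP[h1 h2] := z01 j; rewrite ger0_norm.
- by move=> u _ _; apply: cvg_trans (@continuous_expRN _ (psi u) s); exact: cvg_app Xs.
Qed.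

Lemma expfam_right_continuous zeta psi (s : R) k : expfam zeta psi -> 0 <= s ->
  zeta k x @[x --> s^'+] --> zeta k s.
Proof.
move=> ez s0; apply: (@expfam_cvg zeta psi _ _ s k ez s0).
  by near=> x; apply: (le_trans s0); near: x; exact: nbhs_right_ge.
exact: cvg_at_right_filter.
Unshelve. all: by end_near. Qed.

Lemma expfam_continuous zeta psi (s : R) k : expfam zeta psi -> 0 < s ->
  {for s, continuous (zeta k)}.
Proof.
move=> ez s0; apply: (@expfam_cvg zeta psi _ _ s k ez (ltW s0)) => //.
by near=> x; apply: ltW; near: x; exact: lt_nbhsr.
Unshelve. all: by end_near. Qed.

Lemma measurable_expfam zeta psi k : expfam zeta psi -> measurable_fun `[(0 : R), +oo[ (zeta k).
Proof.
move=> ez; apply/measurable_fun_itv_obnd_cbndP.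
by apply: continuous_measurable_itvoy => x x0; exact: expfam_continuous ez x0.
Qed.

(** The Poisson formula without a case distinction on the rate: at s = 0 it is the unit mass at 0,
    which covers time 0. *)
Definition poisson_family (k : nat) (s : R) : R := s ^+ k * k`!%:R^-1 * expR (- s).

Lemma poisson_pmfE (k : nat) (s : R) : 0 < s -> poisson_pmf s k = poisson_family k s.
Proof. by move=> s0; rewrite /poisson_pmf s0. Qed.

Lemma poisson_family_genfun (s u : R) : 
  [series poisson_family k s * u ^+ k]_k @ \oo --> expR (- ((1 - u) * s)).
Proof.
have -> : [series poisson_family k s * u ^+ k]_k = (fun n => expR (- s) * series (exp_coeff (s * u)) n).
  apply/funext => n; rewrite /series/= big_distrr/=; apply: eq_bigr => k _.
  by rewrite /poisson_family /exp_coeff/= exprMn; ring.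
have -> : - ((1 - u) * s) = - s + s * u by ring.
rewrite expRD; apply: cvgMr.
by apply: is_cvg_series_exp_coeff.
Qed.

Lemma poisson_expfam : expfam poisson_family (fun u => 1 - u).
Proof.
move=> s s0; split; last by move=> u _ _; exact: poisson_family_genfun.
have p0 k : 0 <= poisson_family k s by rewrite !mulr_ge0 ?exprn_ge0 ?expR_ge0.
move=> k; rewrite p0/=.
(* At u = 1 the series says that the weights sum to 1, so each of them is at most 1. *)
have h := @poisson_family_genfun s 1; rewrite subrr mul0r oppr0 expR0 in h.
rewrite -(cvg_lim (@Rhausdorff R) h).
apply: limr_ge; first exact: cvgP h.
near=> n; have kn : (k < n)%N by near: n; exists k.+1.
rewrite /series/= (bigD1_seq k)/= ?iota_uniq ?mem_index_iota//.
rewrite expr1n mulr1 lerDl sumr_ge0// => i _.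
by rewrite mulr_ge0 ?exprn_ge0.
Unshelve. all: by end_near. Qed.

End exponential_families.

Section expfam_mixture.
Context d (T : measurableType d) (R : realType).
Variables (m : {measure set T -> \bar R}) (D : set T) (mD : measurable D).
Variables (zeta : nat -> R -> R) (psi : R -> R).
Hypothesis ez : expfam zeta psi.
Variables (h tau : T -> R).
Hypotheses (mh : measurable_fun D h) (h0 : forall w, D w -> 0 <= h w).
Hypotheses (mtau : measurable_fun D tau) (tau0 : forall w, D w -> 0 <= tau w).
Hypothesis Foo : forall u : R, 0 < u -> u < 1 ->
  (\int[m]_(w in D) (h w * expR (- (psi u * tau w)))%:E < +oo)%E.

Lemma measurable_expfam_comp k : measurable_fun D (fun w => zeta k (tau w)).
Proof.
apply: (@measurable_comp _ _ _ _ _ _ `[(0 : R), +oo[ (zeta k)) => //.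
- by move=> _ [w /tau0 t0 <-]; rewrite /= in_itv/= andbT.
- exact: measurable_expfam ez.
Qed.

(** The weight [h] serves in turn for the exponential density, for the kernel of the
    Riemann-Liouville integral and for the variable W. *)
Lemma expfam_mixture :
  (forall k, m.-integrable D (EFin \o (fun w => h w * zeta k (tau w)))) /\
  genfun (fun k => \int[m]_(w in D) (h w * zeta k (tau w)))
    (fun u => \int[m]_(w in D) (h w * expR (- (psi u * tau w)))).
Proof.
apply: (@genfun_integral _ _ _ m D mD (fun k w => h w * zeta k (tau w))
  (fun u w => h w * expR (- (psi u * tau w)))) => //.
- by move=> k; apply: measurable_funM => //; exact: measurable_expfam_comp.
- move=> k w Dw; have [/(_ k)/andP[z0 _] _] := ez (tau0 Dw).
  by rewrite mulr_ge0// h0.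
- by move=> w Dw; have [_ g] := ez (tau0 Dw); exact: genfunZ g.
Qed.

End expfam_mixture.

Section expfam_time_change.
Context d (T : measurableType d) (R : realType) (P : probability T R).
Hypothesis Pc : measure_is_complete P.
Variables (Z : nat -> R -> set T) (tau : T -> R) (zeta : nat -> R -> R) (psi : R -> R).
Hypothesis psi0 : forall u, 0 < u -> u < 1 -> 0 <= psi u.
Hypothesis ez : expfam zeta psi.
Hypothesis mZ : forall k s, 0 <= s -> measurable (Z k s).
Hypothesis mtau : measurable_fun setT tau.
Hypothesis tau0 : {ae P, forall w, 0 <= tau w}.
Hypothesis Zrc : {ae P, forall w, forall k, \forall s \near (tau w)^'+, Z k s w <-> Z k (tau w) w}.
Hypothesis PZ : forall k s, 0 <= s -> P (Z k s) = (zeta k s)%:E.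

Let D : set T := tau @^-1` `[0, +oo[.

Let mD : measurable D.
Proof. by rewrite -[D]setTI; apply: mtau. Qed.

Let DE w : D w -> 0 <= tau w.
Proof. by rewrite /D /= in_itv/= andbT. Qed.

Let Foo (u : R) : 0 < u -> u < 1 ->
  (\int[P]_(w in D) (expR (- (psi u * tau w)))%:E < +oo)%E.
Proof.
move=> u0 u1; apply: (@le_lt_trans _ _ (\int[P]_(w in D) (cst 1%E) w)%E).
  apply: ge0_le_integral => //.
  - apply/measurable_EFinP; apply: measurable_funTS; apply: measurableT_comp.
      exact: measurable_expR.
    by apply: measurableT_comp => //; apply: measurable_funM.
  - move=> w Dw; rewrite lee_fin expR_le1 oppr_le0 mulr_ge0// ?psi0//.
    exact: DE.
by rewrite integral_cst//= mul1e (le_lt_trans (probability_le1 P mD))// ltry.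
Qed.

Lemma genfun_time_change :
  (forall k, P.-integrable D (EFin \o (fun w => zeta k (tau w)))) /\
  genfun (fun k => \int[P]_(w in D) zeta k (tau w))
    (fun u => \int[P]_(w in D) expR (- (psi u * tau w))).
Proof.
apply: (@genfun_integral _ _ _ P D mD (fun k w => zeta k (tau w))
  (fun u w => expR (- (psi u * tau w)))) => //.
- by move=> k; apply: (measurable_expfam_comp ez (measurable_funTS mtau) DE).
- by move=> k w Dw; have [/(_ k)/andP[z0 _] _] := ez (DE Dw).
- by move=> w Dw; have [] := ez (DE Dw).
Qed.

Lemma expfam_time_change (C : set T) k : measurable C ->
  (forall s a b, 0 <= s ->
    (P (Z k s `&` (tau @^-1` `[a, b[ `&` C)) = P (Z k s) * (P (tau @^-1` `[a, b[) * P C))%E) ->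
  measurable [set w | Z k (tau w) w] /\
  (P ([set w | Z k (tau w) w] `&` C) = (\int[P]_(w in D) zeta k (tau w))%:E * P C)%E.
Proof.
move=> mC ind.
have [||mE E] := probability_time_change Pc (mZ k) mtau mC tau0 _ (PZ k) _ ind.
- by apply: filterS Zrc => w; exact.
- by move=> s s0; exact: expfam_right_continuous ez s0.
split => //; rewrite E /Rintegral fineK//.
have [/(_ k) i _] := genfun_time_change.
by apply: (@integrable_fin_num _ _ _ P D mD (fun w => (zeta k (tau w))%:E)).
Qed.

End expfam_time_change.

Lemma measurable_lteif d (T : measurableType d) (R : realType) (D : set T)
    (f g : T -> R) (b : bool) : measurable D ->
  measurable_fun D f -> measurable_fun D g ->
  measurable_fun D (fun w => (f w < g w ?<= if b)%:R : R).
Proof.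
move=> mD mf mg.
have mB : measurable_fun D (fun w => f w < g w ?<= if b).
  by case: b => /=; [exact: measurable_fun_ler|exact: measurable_fun_ltr].
rewrite (_ : (fun w => _) = (fun w => if f w < g w ?<= if b then 1 else 0)).
  by apply: measurable_fun_if => //; exact: measurable_cst.
by apply/funext => w; case: ifP.
Qed.

Lemma measurable_fun_fst_setX d1 d2 d3 (T1 : measurableType d1) (T2 : measurableType d2)
    (T3 : measurableType d3) (D1 : set T1) (D2 : set T2) (f : T1 -> T3) :
  measurable D1 -> measurable D2 ->
  measurable_fun D1 f -> measurable_fun (D1 `*` D2) (f \o fst).
Proof.
move=> mD1 mD2 mf; apply: (@measurable_comp _ _ _ _ _ _ D1) => //.
- by move=> _ [[a b] [/= Da _] <-].
- exact: measurable_funTS measurable_fst.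
Qed.

Lemma measurable_fun_snd_setX d1 d2 d3 (T1 : measurableType d1) (T2 : measurableType d2)
    (T3 : measurableType d3) (D1 : set T1) (D2 : set T2) (f : T2 -> T3) :
  measurable D1 -> measurable D2 ->
  measurable_fun D2 f -> measurable_fun (D1 `*` D2) (f \o snd).
Proof.
move=> mD1 mD2 mf; apply: (@measurable_comp _ _ _ _ _ _ D2) => //.
- by move=> _ [[a b] [/= _ Db] <-].
- exact: measurable_funTS measurable_snd.
Qed.

(** * Laplace transforms as integrals of distribution functions *)

Section layer_cake.
Context d (T : measurableType d) (R : realType) (P : probability T R).
Notation leb := (@lebesgue_measure R).

Lemma integral_expRN_ge (c y : R) (b : bool) : 0 < c -> 0 <= y ->
  (\int[leb]_(z in `]0%R, +oo[) (c * expR (- (c * z)) * (y < z ?<= if b)%:R)%:E =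
   (expR (- (c * y)))%:E)%E.
Proof.
move=> c0 y0.
have mf (D : set R) : measurable_fun D (fun z : R => (expR (- (c * z)))%:E).
  apply/measurable_EFinP; apply: measurable_funTS; apply: continuous_measurable_fun.
  exact: continuous_expRN.
have S : `]0, +oo[ `&` [set z | y < z ?<= if b] = [set` Interval (BSide (b && (0 < y)) y) +oo%O].
  apply/seteqP; split => z /=; rewrite !in_itv/= !andbT.
    by move=> [z0]; move: y0; rewrite le_eqVlt => /predU1P[<-|->]; rewrite ?ltxx ?andbF ?andbT.
  move: y0; rewrite le_eqVlt => /predU1P[<-|y0]; rewrite ?ltxx ?andbF ?andbT ?y0 ?andbT.
    by move=> /= z0; split => //; case: b => //=; exact: ltW.
  by move=> yz; split => //; move: yz; case: b => /=; [exact: lt_le_trans|exact: lt_trans].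
transitivity (\int[leb]_(z in `]0%R, +oo[ `&` [set z | (y < z ?<= if b)%R]) (c * expR (- (c * z)))%:E)%E.
  rewrite integral_mkcondr; apply: eq_integral => z _.
  rewrite patchE; case: ifPn => [/set_mem/= ->|]; first by rewrite mulr1.
  by move=> /negP h; have [hz|_] := boolP (y < z ?<= if b); [exfalso; exact/h/mem_set|rewrite mulr0].
rewrite S; transitivity (\int[leb]_(z in `]y, +oo[) (c%:E * (expR (- (c * z)))%:E))%E.
  case: (b && _) => //; rewrite -integral_itv_obnd_cbnd//.
  by apply/measurable_EFinP; apply: measurable_funM => //; exact/measurable_EFinP.
rewrite ge0_integralZl_EFin//; last 2 first.
- exact: mf.
- exact: ltW.
by rewrite integral_expRN// -EFinM mulrC divfK// gt_eqF.
Qed.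

(** Write exp(- c y) as the integral of c exp(- c z) over z > y and exchange the integrals. In this
    way facts about events, such as independence or inclusions, become facts about Laplace
    transforms. The boolean chooses between y <= z and y < z, which give the same integral. *)
Lemma laplace_layer_cake (D : set T) (h y : T -> R) (c : R) (b : bool) : measurable D ->
  measurable_fun D h -> (forall w, D w -> 0 <= h w) ->
  measurable_fun D y -> (forall w, D w -> 0 <= y w) -> 0 < c ->
  (\int[P]_(w in D) (h w * expR (- (c * y w)))%:E =
   \int[leb]_(z in `]0%R, +oo[) ((c * expR (- (c * z)))%:E *
      \int[P]_(w in D `&` [set w | (y w < z ?<= if b)%R]) (h w)%:E))%E.
Proof.
move=> mD mh h0 my y0 c0.
have ce0 (z : R) : 0 <= c * expR (- (c * z)) by rewrite mulr_ge0 ?expR_ge0// ltW.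
have mE (D' : set R) : measurable_fun D' (fun z : R => c * expR (- (c * z))).
  apply: measurable_funM => //; apply: measurable_funTS; apply: continuous_measurable_fun.
  exact: continuous_expRN.
transitivity (\int[P]_(w in D) \int[leb]_(z in `]0%R, +oo[)
    (h w * (c * expR (- (c * z)) * (y w < z ?<= if b)%:R))%:E)%E.
  apply: eq_integral => w /set_mem Dw.
  under [RHS]eq_integral do rewrite EFinM.
  rewrite ge0_integralZl_EFin//.
  - by rewrite integral_expRN_ge// ?EFinM// y0.
  - by move=> z _; rewrite lee_fin mulr_ge0.
  - apply/measurable_EFinP; apply: measurable_funM => //.
      exact: mE.
    by apply: measurable_lteif.
  - exact: h0.
rewrite (@tonelli_sets _ _ _ _ _ P leb D `]0%R, +oo[%classic mD _
  (fun w z => (h w * (c * expR (- (c * z)) * (y w < z ?<= if b)%:R))%:E)%E)//.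
- apply: eq_integral => z _.
  have -> : (\int[P]_(w in D `&` [set w | (y w < z ?<= if b)%R]) (h w)%:E =
      \int[P]_(w in D) (h w * (y w < z ?<= if b)%:R)%:E)%E.
    rewrite integral_mkcondr; apply: eq_integral => w _.
    rewrite patchE; case: ifPn => [/set_mem/= ->|]; first by rewrite mulr1.
    move=> /negP hz; have [hz'|_] := boolP (y w < z ?<= if b); last by rewrite mulr0.
    by exfalso; exact/hz/mem_set.
  rewrite -ge0_integralZl ?lee_fin//.
  + by apply: eq_integral => w _; rewrite -EFinM mulrCA mulrA.
  + apply/measurable_EFinP; apply: measurable_funM => //.
    by apply: measurable_lteif.
  + by move=> w Dw; rewrite lee_fin mulr_ge0// h0.
- apply/measurable_EFinP.
  have mF : measurable (D `*` `](0 : R), +oo[%classic) by apply: measurableX.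
  apply: measurable_funM; first exact: measurable_fun_fst_setX.
  apply: measurable_funM.
    apply: (measurable_fun_snd_setX (f := fun z => c * expR (- (c * z)))) => //; exact: mE.
  apply: (measurable_lteif (f := y \o fst) (g := snd)) => //.
    exact: measurable_fun_fst_setX.
  exact: measurable_funTS measurable_snd.
- by move=> w z Dw z0; rewrite lee_fin !mulr_ge0 ?h0 ?expR_ge0 ?(ltW c0).
Qed.

End layer_cake.

(** * Expectation of a product of exponentials of independent variables *)

Section compound_poisson.
Context d (T : measurableType d) (R : realType) (P : probability T R).
Notation leb := (@lebesgue_measure R).
Variables (A : set T) (Y : nat -> T -> R) (F : R -> R) (c rho : R).
Hypotheses (mA : measurable A) (c0 : 0 < c) (rho0 : 0 <= rho).
Hypothesis mY : forall k, (1 <= k)%N -> measurable_fun setT (Y k).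
Hypothesis Y0 : forall w k, A w -> (1 <= k)%N -> 0 <= Y k w.
Hypotheses (F0 : forall z, 0 <= F z) (mF : measurable_fun `](0 : R), +oo[ F).
Hypothesis Frho : (\int[leb]_(z in `]0%R, +oo[) (c * expR (- (c * z)) * F z)%:E = rho%:E)%E.

Let D n m (z : nat -> R) : set T :=
  A `&` [set w | forall k, (n < k)%N -> (k <= n + m)%N -> Y k w <= z k].

Hypothesis indep : forall m z,
  (P (D 0 m z) = P A * (\prod_(1 <= k < m.+1) F (z k))%:E)%E.

Let mD n m z : measurable (D n m z).
Proof.
apply: measurableI => //.
rewrite (_ : [set w | _] = \bigcap_(k in [set k | (n < k <= n + m)%N]) (Y k @^-1` `]-oo, z k])).
  apply: bigcap_measurableType => k /= /andP[nk _]; rewrite -[_ @^-1` _]setTI.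
  by apply: mY => //; exact: leq_ltn_trans nk.
apply/seteqP; split => w /=.
  by move=> h k /= /andP[nk km]; rewrite in_itv/=; exact: h.
by move=> h k nk km; have := h k; rewrite /= in_itv/= nk km; exact.
Qed.

Let DS n m z x : D n.+1 m z `&` [set w | Y n.+1 w <= x] =
  D n m.+1 (fun k => if k == n.+1 then x else z k).
Proof.
apply/seteqP; split => w /=.
  move=> [[Aw h] hx]; split => // k nk km; case: eqVneq => [->//|kn].
  by apply: h; [rewrite ltn_neqAle eq_sym kn|rewrite addSnnS].
move=> [Aw h]; split; [split => //|].
  move=> k nk km; have := h k (ltnW nk); rewrite -addSnnS => /(_ km).
  by rewrite gtn_eqF.
by have := h n.+1 (ltnSn n); rewrite eqxx; apply; rewrite -addSnnS leq_addr.
Qed.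

Let prod_ge0 n w : 0 <= \prod_(1 <= k < n.+1) expR (- (c * Y k w)).
Proof. by apply: prodr_ge0 => k _; exact: expR_ge0. Qed.

Let mprod n (E : set T) : measurable_fun E (fun w => \prod_(1 <= k < n.+1) expR (- (c * Y k w))).
Proof.
apply: measurable_funTS; rewrite /index_iota subSS subn0.
elim: n => [|n IHn]; first by under eq_fun do rewrite big_nil; exact: measurable_cst.
rewrite -[n.+1]addn1 iotaD; under eq_fun do rewrite big_cat/= big_seq1.
apply: measurable_funM => //; apply: measurableT_comp; first exact: measurable_expR.
by apply: measurableT_comp => //; apply: measurable_funM => //; apply: mY; rewrite add1n.
Qed.

(** Independence is given for events Y_k <= z_k. The last exponential factor is traded, through the
    layer cake formula, for one more such event, then integrated against the exponential kernel to
    give [rho]. The induction on the number n of remaining factors must therefore allow an arbitrary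
    number m of events already produced. *)
Lemma integral_prod_expR n m z :
  (\int[P]_(w in D n m z) (\prod_(1 <= k < n.+1) expR (- (c * Y k w)))%:E =
   P A * (rho ^+ n * \prod_(n.+1 <= k < (n + m).+1) F (z k))%:E)%E.
Proof.
have PA : P A = (fine (P A))%:E by rewrite fineK// fin_num_measure.
elim: n m z => [|n IHn] m z.
  under eq_integral do rewrite big_nil.
  by rewrite integral_cst//= mul1e indep expr0 mul1r.
under eq_integral do rewrite big_nat_recr//=.
rewrite (laplace_layer_cake P true)//; last 2 first.
- exact/measurable_funTS/mY.
- by move=> w [Aw _]; exact: Y0.
under eq_integral do rewrite /= DS IHn.
set K := \prod_(n.+2 <= k < (n.+1 + m).+1) F (z k).
have KE x : \prod_(n.+1 <= k < (n + m.+1).+1) F (if k == n.+1 then x else z k) = F x * K.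
  rewrite big_ltn ?ltnS ?addnS ?ltnS ?leq_addr// eqxx -addSn; congr (_ * _).
  by apply: eq_big_nat => k /andP[nk _]; rewrite gtn_eqF.
have K0 : 0 <= K by rewrite /K; apply: prodr_ge0 => k _.
transitivity (\int[leb]_(x in `]0%R, +oo[) ((fine (P A) * rho ^+ n * K)%:E * (c * expR (- (c * x)) * F x)%:E))%E.
  apply: eq_integral => x _; rewrite KE [in LHS]PA -!EFinM; congr EFin; ring.
rewrite ge0_integralZl_EFin//; last 3 first.
- by move=> x _; rewrite lee_fin !mulr_ge0 ?expR_ge0// ltW.
- apply/measurable_EFinP; apply: measurable_funM => //; apply: measurable_funM => //.
  by apply: measurable_funTS; apply: continuous_measurable_fun; exact: continuous_expRN.
- by rewrite !mulr_ge0 ?exprn_ge0// fine_ge0.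
by rewrite Frho [in RHS]PA -!EFinM; congr EFin; rewrite exprS; ring.
Qed.

End compound_poisson.

(** * The inverse of a stable subordinator *)

Lemma measurable_lteif_cst d (T : measurableType d) (R : realType) (D : set T)
    (X : T -> R) (z : R) (b : bool) : measurable D -> measurable_fun D X ->
  measurable (D `&` [set w | X w < z ?<= if b]).
Proof.
move=> mD mX; rewrite (_ : [set w | _] = X @^-1` [set` Interval -oo%O (BSide (~~ b) z)]).
  by apply: mX => //; exact: measurable_itv.
by apply/seteqP; split => w; rewrite /= in_itv/=; case: b.
Qed.

Lemma measurable_le_cst d (T : measurableType d) (R : realType) (X : T -> R) (z : R) :
  measurable_fun setT X -> measurable [set w | X w <= z].
Proof. by move=> mX; have := measurable_lteif_cst z true measurableT mX; rewrite setTI. Qed.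

Lemma probability_le_layer d (T : measurableType d) (R : realType) (P : probability T R)
    (D : set T) (X : T -> R) (c : R) (b : bool) :
  measurable D -> measurable_fun D X -> (forall w, D w -> 0 <= X w) -> 0 < c ->
  (\int[P]_(w in D) (expR (- (c * X w)))%:E =
   \int[@lebesgue_measure R]_(z in `]0%R, +oo[) ((c * expR (- (c * z)))%:E *
      P (D `&` [set w | (X w < z ?<= if b)%R])))%E.
Proof.
move=> mD mX X0 c0.
have := laplace_layer_cake P b mD (@measurable_cst _ _ _ _ D (1 : R)) (fun _ _ => ler01) mX X0 c0.
under eq_integral do rewrite /cst mul1r.
move=> ->; apply: eq_integral => z _; congr (_ * _)%E.
by rewrite /cst integral_cst ?mul1e//; exact: measurable_lteif_cst.
Qed.

Lemma measurable_probability_le_layer d (T : measurableType d) (R : realType)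
    (P : probability T R) (D : set T) (X : T -> R) (c : R) (b : bool) (E : set R) :
  measurable E -> measurable D -> measurable_fun D X ->
  measurable_fun E (fun z => (c * expR (- (c * z)))%:E *
      P (D `&` [set w | (X w < z ?<= if b)%R]))%E.
Proof.
move=> mE mD mX.
apply: emeasurable_funM.
  apply/measurable_EFinP; apply: measurable_funM => //; apply: measurable_funTS.
  by apply: continuous_measurable_fun; exact: continuous_expRN.
have mS z := measurable_lteif_cst z b mD mX.
rewrite (_ : (fun z => _) = EFin \o (fun z => fine (P (D `&` [set w | X w < z ?<= if b])))).
  apply/measurable_EFinP; apply: measurable_funTS; apply: nondecreasing_measurable => // s t st.
  rewrite fine_le ?fin_num_measure//; apply: le_measure; rewrite ?inE//.
  move=> w [Dw /= ws]; split => //=; move: ws; case: (b) => /= ws; first exact: le_trans ws st.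
  exact: lt_le_trans ws st.
by apply/funext => z /=; rewrite fineK// fin_num_measure.
Qed.

Lemma probability_setIT d (T : measurableType d) (R : realType) (P : probability T R)
    (A B : set T) : measurable A -> measurable B -> P B = 1%E -> P (A `&` B) = P A.
Proof.
move=> mA mB PB; have nB : P (~` B) = 0%E by rewrite probability_setC// PB subee.
rewrite -[in RHS](setIT A) -(setUv B) setIUr measureU0//.
- exact: measurableI.
- by apply: measurableI => //; exact: measurableC.
- apply/eqP; rewrite eq_le measure_ge0 andbT -nB; apply: le_measure; rewrite ?inE//.
  + by apply: measurableI => //; exact: measurableC.
  + exact: measurableC.
Qed.

Section distribution_function.
Context d (T : measurableType d) (R : realType) (P : probability T R).
Variable X : T -> R.
Hypothesis mX : measurable_fun setT X.

Let X' : {RV P >-> R} := HB.pack X (isMeasurableFun.Build _ _ _ _ X mX).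

Let cdfE t : P [set w | X w <= t] = cdf X' t.
Proof.
by rewrite /cdf /distribution/= /pushforward; congr (P _).
Qed.

Lemma measurable_cdf_fine : measurable_fun setT (fun t => fine (P [set w | X w <= t])).
Proof.
apply: nondecreasing_measurable => // s t st; rewrite !cdfE.
by rewrite fine_le ?fin_num_measure// cdf_nondecreasing.
Qed.

Lemma cdf_fine_right_continuous t :
  fine (P [set w | X w <= x]) @[x --> t^'+] --> fine (P [set w | X w <= t]).
Proof.
under eq_fun do rewrite cdfE; rewrite cdfE.
apply: fine_cvg; rewrite fineK ?fin_num_measure//.
exact: cdf_right_continuous.
Qed.

(** Reduces equality of distribution functions, which are right-continuous, to equality of Laplace
    transforms. *)
Lemma cdf_laplace (th : R) : {ae P, forall w, 0 <= X w} -> 0 < th ->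
  (\int[@lebesgue_measure R]_(t in `]0%R, +oo[) (expR (- (th * t)) * fine (P [set w | (X w <= t)%R]))%:E =
   th^-1%:E * \int[P]_w (expR (- (th * X w)))%:E)%E.
Proof.
(* The variable is nonnegative only almost surely, whereas the layer cake formula asks for it
   everywhere. *)
move=> X0 th0; pose Y w := Num.max (X w) 0.
have mY : measurable_fun setT Y by apply: measurable_maxr.
have Y0 w : 0 <= Y w by rewrite le_max lexx orbT.
have -> : (\int[P]_w (expR (- (th * X w)))%:E = \int[P]_w (expR (- (th * Y w)))%:E)%E.
  have me (Z : T -> R) : measurable_fun setT Z -> measurable_fun setT (fun w => (expR (- (th * Z w)))%:E).
    move=> mZ; apply/measurable_EFinP; apply: measurableT_comp; first exact: measurable_expR.
    by apply: measurableT_comp => //; apply: measurable_funM.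
  apply: ae_eq_integral => //; [exact: me|exact: me|].
  by apply: filterS X0 => w Xw _; rewrite /Y; congr (expR (- (th * _)))%:E; rewrite max_l.
rewrite (probability_le_layer P true measurableT mY)//.
rewrite -ge0_integralZl//; last 3 first.
- exact: measurable_probability_le_layer.
- by move=> z _; rewrite mule_ge0// lee_fin mulr_ge0 ?expR_ge0// ltW.
- by rewrite lee_fin invr_ge0 ltW.
apply: eq_integral => z; rewrite inE/= in_itv/= andbT => z0.
rewrite setTI muleA -EFinM mulrA mulVf ?gt_eqF// mul1r EFinM fineK ?fin_num_measure//; last exact: measurable_le_cst.
congr (_ * P _)%E; apply/seteqP; split => w /=; rewrite /Y ge_max ?(ltW z0) ?andbT//.
Qed.

End distribution_function.

Section inverse_stable.
Context d (T : measurableType d) (R : realType) (P : probability T R).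
Notation leb := (@lebesgue_measure R).
Hypothesis Pc : measure_is_complete P.
Variables (nu : R) (A : R -> T -> R).
Hypothesis nu0 : 0 < nu.
Hypothesis mA : forall z, 0 <= z -> measurable_fun setT (A z).
Hypothesis A0 : {ae P, forall w, A 0 w = 0}.
Hypothesis Amono : {ae P, forall w, forall s t, 0 <= s -> s <= t -> A s w <= A t w}.
Hypothesis AL : forall z th, 0 <= z -> 0 <= th ->
  (\int[P]_w (expR (- (th * A z w)))%:E = (expR (- (th `^ nu * z)))%:E)%E.

Let mAle z t : 0 <= z -> measurable [set w | A z w <= t].
Proof.
move=> z0; rewrite -[X in measurable X]setTI (_ : [set w | _] = A z @^-1` `]-oo, t]).
  by apply: mA.
by apply/seteqP; split => w /=; rewrite in_itv.
Qed.

Let mexpA c z : 0 <= z -> measurable_fun setT (fun w => (expR (- (c * A z w)))%:E).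
Proof.
move=> z0; apply/measurable_EFinP; apply: measurableT_comp; first exact: measurable_expR.
by apply: measurableT_comp => //; apply: measurable_funM => //; exact: mA.
Qed.

(** Markov's inequality for exp(- th A(z)). *)
Lemma stable_chernoff z t th : 0 <= z -> 0 <= th ->
  (P [set w | (A z w <= t)%R] <= (expR (th * t - th `^ nu * z))%:E)%E.
Proof.
move=> z0 th0; rewrite expRD EFinM -AL// -ge0_integralZl_EFin//; last exact: mexpA.
rewrite -[leLHS]mul1e -integral_cst//; last exact: mAle.
apply: (@le_trans _ _ (\int[P]_(w in [set w | (A z w <= t)%R]) ((expR (th * t))%:E * (expR (- (th * A z w)))%:E))%E).
  apply: ge0_le_integral => //; first exact: mAle.
  - apply: measurable_funTS; apply: emeasurable_funM => //; exact: mexpA.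
  - move=> w /= At; rewrite -EFinM lee_fin -expRD -expR0 ler_expR subr_ge0.
    by rewrite ler_wpM2l.
apply: ge0_subset_integral => //; first exact: mAle.
- by apply: emeasurable_funM => //; exact: mexpA.
Qed.

(** At t = 0 and th = x^(1/nu) the Chernoff bound is exp(- x z), which tends to 0 as x grows. *)
Lemma stable_gt0 z : 0 < z -> {ae P, forall w, 0 < A z w}.
Proof.
move=> z0; exists [set w | A z w <= 0]; split; first exact/mAle/ltW.
  set p := P _; have p1 : (p <= 1)%E by exact: probability_le1 (mAle _ (ltW z0)).
  have p0 : (0 <= p)%E by exact: measure_ge0.
  have pfin : p \is a fin_num by rewrite ge0_fin_numE// (le_lt_trans p1) ?ltry.
  have pth x : 0 < x -> fine p <= expR (- (x * z)).
    move=> x0; have th0 : 0 <= x `^ nu^-1 by exact: powR_ge0.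
    rewrite -lee_fin fineK// (le_trans (stable_chernoff 0 (ltW z0) th0))//.
    by rewrite mulr0 sub0r -powRrM mulVf ?gt_eqF// powRr1// ltW.
  apply/eqP; rewrite -(fineK pfin) eqe; apply/negPn/negP => pn0.
  have pp : 0 < fine p by rewrite lt_neqAle eq_sym pn0/= fine_ge0.
  have lp : ln (fine p) <= 0 by rewrite ln_le0// -lee_fin fineK.
  (* For this x the bound reads p <= p / e. *)
  have := pth ((1 - ln (fine p)) / z); rewrite divfK ?gt_eqF//.
  have -> : 0 < (1 - ln (fine p)) / z by rewrite divr_gt0//; lra.
  move=> /(_ erefl); rewrite opprB -[leLHS]lnK ?posrE// ler_expR; lra.
by move=> w /= /negP; rewrite -leNgt.
Qed.

(** The Chernoff bound at th = 1 is exp(t - n) for every n. This ensures that the set defining the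
    inverse is almost surely nonempty. *)
Lemma stable_unbounded t : {ae P, forall w, exists n : nat, t < A n%:R w}.
Proof.
pose B := \bigcap_(n : nat) [set w | A n%:R w <= t].
have mB : measurable B by apply: bigcapT_measurable => n; exact: mAle.
exists B; split => //; last first.
  by move=> w /= h n _ /=; rewrite leNgt; apply/negP => hn; apply: h; exists n.
set p := P _; have p1 : (p <= 1)%E by exact: probability_le1.
have p0 : (0 <= p)%E by exact: measure_ge0.
have pfin : p \is a fin_num by rewrite ge0_fin_numE// (le_lt_trans p1) ?ltry.
have pn (n : nat) : fine p <= expR (t - n%:R).
  rewrite -lee_fin fineK//.
  apply: (@le_trans _ _ (P [set w | A n%:R w <= t])).
    by apply: le_measure; rewrite ?inE//; [exact: mAle|move=> w; exact].
  have := @stable_chernoff n%:R t 1 (ler0n _ _) ler01.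
  by rewrite powR1 !mul1r.
apply/eqP; rewrite -(fineK pfin) eqe; apply/negPn/negP => pn0.
have pp : 0 < fine p by rewrite lt_neqAle eq_sym pn0/= fine_ge0.
(* Once n > t - ln p, the bound exp(t - n) falls below p. *)
have := pn (Num.truncn (t - ln (fine p))).+1.
rewrite -[leLHS]lnK ?posrE// ler_expR leNgt => /negP; apply.
by rewrite ltrBlDl -ltrBlDr truncnS_gt.
Qed.

Lemma stable_ge0 : {ae P, forall w, forall z, 0 <= z -> 0 <= A z w}.
Proof.
by apply: filterS2 A0 Amono => w Aw0 Aw z z0; rewrite -Aw0; exact: Aw.
Qed.

Let L := inverse_process A.

Lemma inverse_process_ge0 t w : 0 <= L t w.
Proof.
rewrite /L /inverse_process; have [->|/set0P[x]] := eqVneq [set z : R | 0 <= z /\ t < A z w] set0.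
  (* The infimum of the empty set is 0 by convention. *)
  by rewrite inf0.
by move=> hx; apply: lb_le_inf; [exists x|move=> y []].
Qed.

Lemma inverse_process_le t z w : 0 <= z -> t < A z w -> L t w <= z.
Proof.
by move=> z0 tz; apply: ge_inf => //; exists 0 => y [].
Qed.

(** The witness is rational so that the event L t < z becomes a countable union of events about the
    subordinator. *)
Lemma lt_inverse_process t z w : (forall s t, 0 <= s -> s <= t -> A s w <= A t w) ->
  (exists n : nat, t < A n%:R w) -> L t w < z ->
  exists q : rat, [/\ 0 <= (ratr q : R), (ratr q : R) < z & t < A (ratr q) w].
Proof.
move=> Am [n tn] Lz.
have hi : [set z : R | 0 <= z /\ t < A z w] !=set0 by exists n%:R; split.
have [x [x0 tx] xz] := inf_lt hi Lz.
have [q] := rat_in_itvoo xz; rewrite in_itv/= => /andP[xq qz].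
exists q; split => //; first exact: le_trans x0 (ltW xq).
by rewrite (lt_le_trans tx)// Am// ltW.
Qed.

Lemma inverse_process0 : {ae P, forall w, L 0 w = 0}.
Proof.
have h : {ae P, forall w, forall n : nat, 0 < A n.+1%:R^-1 w}.
  by apply/ae_foralln => n; apply: stable_gt0; rewrite invr_gt0.
apply: filterS h => w h; apply/eqP; rewrite eq_le inverse_process_ge0 andbT.
apply/ler_addgt0Pl => e e0; rewrite addr0.
have [n ne] : exists n : nat, n.+1%:R^-1 < e.
  exists (Num.truncn e^-1); rewrite -[ltRHS]invrK ltf_pV2 ?posrE ?invr_gt0//.
  exact: truncnS_gt.
by rewrite (le_trans _ (ltW ne))//; apply: inverse_process_le => //; rewrite invr_ge0.
Qed.

(** The event L t < z agrees with a countable union over rational times only where the path is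
    monotone and unbounded, that is almost surely; completeness does the rest. *)
Lemma measurable_inverse_process t : measurable_fun setT (L t).
Proof.
move=> _; apply: (measurability _ (RGenInftyO.measurableE R)) => //.
move=> _ [_ [z ->] <-]; rewrite setTI.
pose B := \bigcup_(q in [set q : rat | 0 <= (ratr q : R) < z]) ~` [set w | A (ratr q) w <= t].
have mB : measurable B.
  rewrite /B bigcup_mkcond; apply: bigcupT_measurable_rat => q.
  case: ifPn => [/set_mem/= /andP[q0 _]|_]; last exact: measurable0.
  by apply: measurableC; exact: mAle.
apply: (proj1 (ae_measurable_set Pc mB _)).
apply: filterS2 Amono (stable_unbounded t) => w Am An; split.
  move=> [q /= /andP[q0 qz] /= /negP]; rewrite -ltNge => tA.
  by rewrite in_itv/=; apply: le_lt_trans qz; exact: inverse_process_le.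
rewrite /= in_itv/= => Lz; have [q [q0 qz tA]] := lt_inverse_process Am An Lz.
by exists q => /=; [rewrite q0 qz|apply/negP; rewrite -ltNge].
Qed.

Let mAlt z t : 0 <= z -> measurable [set w | t < A z w].
Proof.
move=> z0; rewrite (_ : [set w | _] = ~` [set w | A z w <= t]).
  by apply: measurableC; exact: mAle.
by apply/seteqP; split => w /=; rewrite ltNge => /negP.
Qed.

Let G : set T := [set w | 0 < A 1 w].

Let mG : measurable G. Proof. exact: mAlt. Qed.

Let PG : P G = 1%E.
Proof. by have [] := ae_probability1 Pc (stable_gt0 ltr01). Qed.

(** Both variables have Laplace transform exp(- th^nu z), and distribution functions are
    right-continuous, so uniqueness of Laplace transforms applies. *)
Lemma stable_scaling z t : 0 < z -> 0 < t ->
  P [set w | A z w <= t] = P [set w | z `^ nu^-1 * A 1 w <= t].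
Proof.
move=> z0 t0.
have mz : measurable_fun setT (A z) by exact/mA/ltW.
have mX : measurable_fun setT (fun w => z `^ nu^-1 * A 1 w).
  by apply: measurable_funM => //; exact: mA.
have m1 x : measurable [set w | z `^ nu^-1 * A 1 w <= x] by exact: measurable_le_cst.
rewrite -[LHS]fineK ?fin_num_measure//; last exact/mAle/ltW.
rewrite -[RHS]fineK ?fin_num_measure//; congr EFin.
have X0 : {ae P, forall w, 0 <= z `^ nu^-1 * A 1 w}.
  by apply: filterS stable_ge0 => w h; rewrite mulr_ge0 ?powR_ge0// h.
have Az0 : {ae P, forall w, 0 <= A z w}.
  by apply: filterS stable_ge0 => w; apply; exact: ltW.
have lap (th : R) : 0 < th -> (\int[P]_w (expR (- (th * (z `^ nu^-1 * A 1 w))))%:E =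
    \int[P]_w (expR (- (th * A z w)))%:E)%E.
  move=> th0; transitivity (expR (- (th `^ nu * z)))%:E; last by rewrite AL// ltW.
  have thz : 0 <= th * z `^ nu^-1 by rewrite mulr_ge0 ?powR_ge0// ltW.
  transitivity (\int[P]_w (expR (- ((th * z `^ nu^-1) * A 1 w)))%:E)%E.
    by apply: eq_integral => w _; rewrite mulrA.
  rewrite (AL ler01 thz); congr (expR _)%:E.
  by rewrite powRM ?powR_ge0 ?(ltW th0)// -powRrM mulVf ?gt_eqF// powRr1 ?(ltW z0)// mulr1.
apply: (@laplace_inj _ (fun t => fine (P [set w | A z w <= t]))
  (fun t => fine (P [set w | z `^ nu^-1 * A 1 w <= t]))) => //.
- by apply: measurable_funTS; exact: measurable_cdf_fine.
- by apply: measurable_funTS; exact: measurable_cdf_fine.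
- by move=> ? _; rewrite fine_ge0.
- by move=> ? _; rewrite fine_ge0.
- move=> th th0; rewrite cdf_laplace// (AL (ltW z0) (ltW th0)).
  by rewrite -EFinM ltry.
- by move=> th th0; rewrite !cdf_laplace// lap.
- exact: cdf_fine_right_continuous.
- exact: cdf_fine_right_continuous.
Qed.

Definition inverse_scale (w : T) : R := A 1 w `^ (- nu).

Lemma measurable_inverse_scale : measurable_fun setT inverse_scale.
Proof. by apply: (@measurableT_comp _ _ _ _ _ _ (fun x => x `^ (- nu))); [exact: measurable_powR|exact: mA]. Qed.

Lemma inverse_scale_lt w (t z : R) : 0 < A 1 w -> 0 < t -> 0 < z ->
  (t `^ nu * inverse_scale w < z) = (t < z `^ nu^-1 * A 1 w).
Proof.
move=> a0 t0 z0; rewrite /inverse_scale powRN ltr_pdivrMr ?powR_gt0//.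
have zE : z = (z `^ nu^-1) `^ nu by rewrite -powRrM mulVf ?gt_eqF// powRr1// ltW.
rewrite {1}zE -powRM ?powR_ge0 ?(ltW a0)//.
apply/idP/idP => [|h].
  apply: contraTT; rewrite -!leNgt => h.
  by apply: ge0_ler_powR => //; rewrite ?nnegrE ?mulr_ge0 ?powR_ge0 ?(ltW a0) ?(ltW t0) ?(ltW nu0).
by apply: gt0_ltr_powR => //; rewrite ?nnegrE ?mulr_ge0 ?powR_ge0 ?(ltW a0) ?(ltW t0).
Qed.

(** Almost surely {L t < z} is contained in {t < A z}, which is contained in {L t <= z}, and by
    scaling the middle event has the probability of {t^nu W < z}. The layer cake formula, with
    strict inequality for one bound and large inequality for the other, gives the two inequalities
    between the transforms; no continuity of the law of L is involved. *)
Lemma inverse_process_laplace c t : 0 < c -> 0 < t ->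
  (\int[P]_w (expR (- (c * L t w)))%:E =
   \int[P]_(w in G) (expR (- (c * (t `^ nu * inverse_scale w))))%:E)%E.
Proof.
move=> c0 t0.
have mL := measurable_inverse_process t.
have ce0 z : (0 <= (c * expR (- (c * z)))%:E)%E by rewrite lee_fin mulr_ge0 ?expR_ge0// ltW.
have mce (D : set R) : measurable_fun D (fun z : R => (c * expR (- (c * z)))%:E).
  apply/measurable_EFinP; apply: measurable_funM => //; apply: measurable_funTS.
  by apply: continuous_measurable_fun; exact: continuous_expRN.
have mW : measurable_fun G (fun w => t `^ nu * inverse_scale w).
  by apply: measurable_funTS; apply: measurable_funM => //; exact: measurable_inverse_scale.
have tAE z : 0 < z ->
    P (G `&` [set w | t `^ nu * inverse_scale w < z]) = P [set w | t < A z w].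
  move=> z0; have mX : measurable_fun setT (fun w => z `^ nu^-1 * A 1 w).
    by apply: measurable_funM => //; exact: mA.
  have -> : G `&` [set w | t `^ nu * inverse_scale w < z] =
      G `&` ~` [set w | z `^ nu^-1 * A 1 w <= t].
    apply/seteqP; split => w /= [g].
      by rewrite inverse_scale_lt// ltNge => /negP.
    by move=> /negP; rewrite -ltNge inverse_scale_lt.
  rewrite setIC probability_setIT//; last first.
    by apply: measurableC; exact: measurable_le_cst.
  have -> : [set w | t < A z w] = ~` [set w | A z w <= t].
    by apply/seteqP; split => w /=; rewrite ltNge => /negP.
  rewrite !probability_setC ?stable_scaling//; first exact/mAle/ltW.
  exact: measurable_le_cst.
have cdfL (b : bool) := probability_le_layer P b measurableT mL (fun w _ => inverse_process_ge0 t w) c0.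
rewrite (probability_le_layer P false mG mW)//; last first.
  by move=> w _; rewrite mulr_ge0 ?powR_ge0.
apply/eqP; rewrite eq_le; apply/andP; split.
  rewrite (cdfL false); apply: ge0_le_integral => //.
  - by move=> z _; rewrite mule_ge0.
  - exact: measurable_probability_le_layer.
  - exact: measurable_probability_le_layer.
  - move=> z; rewrite /= in_itv/= andbT => z0; rewrite lee_pmul// tAE// setTI.
    have mLz : measurable [set w | L t w < z].
      by have := measurable_lteif_cst z false measurableT mL; rewrite setTI.
    have mtA := mAlt t (ltW z0).
    have [_ ->] : measurable [set w | L t w < z] /\
        P [set w | L t w < z] = P ([set w | L t w < z] `&` [set w | t < A z w]).
      apply: (ae_measurable_set Pc); first exact: measurableI.
      apply: filterS2 Amono (stable_unbounded t) => w Am An; split=> [[]//|/= Lz].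
      split => //=; have [q [q0 qz tA]] := lt_inverse_process Am An Lz.
      by rewrite (lt_le_trans tA)// Am// ltW.
    by apply: le_measure; rewrite ?inE//; exact: measurableI.
rewrite (cdfL true); apply: ge0_le_integral => //.
- by move=> z _; rewrite mule_ge0.
- exact: measurable_probability_le_layer.
- exact: measurable_probability_le_layer.
- move=> z; rewrite /= in_itv/= andbT => z0; rewrite lee_pmul// tAE//.
  apply: le_measure; rewrite ?inE//; first exact/mAlt/ltW.
    rewrite setTI; exact: measurable_le_cst.
  by move=> w /= tA; split => //; exact: inverse_process_le (ltW z0) tA.
Qed.

End inverse_stable.

Lemma exponential_prob_lt0 (R : realType) (beta : R) : exponential_prob beta `]-oo, 0[ = 0%E.
Proof.
by apply: integral0_eq => x /=; rewrite in_itv/= => x0; rewrite lt0_exponential_pdf.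
Qed.

Lemma exponential_prob_le (R : realType) (beta z : R) : 0 < beta -> 0 < z ->
  exponential_prob beta `]-oo, z] = (1 - expR (- (beta * z)))%:E.
Proof.
move=> b0 z0; have /= e := exponential_prob_itv0c beta z0.
rewrite EFinB -mulNr -e /exponential_prob.
rewrite [in LHS](_ : `]-oo, z]%classic = `]-oo, 0[%classic `|` `[0, z]%classic); last first.
  by rewrite -itv_bndbnd_setU// bnd_simp ltW.
rewrite ge0_integral_setU//; first by have := exponential_prob_lt0 beta; rewrite /exponential_prob => ->; rewrite add0e.
- by apply/measurable_EFinP; apply: measurable_funTS; exact: measurable_exponential_pdf.
- by move=> x _; rewrite lee_fin exponential_pdf_ge0// ltW.
- apply/disj_setPS => x [] /=; rewrite !in_itv/= => x0 /andP[x0' _].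
  by move: (lt_le_trans x0 x0'); rewrite ltxx.
Qed.

(** * The Laplace transform of a compound Poisson sum *)

Section compound_laplace.
Context d (T : measurableType d) (R : realType) (P : probability T R).
Notation leb := (@lebesgue_measure R).
Variables (N : T -> nat) (Y : nat -> T -> R) (F : R -> R) (beta m c : R).
Hypotheses (beta0 : 0 < beta) (c0 : 0 < c).
Hypothesis mN : forall n, measurable [set w | N w = n].
Hypothesis PN : forall n, P [set w | N w = n] = (poisson_family n m)%:E.
Hypothesis mY : forall k, (1 <= k)%N -> measurable_fun setT (Y k).
Hypothesis F0 : forall z, 0 <= F z.
Hypothesis FE : forall z, 0 < z -> F z = 1 - expR (- (beta * z)).

Let G : set T := [set w | forall k, (1 <= k)%N -> 0 <= Y k w].

Hypothesis PG : P G = 1%E.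
Hypothesis indep : forall n M z,
  (P ([set w | N w = n] `&` [set w | forall k, (0 < k)%N -> (k <= M)%N -> (Y k w <= z k)%R]) =
   P [set w | N w = n] * (\prod_(1 <= k < M.+1) F (z k))%:E)%E.

Let mG : measurable G.
Proof.
rewrite (_ : G = \bigcap_(k in [set k | (1 <= k)%N]) (Y k @^-1` `[0, +oo[)).
  by apply: bigcap_measurableType => k /= k1; rewrite -[_ @^-1` _]setTI; apply: mY.
by apply/seteqP; split => w h k k1; have := h k k1; rewrite /= in_itv/= andbT.
Qed.

(** The Laplace transform at c of the exponential law of parameter beta. *)
Let rho : R := beta / (beta + c).

Let Frho : (\int[leb]_(z in `]0%R, +oo[) (c * expR (- (c * z)) * F z)%:E = rho%:E)%E.
Proof.
have bc0 : 0 < beta + c by rewrite addr_gt0.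
have mE (e : R) D : measurable_fun D (fun z : R => (expR (- (e * z)))%:E).
  apply/measurable_EFinP; apply: measurable_funTS; apply: continuous_measurable_fun.
  exact: continuous_expRN.
have ie (e : R) : 0 < e -> leb.-integrable `]0, +oo[ (fun z : R => (expR (- (e * z)))%:E).
  move=> e0; apply/integrableP; split; first exact: mE.
  under eq_integral do rewrite gee0_abs ?lee_fin ?expR_ge0//.
  by rewrite integral_expRN// ltry.
transitivity (\int[leb]_(z in `]0%R, +oo[) (c%:E * ((expR (- (c * z)))%:E - (expR (- ((beta + c) * z)))%:E)))%E.
  apply: eq_integral => z; rewrite inE/= in_itv/= andbT => z0.
  rewrite -EFinB -EFinM FE//; congr EFin.
  by rewrite mulrDl opprD expRD; ring.
rewrite integralZl//; last exact: integrableB (ie _ c0) (ie _ bc0).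
rewrite integralB//; [|exact: ie|exact: ie].
rewrite !integral_expRN// !mulr0 oppr0 expR0 -EFinB -EFinM /rho; congr EFin.
by field; rewrite !gt_eqF.
Qed.

(** On {N = n} the exponential of the sum is a product of n factors and contributes the n-th Poisson
    weight times rho^n. Summation over n gives exp(- (1 - rho) m), and 1 - rho = c / (beta + c). *)
Lemma compound_laplace :
  (\int[P]_(w in G) (expR (- (c * \sum_(1 <= k < (N w).+1) Y k w)))%:E =
   (expR (- (c / (beta + c) * m)))%:E)%E.
Proof.
have bc0 : 0 < beta + c by rewrite addr_gt0.
have rho0 : 0 <= rho by rewrite divr_ge0// ltW.
have mF : measurable_fun `](0 : R), +oo[ F.
  apply: (eq_measurable_fun (fun z => 1 - expR (- (beta * z)))).
    by move=> z; rewrite inE/= in_itv/= andbT => z0; rewrite FE.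
  apply: measurable_funB => //; apply: measurable_funTS; apply: continuous_measurable_fun.
  exact: continuous_expRN.
pose E n := [set w | N w = n] `&` G.
have mE n : measurable (E n) by exact: measurableI.
have GE : G = \bigcup_n E n.
  apply/seteqP; split => w; first by move=> Gw; exists (N w).
  by move=> [n _ []].
have mprod n (D : set T) : measurable_fun D (fun w => (\prod_(1 <= k < n.+1) expR (- (c * Y k w)))%:E).
  apply/measurable_EFinP; apply: measurable_funTS; rewrite /index_iota subSS subn0.
  elim: n => [|n IHn]; first by under eq_fun do rewrite big_nil; exact: measurable_cst.
  rewrite -[n.+1]addn1 iotaD; under eq_fun do rewrite big_cat/= big_seq1.
  apply: measurable_funM => //; apply: measurableT_comp; first exact: measurable_expR.
  by apply: measurableT_comp => //; apply: measurable_funM => //; apply: mY; rewrite add1n.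
have EP n w : E n w -> expR (- (c * \sum_(1 <= k < (N w).+1) Y k w)) =
    \prod_(1 <= k < n.+1) expR (- (c * Y k w)).
  move=> [/= -> _]; rewrite big_distrr/= -sumrN.
  by rewrite (big_morph (@expR R) (@expRD R) (@expR0 R)).
rewrite [in LHS]GE ge0_integral_bigcup//; last 2 first.
- apply/measurable_fun_bigcup => // n.
  apply: eq_measurable_fun (mprod n (E n)) => w /set_mem Ew.
  by rewrite (EP n w Ew).
- by move=> i j _ _ [w [[/= <- _] [/= <- _]]].
have En n : (\int[P]_(w in E n) (expR (- (c * \sum_(1 <= k < (N w).+1) Y k w)))%:E =
    (poisson_family n m * rho ^+ n)%:E)%E.
  under eq_integral => w /set_mem Ew do rewrite (EP n w Ew).
  have Y0 w k : E n w -> (1 <= k)%N -> 0 <= Y k w by move=> [_]; exact.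
  have ind M z : (P (E n `&` [set w | forall k, (0 < k)%N -> (k <= 0 + M)%N -> (Y k w <= z k)%R]) =
      P (E n) * (\prod_(1 <= k < M.+1) F (z k))%:E)%E.
    have mM : measurable [set w | forall k, (0 < k)%N -> (k <= M)%N -> Y k w <= z k].
      rewrite (_ : [set w | _] = \bigcap_(k in [set k | (0 < k <= M)%N]) (Y k @^-1` `]-oo, z k])).
        apply: bigcap_measurableType => k /= /andP[nk _]; rewrite -[_ @^-1` _]setTI.
        exact: mY.
      apply/seteqP; split => w /=.
        by move=> h k /= /andP[nk km]; rewrite in_itv/=; exact: h.
      by move=> h k nk km; have := h k; rewrite /= in_itv/= nk km; exact.
    rewrite /E setIAC probability_setIT//; last exact: measurableI.
    by rewrite indep probability_setIT.
  have := integral_prod_expR (mE n) c0 rho0 mY Y0 F0 mF Frho ind n 0 (fun=> 0).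
  rewrite addn0 big_geq// mulr1 probability_setIT// PN -EFinM => <-.
  congr integral.
  by apply/seteqP; split => // w Ew; split => //= k nk; rewrite leqNgt nk.
under eq_eseriesr do rewrite En.
apply/nneseries_cvgP.
  by move=> k; rewrite mulr_ge0 ?exprn_ge0// -lee_fin -PN.
have := @poisson_family_genfun _ m rho.
have -> : 1 - rho = c / (beta + c) by rewrite /rho; field; rewrite gt_eqF.
by [].
Qed.

End compound_laplace.

(** * The Riemann-Liouville equation *)

Lemma integral_powR_shift_expR (R : realType) (x c t : R) : 0 < x -> x <= 1 -> 0 < c ->
  (\int[@lebesgue_measure R]_(s in `]t, +oo[) ((s - t) `^ (x - 1) * expR (- (c * s)))%:E =
   (Gamma x * (c `^ (- x) * expR (- (c * t))))%:E)%E.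
Proof.
move=> x0 x1 c0; rewrite (@ge0_integration_by_shift _ t); last 2 first.
- move=> s ts; apply: continuousM; last exact: continuous_expRN.
  apply: (@continuous_comp _ _ _ (fun s => s - t) (fun s => s `^ (x - 1))).
    by apply: continuousB; [exact: cvg_id|exact: cvg_cst].
  by apply: continuous_powR; rewrite subr_gt0.
- by move=> s _; rewrite mulr_ge0 ?powR_ge0 ?expR_ge0.
transitivity (\int[@lebesgue_measure R]_(s in `]0%R, +oo[) ((expR (- (c * t)))%:E *
    (s `^ (x - 1) * expR (- (c * s)))%:E))%E.
  apply: eq_integral => s _; rewrite -EFinM; congr EFin.
  by rewrite mulrDr opprD expRD (_ : t + s - t = s); ring.
rewrite ge0_integralZl_EFin//; last 2 first.
- by move=> s _; rewrite lee_fin mulr_ge0 ?powR_ge0 ?expR_ge0.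
- by apply/measurable_EFinP; exact: measurable_gamma_integrand.
by rewrite integral_powR_expR// -EFinM; congr EFin; ring.
Qed.

Lemma genfun_inj_at (R : realType) (a b : nat -> R) (F G : R -> R) k :
  genfun a F -> genfun b G -> (forall u, 0 < u -> u < 1 -> F u = G u) -> a k = b k.
Proof.
move=> aF bG FG; apply: (genfun_inj aF); apply: genfun_ext bG => u u0 u1.
by rewrite FG.
Qed.

Section mixture.
Context {R : realType}.
Notation leb := (@lebesgue_measure R).
Variables (beta : R) (zeta : nat -> R -> R) (psi : R -> R).
Hypothesis beta0 : 0 < beta.
Hypothesis psi0 : forall u, 0 < u -> u < 1 -> 0 <= psi u.
Hypothesis ez : expfam zeta psi.

Definition exp_mixture (k : nat) : R :=
  \int[leb]_(x in `]0, +oo[) (beta * expR (- (beta * x)) * zeta k x).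

Lemma genfun_exp_mixture : genfun exp_mixture (fun u => beta / (beta + psi u)).
Proof.
have bpsi u : 0 < u -> u < 1 -> 0 < beta + psi u by move=> u0 u1; rewrite ltr_wpDr// psi0.
have I u : 0 < u -> u < 1 -> (\int[leb]_(x in `]0%R, +oo[)
    (beta * expR (- (beta * x)) * expR (- (psi u * x)))%:E = (beta / (beta + psi u))%:E)%E.
  move=> u0 u1; transitivity (\int[leb]_(x in `]0%R, +oo[) (beta%:E * (expR (- ((beta + psi u) * x)))%:E))%E.
    by apply: eq_integral => x _; rewrite -EFinM mulrDl opprD expRD mulrA.
  rewrite ge0_integralZl_EFin//; last 2 first.
  - apply/measurable_EFinP; apply: measurable_funTS; apply: continuous_measurable_fun.
    exact: continuous_expRN.
  - exact: ltW.
  by rewrite integral_expRN ?bpsi// mulr0 oppr0 expR0 -EFinM mul1r.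
have := @expfam_mixture _ _ _ leb `]0, +oo[%classic _ zeta psi ez
  (fun x => beta * expR (- (beta * x))) id.
case => //.
- apply: measurable_funM => //; apply: measurable_funTS; apply: continuous_measurable_fun.
  exact: continuous_expRN.
- by move=> x _; rewrite mulr_ge0 ?expR_ge0// ltW.
- by move=> x /=; rewrite in_itv/= andbT => /ltW.
- by move=> u u0 u1; rewrite I// ltry.
move=> _; apply: genfun_ext => u u0 u1.
by rewrite /Rintegral I.
Qed.

End mixture.

Section conv_linearity.
Context {R : realType}.
Implicit Types (a b c : nat -> R).

Lemma convZr a b (x : R) k : conv a (fun i => x * b i) k = x * conv a b k.
Proof. by rewrite /conv big_distrr/=; apply: eq_bigr => j _; rewrite mulrCA. Qed.

Lemma conv_delta a k : conv (fun i => (i == 0%N)%:R) a k = a k.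
Proof.
rewrite /conv big_ord_recl/= mul1r subn0 big1 ?addr0// => i _.
by rewrite /= mul0r.
Qed.

Lemma convN a b k : conv a (fun i => - b i) k = - conv a b k.
Proof. by rewrite /conv -sumrN; apply: eq_bigr => j _; rewrite mulrN. Qed.

Lemma is_derive_conv (a : nat -> R) (x : nat -> R -> R) (dx : nat -> R) (t : R) k :
  (forall i, is_derive t 1 (x i) (dx i)) ->
  is_derive t 1 (fun s => conv a (x ^~ s) k) (conv a dx k).
Proof.
move=> xd; rewrite /conv.
rewrite (_ : (fun s => _) = \sum_(j < k.+1) (a j \*: x (k - j)%N)).
  by apply: is_derive_sum => j; exact: is_deriveZ.
by apply/funext => s; rewrite fct_sumE.
Qed.

Lemma Rintegral_conv d (T : measurableType d) (m : {measure set T -> \bar R}) (D : set T)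
    (g : nat -> T -> R) a k : measurable D -> (forall i, m.-integrable D (EFin \o g i)) ->
  m.-integrable D (EFin \o (fun s => conv a (g ^~ s) k)) /\
  \int[m]_(s in D) conv a (g ^~ s) k = conv a (fun i => \int[m]_(s in D) g i s) k.
Proof.
move=> mD ig.
have ij (j : 'I_k.+1) : m.-integrable D (fun s => (a j * g (k - j)%N s)%:E).
  by under eq_fun do rewrite EFinM; apply: integrableZl => //; exact: ig.
have E s : (conv a (g ^~ s) k)%:E = (\sum_(j < k.+1) (a j * g (k - j)%N s)%:E)%E.
  by rewrite sumEFin.
split.
  rewrite (_ : _ \o _ = fun s => (\sum_(j < k.+1) (a j * g (k - j)%N s)%:E)%E).
    by apply: integrable_sum => // j _; exact: ij.
  exact: funext E.
rewrite /Rintegral; under eq_integral do rewrite E.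
rewrite integral_sum//; transitivity (fine (\sum_(j < k.+1) (\int[m]_(s in D) (a j * g (k - j)%N s))%:E)%E).
  congr fine; apply: eq_bigr => j _; rewrite /Rintegral fineK//.
  exact: integrable_fin_num (ij j).
by rewrite sumEFin/=; apply: eq_bigr => j _; rewrite RintegralZl.
Qed.

End conv_linearity.

Lemma frac_diffE (R : realType) (eta : R) f k :
  frac_diff eta f k = conv (fun j => (-1) ^+ j * gbinom eta j) f k.
Proof. by []. Qed.

Lemma frac_diff0 (R : realType) (eta : R) f : frac_diff eta f 0 = f 0%N.
Proof.
by rewrite /frac_diff big_ord_recl big_ord0 /= addr0 expr0 mul1r /gbinom big_ord0 fact0 divr1 mul1r subn0.
Qed.

(** If Q generates q, then q - b * q is generated by psi Q / (beta + psi), and the claim is beta psi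
    / (beta + psi) = psi - psi^2 / (beta + psi). It converts D q = -+ mu (q - b * q), valid for q
    and for its fractional difference alike, into the equations of the theorem. *)
Lemma frac_diff_mixture (R : realType) (eta beta : R) (b q : nat -> R) (F : R -> R) k :
  0 < eta -> eta < 1 -> 0 < beta ->
  genfun b (fun u => beta / (beta + (1 - u) `^ eta)) -> genfun q F ->
  beta * (q k - conv b q k) =
  frac_diff eta q k - frac_diff eta (fun i => q i - conv b q i) k.
Proof.
move=> eta0 eta1 beta0 gb gq; rewrite !frac_diffE.
have gg := genfun_binomial eta0 eta1.
have gv := genfunB gq (genfun_conv gb gq).
have gr := genfunB (genfun_conv gg gq) (genfun_conv gg gv).
apply: (genfun_inj_at k (@genfunZ _ beta _ _ gv) gr) => u u0 u1 /=.
have : 0 < beta + (1 - u) `^ eta by rewrite ltr_wpDr// powR_ge0.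
by move=> h; field; rewrite gt_eqF.
Qed.

(** * Derivatives of tail integrals *)

Section derivative_of_tail.
Context {R : realType}.
Notation leb := (@lebesgue_measure R).

(** Near t the tail integral is a constant minus the integral from the fixed base point t / 2, to
    which the fundamental theorem of calculus applies. *)
Lemma integrable_itvoy_is_derive (f : R -> R) (t : R) : 0 < t ->
  (forall s, 0 < s -> leb.-integrable `]s, +oo[ (EFin \o f)) ->
  {for t, continuous f} ->
  is_derive t 1 (fun s => \int[leb]_(x in `]s, +oo[) f x) (- f t).
Proof.
move=> t0 fi cf; pose a := t / 2; have a0 : 0 < a by rewrite divr_gt0.
have at_ : a < t by rewrite ltr_pdivrMr// mulr_natr mulr2n ltrDl.
have fs (D : set R) : measurable D -> D `<=` `]a, +oo[ -> leb.-integrable D (EFin \o f).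
  by move=> mD Da; apply: integrableS (fi _ a0).
have tt1 : t < t + 1 by rewrite ltrDl.
have fat : leb.-integrable `]a, (t + 1)] (EFin \o f).
  by apply: fs => // x /=; rewrite !in_itv/= => /andP[->].
have [dF FE] := @continuous_FTC1 R f (BRight a) t (t + 1) tt1 fat at_ cf.
have dF' : is_derive t 1 (fun s => \int[leb]_(x in `]a, +oo[) f x - \int[leb]_(x in `]a, s]) f x) (- f t).
  rewrite -[- f t]sub0r; apply: is_deriveB.
  by apply: DeriveDef => //; rewrite -derive1E.
apply: near_eq_is_derive dF'; near=> s.
have as_ : a < s by near: s; exact: lt_nbhsr.
by apply: (@Rintegral_itvB _ f (BRight a) +oo%O s) => //; [exact: fi|rewrite bnd_simp ltW].
Unshelve. all: by end_near. Qed.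

Fixpoint tail_integral (i : nat) (f : R -> R) : R -> R :=
  if i is j.+1 then fun t => \int[leb]_(x in `]t, +oo[) tail_integral j f x else f.

End derivative_of_tail.

Section derivative_chain.
Context {R : realType}.
Variables (m : nat) (F : R -> R) (H : nat -> R -> R).
Hypothesis F0 : forall t, 0 < t -> F t = H 0 t.
Hypothesis HS : forall j t, (j < m)%N -> 0 < t -> is_derive (t : R) 1 (H j) (H j.+1 t).

(** [F] and [H 0] are known to agree at positive times only; equality passes to derivatives because
    positive times have neighbourhoods of positive times. *)
Lemma derive1n_chain j t : (j <= m)%N -> 0 < t -> derive1n j F t = H j t.
Proof.
elim: j t => [|j IHj] t; first by move=> _; exact: F0.
move=> jm t0; rewrite derive1nS derive1E.
have e : \forall s \near t, H j s = derive1n j F s.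
  by near=> s; rewrite IHj// 1?ltnW//; near: s; exact: lt_nbhsr.
rewrite -(near_eq_derive (1 : R) e).
by have [_ ->] := HS jm t0.
Unshelve. all: by end_near. Qed.

Lemma derivable_chain j t : (j < m)%N -> 0 < t -> derivable (derive1n j F) t 1.
Proof.
move=> jm t0; have e : \forall s \near t, H j s = derive1n j F s.
  by near=> s; rewrite derive1n_chain// 1?ltnW//; near: s; exact: lt_nbhsr.
apply: (near_eq_derivable e).
by have [] := HS jm t0.
Unshelve. all: by end_near. Qed.

End derivative_chain.

Section riemann_liouville_mixture.
Context {R : realType}.
Notation leb := (@lebesgue_measure R).
Variables (beta mu nu : R) (psi : R -> R) (q : nat -> R -> R) (b : nat -> R).
Hypotheses (beta0 : 0 < beta) (mu0 : 0 < mu) (nu1 : 1 < nu).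
Hypothesis psi0 : forall u : R, 0 < u -> u < 1 -> 0 < psi u.

Let c u := mu * (psi u / (beta + psi u)).
Let phi u := c u `^ nu^-1.

Hypothesis eq : expfam q phi.
Hypothesis gb : genfun b (fun u => beta / (beta + psi u)).

Let nu0 : 0 < nu. Proof. exact: lt_trans nu1. Qed.

Let c_gt0 u : 0 < u -> u < 1 -> 0 < c u.
Proof. by move=> u0 u1; rewrite mulr_gt0// divr_gt0// ?addr_gt0 ?psi0. Qed.

Let phi_gt0 u : 0 < u -> u < 1 -> 0 < phi u.
Proof. by move=> u0 u1; rewrite powR_gt0// c_gt0. Qed.

Let y i k := tail_integral i (q k).

Let tail_integrable i :
  (forall t k, 0 < t -> 0 <= y i k t) ->
  (forall t k, 0 < t -> {for t, continuous (y i k)}) ->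
  (forall t, 0 < t -> genfun (fun k => y i k t) (fun u => phi u ^- i * expR (- (phi u * t)))) ->
  forall t, 0 < t -> (forall k, leb.-integrable `]t, +oo[ (EFin \o y i k)) /\
    genfun (fun k => y i.+1 k t) (fun u => phi u ^- i.+1 * expR (- (phi u * t))).
Proof.
move=> y0 yc yg t t0.
have I u : 0 < u -> u < 1 -> (\int[leb]_(x in `]t, +oo[) (phi u ^- i * expR (- (phi u * x)))%:E =
    (phi u ^- i.+1 * expR (- (phi u * t)))%:E)%E.
  move=> u0 u1; under eq_integral do rewrite EFinM.
  rewrite ge0_integralZl_EFin//; last 2 first.
  - apply/measurable_EFinP; apply: measurable_funTS; apply: continuous_measurable_fun.
    exact: continuous_expRN.
  - by rewrite invr_ge0 exprn_ge0// powR_ge0.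
  rewrite integral_expRN ?phi_gt0// -EFinM; congr EFin.
  by rewrite exprSr invfM; ring.
have tx (x : R) : `]t, +oo[%classic x -> 0 < x.
  by rewrite /= in_itv/= andbT; exact: lt_trans.
have [|||||h1 h2] := @genfun_integral _ _ _ leb `]t, +oo[%classic _ (y i)
  (fun u x => phi u ^- i * expR (- (phi u * x))).
- by [].
- move=> k; apply: continuous_measurable_itvoy => x tx'; apply: yc; exact: lt_trans tx'.
- by move=> k x /tx; exact: y0.
- by move=> x /tx; exact: yg.
- by move=> u u0 u1; rewrite I// ltry.
split => //; apply: genfun_ext h2 => u u0 u1.
by rewrite /Rintegral I.
Qed.

(** One tail integral divides the generating function by phi. Integrability at one stage makes the
    next stage differentiable, hence continuous, which is what the stage after it requires. *)
Let tailP i :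
  [/\ forall t k, 0 < t -> 0 <= y i k t,
      forall t k, 0 < t -> {for t, continuous (y i k)} &
      forall t, 0 < t -> genfun (fun k => y i k t) (fun u => phi u ^- i * expR (- (phi u * t)))].
Proof.
elim: i => [|i [y0 yc yg]].
  split => [t k t0|t k t0|t t0].
  - by have [/(_ k)/andP[]] := eq (ltW t0).
  - exact: expfam_continuous eq _.
  - have [_ h] := eq (ltW t0); apply: genfun_ext h => u _ _; by rewrite expr0 invr1 mul1r.
have h (t : R) (t0 : 0 < t) := tail_integrable y0 yc yg t0.
split => [t k t0|t k t0|t t0].
- by apply: Rintegral_ge0 => x /=; rewrite in_itv/= andbT => tx; apply: y0; exact: lt_trans tx.
- apply/differentiable_continuous/derivable1_diffP.
  have [] := @integrable_itvoy_is_derive _ (y i k) t t0 _ (yc t k t0) => //.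
  by move=> s s0; have [+ _] := h s s0; exact.
- by have [] := h t t0.
Qed.

Let tail_is_derive i k (t : R) : 0 < t -> is_derive t 1 (y i.+1 k) (- y i k t).
Proof.
move=> t0; have [y0 yc yg] := tailP i.
apply: integrable_itvoy_is_derive => //; last exact: yc.
by move=> s s0; have [+ _] := tail_integrable y0 yc yg s0; exact.
Qed.

Let m := rl_order nu.
(** The order of the fractional integral. It lies in (0, 1] and equals 1 exactly when nu is an
    integer, since m is the floor of nu plus 1. *)
Let kap : R := m%:R - nu.

Let kap_gt0 : 0 < kap.
Proof. by rewrite subr_gt0; exact: truncnS_gt. Qed.

Let kap_le1 : kap <= 1.
Proof.
rewrite /kap /m /rl_order -natr1 lerBlDr addrC lerD2l.
by rewrite truncn_le// ltW.
Qed.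

Let rl_kernel (t s : R) : (s - t) `^ (nu - m%:R + 1) = ((s - t) `^ (kap - 1))^-1.
Proof. by rewrite -powRN; congr powR; rewrite /kap; ring. Qed.

Let rl_genfun t : 0 < t ->
  (forall k, leb.-integrable `]t, +oo[ (EFin \o rl_integrand nu (q k) t)) /\
  genfun (fun k => rl_integral nu (q k) t)
    (fun u => Gamma kap * (phi u `^ (- kap) * expR (- (phi u * t)))).
Proof.
move=> t0.
have I u : 0 < u -> u < 1 -> (\int[leb]_(s in `]t, +oo[)
    ((s - t) `^ (kap - 1) * expR (- (phi u * s)))%:E =
    (Gamma kap * (phi u `^ (- kap) * expR (- (phi u * t))))%:E)%E.
  by move=> u0 u1; apply: integral_powR_shift_expR => //; exact: phi_gt0.
have [||||||h1 h2] := @expfam_mixture _ _ _ leb `]t, +oo[%classic _ q phi eq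
  (fun s => (s - t) `^ (kap - 1)) id.
- by [].
- apply: (@measurableT_comp _ _ _ _ _ _ (fun x => x `^ (kap - 1))); first exact: measurable_powR.
  exact: measurable_funB.
- by move=> w _; exact: powR_ge0.
- exact: measurable_id.
- by move=> w /=; rewrite in_itv/= andbT => /(lt_trans t0)/ltW.
- by move=> u u0 u1; rewrite I// ltry.
have E k : rl_integrand nu (q k) t = (fun s => (s - t) `^ (kap - 1) * q k s).
  by apply/funext => s; rewrite /rl_integrand rl_kernel invrK mulrC.
split => [k|]; first by rewrite E.
rewrite (_ : (fun k => rl_integral nu (q k) t) = fun k => \int[leb]_(s in `]t, +oo[) ((s - t) `^ (kap - 1) * q k s)).
  by apply: genfun_ext h2 => u u0 u1; rewrite /Rintegral I.
by apply/funext => k; rewrite /rl_integral; congr Rintegral; exact: E.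
Qed.

Let z i t k := y i k t - conv b (fun k => y i k t) k.

Let rl_integralE t k : 0 < t -> rl_integral nu (q k) t = Gamma kap * mu * z m t k.
Proof.
move=> t0; have [_ g1] := rl_genfun t0; have [_ _ /(_ t t0) gy] := tailP m.
have g2 := @genfunZ _ (Gamma kap * mu) _ _ (genfunB gy (genfun_conv gb gy)).
apply: (genfun_inj_at k g1 g2) => u u0 u1 /=.
have phinu : phi u `^ nu = c u by rewrite -powRrM mulVf ?gt_eqF// powRr1// ltW// c_gt0.
have -> : phi u `^ (- kap) = c u * phi u ^- m.
  rewrite -phinu -(powR_mulrn _ (ltW (phi_gt0 u0 u1))) -powRN -gt0_powRD ?phi_gt0//.
  by congr powR; rewrite /kap; ring.
rewrite /c; have : 0 < beta + psi u by rewrite addr_gt0// psi0.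
have : phi u ^+ m != 0 by rewrite expf_neq0// gt_eqF// phi_gt0.
move: (phi u ^+ m) (expR _) => X E X0 h; field; rewrite X0/= gt_eqF//.
Qed.

(** The derivative is computed for an arbitrary combination with coefficients [a]. The unit sequence
    gives [q k] itself, the binomial coefficients give its fractional difference. *)
Variables (a : nat -> R) (k : nat).
Let f (t : R) := conv a (q ^~ t) k.
(** The j-th derivative of the fractional integral: each differentiation removes one tail integral
    and changes the sign. *)
Let H j (t : R) := (-1) ^+ j * conv a (fun i => Gamma kap * mu * z (m - j) t i) k.

Let rl_integrandE t s : rl_integrand nu f t s = conv a (fun i => rl_integrand nu (q i) t s) k.
Proof.
rewrite /rl_integrand /f /conv big_distrl/=.
by apply: eq_bigr => j _; rewrite mulrA.
Qed.

Let conv_integrable t : 0 < t -> leb.-integrable `]t, +oo[ (EFin \o rl_integrand nu f t).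
Proof.
move=> t0; have [ig _] := rl_genfun t0.
have [//|i _] := @Rintegral_conv R _ _ leb `]t, +oo[%classic _ a k _ ig.
by rewrite (funext (rl_integrandE t)).
Qed.

Let rl_integral_conv t : 0 < t -> rl_integral nu f t = H 0 t.
Proof.
move=> t0; have [ig _] := rl_genfun t0.
have [//|_ i] := @Rintegral_conv R _ _ leb `]t, +oo[%classic _ a k _ ig.
rewrite /rl_integral (funext (rl_integrandE t)) i /H expr0 mul1r subn0.
by apply: eq_bigr => j _; rewrite -rl_integralE.
Qed.

Let H_is_derive j (t : R) : (j < m)%N -> 0 < t -> is_derive t 1 (H j) (H j.+1 t).
Proof.
move=> jm t0; pose dz i := - y (m - j.+1) i t - conv b (fun l => - y (m - j.+1) l t) i.
have -> : H j.+1 t = (-1) ^+ j * conv a (fun i => Gamma kap * mu * dz i) k.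
  rewrite /H exprSr -mulrA mulN1r -convN; congr (_ * conv _ _ _).
  by apply/funext => i; rewrite -mulrN; congr (_ * _); rewrite /dz /z convN; ring.
apply: is_deriveZ; apply: is_derive_conv => i; apply: is_deriveZ.
rewrite /z -subnSK//; apply: is_deriveB; first exact: tail_is_derive.
by apply: is_derive_conv => l; exact: tail_is_derive.
Qed.

Lemma riemann_liouville_conv t : 0 < t ->
  riemann_liouville nu f t = mu * conv a (fun i => q i t - conv b (q ^~ t) i) k.
Proof.
move=> t0; rewrite /riemann_liouville (derive1n_chain rl_integral_conv H_is_derive (leqnn _) t0).
rewrite /H mulrA -/m subnn -exprMn mulrNN mulr1 expr1n mul1r.
rewrite convZr mulrA mulrA mulVf ?mul1r//.
by have [/gt_eqF ->] := Gamma_gt0_lty kap_gt0 kap_le1.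
Qed.

Lemma riemann_liouville_derivable_conv : riemann_liouville_derivable nu f.
Proof.
split => [t t0|j t jm t0]; first exact: conv_integrable.
by apply: (@derivable_chain _ m _ _ rl_integral_conv) => //; exact: H_is_derive.
Qed.

End riemann_liouville_mixture.

(** * The Caputo equation *)

Lemma integral_setI_natr d (T : measurableType d) (R : realType)
    (m : {measure set T -> \bar R}) (D : set T) (p : T -> bool) (f : T -> R) :
  (\int[m]_(x in D `&` [set x | p x]) (f x)%:E = \int[m]_(x in D) ((p x)%:R * f x)%:E)%E.
Proof.
rewrite integral_mkcondr; apply: eq_integral => x _.
rewrite patchE; case: ifPn => [/set_mem/= ->|]; first by rewrite mul1r.
move=> /negP hx; have [hx'|_] := boolP (p x); last by rewrite mul0r.
by exfalso; exact/hx/mem_set.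
Qed.

(** * Laplace transforms in time attached to the variable W = a^(- nu) *)

Section stable_moment.
Context d (T : measurableType d) (R : realType) (P : probability T R).
Notation leb := (@lebesgue_measure R).
Variables (nu : R) (a : T -> R) (G : set T).
Hypotheses (nu0 : 0 < nu) (nu1 : nu < 1) (mG : measurable G) (ma : measurable_fun G a).
Hypothesis a0 : forall w, G w -> 0 < a w.
Hypothesis aL : forall x : R, 0 < x ->
  (\int[P]_(w in G) (expR (- (x * a w)))%:E = (expR (- (x `^ nu)))%:E)%E.
Hypothesis PG : P G = 1%E.

Let W (w : T) : R := a w `^ (- nu).

Let W_gt0 w : G w -> 0 < W w. Proof. by move=> Gw; rewrite powR_gt0// a0. Qed.

Let mW : measurable_fun G W.
Proof.
by apply: (@measurable_comp _ _ _ _ _ _ setT (fun x : R => x `^ (- nu))) => //.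
Qed.

Let WK w (s : R) : G w -> 0 < s -> (W w * s `^ nu) `^ nu^-1 * a w = s.
Proof.
move=> Gw s0; rewrite powRM ?powR_ge0// -!powRrM mulfV ?gt_eqF// powRr1 ?(ltW s0)//.
by rewrite mulNr mulfV ?gt_eqF// powR_inv1 ?(ltW (a0 Gw))// mulrAC mulVf ?mul1r// gt_eqF// a0.
Qed.

(** The change of variable is z = W s^nu, whose inverse is s = z^(1/nu) a. *)
Lemma stable_substitution c th w : 0 < th -> G w ->
  (\int[leb]_(s in `]0%R, +oo[)
     (s `^ (nu - 1) * (nu * (W w * expR (- (c * (s `^ nu * W w))))) * expR (- (th * s)))%:E =
   \int[leb]_(z in `]0%R, +oo[)
     (expR (- (th * (z `^ nu^-1 * a w))) * expR (- (c * z)))%:E)%E.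
Proof.
move=> th0 Gw.
rewrite (@ge0_integration_by_powR _ (W w) nu
  (fun z => expR (- (th * (z `^ nu^-1 * a w))) * expR (- (c * z)))) ?W_gt0//.
- apply: eq_integral => s; rewrite inE/= in_itv/= andbT => s0; rewrite WK//.
  by congr EFin; rewrite (mulrC (s `^ nu)); ring.
- move=> z z0; apply: continuousM; last exact: continuous_expRN.
  apply: (@continuous_comp _ _ _ (fun z => z `^ nu^-1 * a w) (fun y => expR (- (th * y)))).
    by apply: continuousM; [exact: continuous_powR|exact: cst_continuous].
  exact: continuous_expRN.
Qed.

Let mexp_comp d' (T' : measurableType d') (D : set T') (x : R) (f : T' -> R) :
  measurable_fun D f -> measurable_fun D (fun z => expR (- (x * f z))).
Proof.
move=> mf; apply: (@measurableT_comp _ _ _ _ _ _ (@expR R)); first exact: measurable_expR.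
by apply: measurableT_comp => //; apply: measurable_funM.
Qed.

Let mpow_comp d' (T' : measurableType d') (D : set T') (x : R) (f : T' -> R) :
  measurable_fun D f -> measurable_fun D (fun z => f z `^ x).
Proof.
by move=> mf; apply: (@measurableT_comp _ _ _ _ _ _ (fun y : R => y `^ x)); first exact: measurable_powR.
Qed.

Let mfstG d' (T' : measurableType d') (D : set T') (f : T -> R) : measurable D ->
  measurable_fun G f -> measurable_fun (G `*` D) (f \o fst).
Proof. by move=> mD; exact: measurable_fun_fst_setX. Qed.

Let msnd (D : set R) : measurable D -> measurable_fun (G `*` D) (fun z : T * R => z.2).
Proof. by move=> mD; apply: measurable_funTS; exact: measurable_snd. Qed.

(** After the substitution, the expectation of exp(- th z^(1/nu) a) is exp(- th^nu z), and an
    exponential integral with rate c + th^nu remains. *)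
Lemma stable_laplace_tonelli c th : 0 <= c -> 0 < th ->
  (\int[P]_(w in G) \int[leb]_(s in `]0%R, +oo[)
     (s `^ (nu - 1) * (nu * (W w * expR (- (c * (s `^ nu * W w))))) * expR (- (th * s)))%:E =
   ((c + th `^ nu)^-1)%:E)%E.
Proof.
move=> c0 th0; have thnu : 0 < th `^ nu by exact: powR_gt0.
transitivity (\int[P]_(w in G) \int[leb]_(z in `]0%R, +oo[)
     (expR (- (th * (z `^ nu^-1 * a w))) * expR (- (c * z)))%:E)%E.
  by apply: eq_integral => w /set_mem Gw; exact: stable_substitution.
rewrite (@tonelli_sets _ _ _ _ _ P leb G `]0, +oo[%classic mG _
  (fun w z => (expR (- (th * (z `^ nu^-1 * a w))) * expR (- (c * z)))%:E)%E)//; last first.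
- apply/measurable_EFinP; apply: measurable_funM.
    apply: mexp_comp; apply: measurable_funM; last exact: mfstG.
    by apply: mpow_comp; exact: msnd.
  by apply: mexp_comp; exact: msnd.
transitivity (\int[leb]_(z in `]0%R, +oo[) (expR (- ((c + th `^ nu) * z)))%:E)%E; last first.
  by rewrite integral_expRN ?ltr_wpDl// mulr0 oppr0 expR0 mul1r.
apply: eq_integral => z; rewrite inE/= in_itv/= andbT => z0.
under eq_integral do rewrite mulrC EFinM mulrA.
rewrite ge0_integralZl_EFin//; last first.
  by apply/measurable_EFinP; exact: mexp_comp.
rewrite aL; last by rewrite mulr_gt0// powR_gt0.
rewrite -EFinM -expRD powRM ?powR_ge0 ?(ltW th0)// -powRrM mulVf ?gt_eqF// powRr1 ?(ltW z0)//.
by congr (expR _)%:E; ring.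
Qed.

(** The preceding identity at c = 0 and th = 1: the inner integral is nu Gamma(nu) W and its
    expectation is 1. *)
Lemma stable_scale_integrable : P.-integrable G (EFin \o W).
Proof.
have [Gam0 GamE] := Gamma_gt0_lty nu0 (ltW nu1).
apply: ge0_integrable => //; first by move=> w _; exact: powR_ge0.
have K0 : 0 < nu * Gamma nu by rewrite mulr_gt0.
have inner w : G w -> (\int[leb]_(s in `]0%R, +oo[)
    (s `^ (nu - 1) * (nu * (W w * expR (- (0 * (s `^ nu * W w))))) * expR (- (1 * s)))%:E =
    (nu * Gamma nu)%:E * (W w)%:E)%E.
  move=> Gw; transitivity (\int[leb]_(s in `]0%R, +oo[) ((nu * W w)%:E * (s `^ (nu - 1) * expR (- s))%:E))%E.
    apply: eq_integral => s _; rewrite -EFinM; congr EFin.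
    by rewrite mul0r oppr0 expR0 mul1r; ring.
  rewrite ge0_integralZl_EFin//.
  - by rewrite GamE -!EFinM; congr EFin; ring.
  - by move=> s _; rewrite lee_fin mulr_ge0 ?powR_ge0 ?expR_ge0.
  - apply/measurable_EFinP; apply: measurable_funM; first exact: mpow_comp.
    by apply: (@measurableT_comp _ _ _ _ _ _ (@expR R)) => //; exact: measurable_expR.
  - by rewrite mulr_ge0 ?powR_ge0// ltW.
have := stable_laplace_tonelli (lexx 0) ltr01.
have -> : (\int[P]_(w in G) \int[leb]_(s in `]0%R, +oo[)
    (s `^ (nu - 1) * (nu * (W w * expR (- (0 * (s `^ nu * W w))))) * expR (- (1 * s)))%:E =
    \int[P]_(w in G) ((nu * Gamma nu)%:E * (W w)%:E))%E.
  by apply: eq_integral => w /set_mem; exact: inner.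
rewrite ge0_integralZl_EFin//; last 3 first.
- by move=> w _; rewrite lee_fin powR_ge0.
- exact/measurable_EFinP.
- exact: ltW.
move=> E; rewrite -[ltLHS]mul1e -(mulVf (lt0r_neq0 K0)) EFinM -muleA E.
by rewrite -EFinM ltry.
Qed.

(** Up to the factor - c nu s^(nu - 1), the time derivative of E exp(- c s^nu W). *)
Definition stable_transform (c s : R) : R :=
  \int[P]_(w in G) (W w * expR (- (c * (s `^ nu * W w)))).

Let v := stable_transform.

Let cW_ge0 c s w : 0 <= c -> 0 <= c * (s `^ nu * W w).
Proof. by move=> c0; rewrite mulr_ge0// mulr_ge0 ?powR_ge0. Qed.

Let mv c s : measurable_fun G (fun w => W w * expR (- (c * (s `^ nu * W w)))).
Proof.
by apply: measurable_funM => //; apply: mexp_comp; apply: measurable_funM.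
Qed.

Lemma stable_transform_integrable c s : 0 <= c ->
  P.-integrable G (EFin \o (fun w => W w * expR (- (c * (s `^ nu * W w))))).
Proof.
move=> c0; apply: (le_integrable mG _ _ stable_scale_integrable).
  exact/measurable_EFinP/mv.
move=> w Gw; rewrite /= lee_fin !ger0_norm ?mulr_ge0 ?expR_ge0 ?powR_ge0//.
by rewrite ler_piMr ?powR_ge0// expR_le1 oppr_le0 cW_ge0.
Qed.

Let vE c s : 0 <= c ->
  ((v c s)%:E = \int[P]_(w in G) (W w * expR (- (c * (s `^ nu * W w))))%:E)%E.
Proof.
by move=> c0; rewrite /v /stable_transform /Rintegral fineK//; exact: integrable_fin_num (stable_transform_integrable s c0).
Qed.

Let v_ge0 c s : 0 <= v c s.
Proof. by apply: Rintegral_ge0 => w _; rewrite mulr_ge0 ?powR_ge0 ?expR_ge0. Qed.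

Let v_le c s : 0 <= c -> v c s <= v 0 1.
Proof.
move=> c0; rewrite -lee_fin [leLHS](vE s c0) [leRHS](vE 1 (lexx 0)).
apply: ge0_le_integral.
- exact: mG.
- by move=> w _; rewrite lee_fin mulr_ge0 ?powR_ge0 ?expR_ge0.
- exact/measurable_EFinP/mv.
- exact/measurable_EFinP/mv.
- move=> w _; rewrite lee_fin ler_wpM2l ?powR_ge0// ler_expR lerN2 mul0r.
  exact: cW_ge0.
Qed.

Lemma stable_transform_continuous c s : 0 <= c -> 0 < s -> {for s, continuous (v c)}.
Proof.
move=> c0 s0; apply: (@continuity_under_integral _ _ _ P
  (fun s w => W w * expR (- (c * (s `^ nu * W w)))) G mG 0 (s + 1) _ _ W).
- by move=> x _; exact: stable_transform_integrable.
- apply: aeW => w Gw x; rewrite inE/= in_itv/= => /andP[x0 _].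
  apply: cvgM; first exact: cvg_cst.
  apply: (@continuous_comp _ _ _ (fun x => x `^ nu * W w) (fun y => expR (- (c * y)))).
    by apply: continuousM; [exact: continuous_powR|exact: cst_continuous].
  exact: continuous_expRN.
- exact: stable_scale_integrable.
- move=> x _; apply: aeW => w Gw; rewrite ger0_norm ?mulr_ge0 ?powR_ge0 ?expR_ge0//.
  by rewrite ler_piMr ?powR_ge0// expR_le1 oppr_le0 cW_ge0.
- by rewrite inE/= in_itv/= s0 ltrDl ltr01.
Qed.

Let v0E s : v 0 s = v 0 1.
Proof. by apply: eq_Rintegral => w _; rewrite !mul0r. Qed.

Local Opaque stable_transform.

Let swap (D : set R) (k : R -> R) c : measurable D -> measurable_fun D k ->
  (forall s, D s -> 0 <= k s) -> 0 <= c ->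
  (\int[leb]_(s in D) (k s * v c s)%:E =
   \int[P]_(w in G) \int[leb]_(s in D) (k s * (W w * expR (- (c * (s `^ nu * W w)))))%:E)%E.
Proof.
move=> mD mk k0 c0.
rewrite (@tonelli_sets _ _ _ _ _ P leb G D mG mD
  (fun w s => (k s * (W w * expR (- (c * (s `^ nu * W w)))))%:E)%E); last 2 first.
- apply/measurable_EFinP; apply: measurable_funM; first exact: measurable_fun_snd_setX.
  apply: measurable_funM; first exact: mfstG.
  apply: mexp_comp; apply: measurable_funM; last exact: mfstG.
  by apply: mpow_comp; exact: msnd.
- by move=> w s _ Ds; rewrite lee_fin !mulr_ge0 ?powR_ge0 ?expR_ge0 ?k0.
apply: eq_integral => s /set_mem Ds; rewrite EFinM (vE s c0) -ge0_integralZl_EFin//.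
- by move=> w _; rewrite lee_fin mulr_ge0 ?powR_ge0 ?expR_ge0.
- exact/measurable_EFinP/mv.
- exact: k0.
Qed.

Let mkern (D : set R) : measurable_fun D (fun s : R => nu * s `^ (nu - 1)).
Proof. by apply: measurable_funM => //; exact: mpow_comp. Qed.

Let stable_transform_laplace c th : 0 <= c -> 0 < th ->
  (\int[leb]_(s in `]0%R, +oo[) (nu * s `^ (nu - 1) * expR (- (th * s)) * v c s)%:E =
   ((c + th `^ nu)^-1)%:E)%E.
Proof.
move=> c0 th0; rewrite swap//; last 2 first.
- by apply: measurable_funM => //; exact: mexp_comp.
- by move=> s _; rewrite !mulr_ge0 ?expR_ge0 ?powR_ge0// ltW.
rewrite -stable_laplace_tonelli//; apply: eq_integral => w _; apply: eq_integral => s _.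
by congr EFin; ring.
Qed.

Lemma stable_transform_tail c t : 0 < c -> 0 <= t ->
  (\int[leb]_(s in `]t, +oo[) (nu * s `^ (nu - 1) * v c s)%:E =
   \int[P]_(w in G) (c^-1 * expR (- (c * (t `^ nu * W w))))%:E)%E.
Proof.
move=> c0 t0; rewrite swap ?ltW//; last first.
  by move=> s _; rewrite mulr_ge0 ?powR_ge0// ltW.
apply: eq_integral => w /set_mem Gw.
transitivity (\int[leb]_(z in `](W w * t `^ nu)%R, +oo[) (expR (- (c * z)))%:E)%E; last first.
  by rewrite integral_expRN// (mulrC (W w)) [in RHS]mulrC.
rewrite (@ge0_integration_by_powR_itvoy _ t (W w) nu (fun z => expR (- (c * z))))//.
- apply: eq_integral => s _; congr EFin.
  by rewrite (mulrC (W w) (s `^ nu)); ring.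
- exact: W_gt0.
- by move=> x _; exact: continuous_expRN.
Qed.

Let mvc c (D : set R) : measurable D -> D `<=` `]0, +oo[ -> 0 <= c -> measurable_fun D (v c).
Proof.
move=> mD D0 c0; apply: (@measurable_funS _ _ _ _ `](0 : R), +oo[%classic) => //.
apply: continuous_measurable_itvoy => s s0; exact: stable_transform_continuous.
Qed.

Lemma stable_convolution_laplace c th : 0 <= c -> 0 < th ->
  (\int[leb]_(t in `]0%R, +oo[) ((expR (- (th * t)))%:E *
     \int[leb]_(s in `]0%R, t[) ((t - s) `^ (- nu) * (s `^ (nu - 1) * v c s))%:E) =
   (nu^-1 * Gamma (1 - nu) * th `^ (nu - 1) / (c + th `^ nu))%:E)%E.
Proof.
move=> c0 th0.
pose H (t s : R) : \bar R := ((s < t)%R%:R * (expR (- (th * t)) * ((t - s) `^ (- nu) * (s `^ (nu - 1) * v c s))))%:E.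
have H0 t s : (0 <= H t s)%E.
  by rewrite lee_fin !mulr_ge0 ?expR_ge0 ?powR_ge0//; exact: v_ge0.
transitivity (\int[leb]_(t in `]0%R, +oo[) \int[leb]_(s in `]0%R, +oo[) H t s)%E.
  apply: eq_integral => t; rewrite inE/= in_itv/= andbT => t0.
  rewrite -integral_setI_natr.
  have -> : `]0, +oo[%classic `&` [set s | s < t] = `]0, t[%classic.
    by apply/seteqP; split => s /=; rewrite !in_itv/= andbT; [case=> -> ->|move=> /andP[-> ->]].
  rewrite -ge0_integralZl//.
  - apply/measurable_EFinP; apply: measurable_funM.
      by apply: mpow_comp; apply: measurable_funB.
    apply: measurable_funM; first exact: mpow_comp.
    by apply: mvc => // s /=; rewrite !in_itv/= andbT => /andP[].
  - by move=> s _; rewrite lee_fin !mulr_ge0 ?expR_ge0 ?powR_ge0//; exact: v_ge0.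
rewrite (@tonelli_sets _ _ _ _ _ leb leb `]0, +oo[%classic `]0, +oo[%classic _ _ H)//; last first.
  apply/measurable_EFinP; apply: measurable_funM.
    apply: (@measurable_lteif _ _ _ (`](0 : R), +oo[%classic `*` `](0 : R), +oo[%classic) snd fst false); first exact: measurableX.
    - by apply: measurable_funTS; exact: measurable_snd.
    - by apply: measurable_funTS; exact: measurable_fst.
  apply: measurable_funM.
    by apply: mexp_comp; apply: measurable_funTS; exact: measurable_fst.
  apply: measurable_funM.
    by apply: mpow_comp; apply: measurable_funB; apply: measurable_funTS; [exact: measurable_fst|exact: measurable_snd].
  apply: (measurable_fun_snd_setX (f := fun s => s `^ (nu - 1) * v c s)) => //.
  by apply: measurable_funM; [exact: mpow_comp|exact: mvc].
transitivity (\int[leb]_(s in `]0%R, +oo[) ((nu^-1 * Gamma (1 - nu) * th `^ (nu - 1))%:E *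
    (nu * s `^ (nu - 1) * expR (- (th * s)) * v c s)%:E))%E; last first.
  rewrite ge0_integralZl_EFin//.
  - by rewrite stable_transform_laplace// -EFinM.
  - by move=> s _; rewrite lee_fin !mulr_ge0 ?expR_ge0 ?powR_ge0 ?(ltW nu0)//; exact: v_ge0.
  - apply/measurable_EFinP; apply: measurable_funM; last exact: mvc.
    by apply: measurable_funM; [exact: mkern|exact: mexp_comp].
  - have [Gam0 _] := @Gamma_gt0_lty R (1 - nu) ltac:(by rewrite subr_gt0) ltac:(by rewrite gerBl ltW).
    by rewrite !mulr_ge0 ?powR_ge0 ?invr_ge0// ltW.
apply: eq_integral => s; rewrite inE/= in_itv/= andbT => s0; rewrite /H.
rewrite -integral_setI_natr.
have -> : `]0, +oo[%classic `&` [set t | s < t] = `]s, +oo[%classic.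
  apply/seteqP; split => t /=; rewrite !in_itv/= !andbT; first by case.
  by move=> st; split => //; exact: lt_trans st.
transitivity (\int[leb]_(t in `]s, +oo[) ((s `^ (nu - 1) * v c s)%:E *
    ((t - s) `^ ((1 - nu) - 1) * expR (- (th * t)))%:E))%E.
  apply: eq_integral => t _; rewrite -EFinM; congr EFin.
  by rewrite (_ : 1 - nu - 1 = - nu); ring.
rewrite ge0_integralZl_EFin//; last 3 first.
- by move=> t _; rewrite lee_fin mulr_ge0 ?powR_ge0 ?expR_ge0.
- apply/measurable_EFinP; apply: measurable_funM; last exact: mexp_comp.
  by apply: mpow_comp; apply: measurable_funB.
- by rewrite mulr_ge0 ?powR_ge0//; exact: v_ge0.
rewrite integral_powR_shift_expR ?subr_gt0 ?gerBl ?(ltW nu0)// -!EFinM; congr EFin.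
rewrite opprB; set X := th `^ _; set Y := s `^ _; set Z := expR _; set V := v c s.
by field; rewrite gt_eqF.
Qed.

Let Gam_gt0 : 0 < Gamma (1 - nu).
Proof. by have [] := @Gamma_gt0_lty R (1 - nu) ltac:(by rewrite subr_gt0) ltac:(by rewrite gerBl ltW). Qed.

Let kernel (y : R) : R := y `^ (nu - 1) * (1 + y)^-1.

Let kernel_ge0 y : 0 < y -> 0 <= kernel y.
Proof. by move=> y0; rewrite mulr_ge0 ?powR_ge0// invr_ge0 addr_ge0// ltW. Qed.

Let kernel_measurable : measurable_fun `](0 : R), +oo[ kernel.
Proof.
apply: measurable_funM; first exact: mpow_comp.
apply: continuous_measurable_itvoy => y y0; apply: continuousV; first by rewrite gt_eqF// addr_gt0.
by apply: continuousD; [exact: cst_continuous|exact: cvg_id].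
Qed.

Let point_gt0 (t y : R) : 0 < t -> 0 < y -> 0 < t * (y / (1 + y)).
Proof. by move=> t0 y0; rewrite mulr_gt0// divr_gt0// addr_gt0. Qed.

(** In this form continuity in t, which the uniqueness of Laplace transforms calls for, follows from
    dominated convergence with the bound v c s <= v 0 1. *)
Let convolution c t := \int[leb]_(y in `]0, +oo[) (kernel y * v c (t * (y / (1 + y)))).

Let convolution_subst c t : 0 <= c -> 0 < t ->
  (\int[leb]_(s in `]0%R, t[) ((t - s) `^ (- nu) * (s `^ (nu - 1) * v c s))%:E =
   \int[leb]_(y in `]0%R, +oo[) (kernel y * v c (t * (y / (1 + y))))%:E)%E.
Proof.
move=> c0 t0; apply: ge0_integration_by_beta => //.
by move=> x x0; exact: stable_transform_continuous.
Qed.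

Let point_continuous t y : 0 < y -> {for y, continuous (fun y : R => t * (y / (1 + y)))}.
Proof.
move=> y0; apply: continuousM; first exact: cst_continuous.
apply: continuousM; first exact: cvg_id.
apply: continuousV; first by rewrite gt_eqF// addr_gt0.
by apply: continuousD; [exact: cst_continuous|exact: cvg_id].
Qed.

Let convolution_measurable c t : 0 <= c -> 0 < t ->
  measurable_fun `](0 : R), +oo[ (fun y => kernel y * v c (t * (y / (1 + y)))).
Proof.
move=> c0 t0; apply: measurable_funM; first exact: kernel_measurable.
apply: continuous_measurable_itvoy => y y0.
apply: (@continuous_comp R R R (fun y => t * (y / (1 + y))) (v c)).
  exact: point_continuous.
by apply: stable_transform_continuous => //; exact: point_gt0.
Qed.

(** At c = 0 the function v does not depend on time, so the convolution is a constant M in t. Its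
    Laplace transform at 1 is M itself, and the preceding formula shows that this is finite. *)
Let kernel_integrable : leb.-integrable `]0, +oo[ (EFin \o (fun y => kernel y * v 0 1)).
Proof.
have mK : measurable_fun `](0 : R), +oo[ (fun y => kernel y * v 0 1).
  by apply: measurable_funM => //; exact: kernel_measurable.
apply: ge0_integrable => //.
  by move=> y /=; rewrite in_itv/= andbT => y0; rewrite mulr_ge0 ?kernel_ge0//; exact: v_ge0.
have := stable_convolution_laplace (lexx 0) ltr01.
set M := (X in (X < +oo)%E).
have M0 : (0 <= M)%E.
  apply: integral_ge0 => y /=; rewrite in_itv/= andbT => y0.
  by rewrite lee_fin mulr_ge0 ?kernel_ge0//; exact: v_ge0.
have ME t : 0 < t ->
    (\int[leb]_(s in `]0%R, t[) ((t - s) `^ (- nu) * (s `^ (nu - 1) * v 0 s))%:E = M)%E.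
  move=> t0; rewrite (convolution_subst (lexx 0) t0); apply: eq_integral => y _.
  by rewrite (v0E (t * (y / (1 + y)))).
have -> : (\int[leb]_(t in `]0%R, +oo[) ((expR (- (1 * t)))%:E *
     \int[leb]_(s in `]0%R, t[) ((t - s) `^ (- nu) * (s `^ (nu - 1) * v 0 s))%:E) = M)%E.
  transitivity (\int[leb]_(t in `]0%R, +oo[) ((expR (- (1 * t)))%:E * M))%E.
    by apply: eq_integral => t; rewrite inE/= in_itv/= andbT => t0; rewrite (ME t t0).
  rewrite ge0_integralZr//; last first.
    by apply/measurable_EFinP; exact: mexp_comp.
  by rewrite integral_expRN// mulr0 oppr0 expR0 divr1 mul1e.
by move=> ->; rewrite ltry.
Qed.

Let convolution_integrable c t : 0 <= c -> 0 < t ->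
  leb.-integrable `]0, +oo[ (EFin \o (fun y => kernel y * v c (t * (y / (1 + y))))).
Proof.
move=> c0 t0; apply: (le_integrable _ _ _ kernel_integrable).
- exact: measurable_itv.
- apply/measurable_EFinP; exact: convolution_measurable.
move=> y; rewrite /= in_itv/= andbT => y0; have k0 := kernel_ge0 y0.
rewrite lee_fin [leLHS]ger0_norm; last exact: mulr_ge0 k0 (v_ge0 _ _).
rewrite [leRHS]ger0_norm; last exact: mulr_ge0 k0 (v_ge0 _ _).
exact: ler_wpM2l k0 _ _ (v_le _ c0).
Qed.

Let convolution_continuous c t : 0 <= c -> 0 < t -> {for t, continuous (convolution c)}.
Proof.
move=> c0 t0; apply: (@continuity_under_integral _ _ _ leb
  (fun t y => kernel y * v c (t * (y / (1 + y)))) `]0, +oo[%classic _ 0 (t + 1) _ _ (fun y => kernel y * v 0 1)).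
- exact: measurable_itv.
- by move=> x /=; rewrite in_itv/= => /andP[x0 _]; exact: convolution_integrable.
- apply: aeW => y /=; rewrite in_itv/= andbT => y0 x; rewrite inE/= in_itv/= => /andP[x0 _].
  have cx : {for x, continuous (fun x : R => v c (x * (y / (1 + y))))}.
    apply: (@continuous_comp R R R (fun x => x * (y / (1 + y))) (v c)).
      by apply: continuousM; [exact: cvg_id|exact: cst_continuous].
    by apply: stable_transform_continuous => //; exact: point_gt0.
  by apply: cvgM; [exact: cvg_cst|exact: cx].
- exact: kernel_integrable.
- move=> x /=; rewrite in_itv/= => /andP[x0 _]; apply: aeW => y /=; rewrite in_itv/= andbT => y0.
  have k0 := kernel_ge0 y0.
  rewrite [leLHS]ger0_norm; last exact: mulr_ge0 k0 (v_ge0 _ _).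
  exact: ler_wpM2l k0 _ _ (v_le _ c0).
- by rewrite inE/= in_itv/= t0 ltrDl ltr01.
Qed.

(** The value of E exp(- c L(t)) at positive times, by self-similarity. *)
Let g c t := \int[P]_(w in G) expR (- (c * (t `^ nu * W w))).

Let g_integrable c t : 0 <= c -> P.-integrable G (EFin \o (fun w => expR (- (c * (t `^ nu * W w))))).
Proof.
move=> c0; apply: (@le_integrable _ _ _ P G mG _ (cst 1%E)).
- by apply/measurable_EFinP; apply: mexp_comp; apply: measurable_funM.
- move=> w _; rewrite /= lee_fin normr1 ger0_norm ?expR_ge0// expR_le1 oppr_le0.
  exact: cW_ge0.
- exact: finite_measure_integrable_cst.
Qed.

Let g_continuous c t : 0 <= c -> 0 < t -> {for t, continuous (g c)}.
Proof.
move=> c0 t0; apply: (@continuity_under_integral _ _ _ P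
  (fun s w => expR (- (c * (s `^ nu * W w)))) G mG 0 (t + 1) _ _ (cst 1)).
- by move=> x _; exact: g_integrable.
- apply: aeW => w Gw x; rewrite inE/= in_itv/= => /andP[x0 _].
  apply: (@continuous_comp _ _ _ (fun x => x `^ nu * W w) (fun y => expR (- (c * y)))).
    by apply: continuousM; [exact: continuous_powR|exact: cst_continuous].
  exact: continuous_expRN.
- exact: finite_measure_integrable_cst.
- move=> x _; apply: aeW => w Gw; rewrite ger0_norm ?expR_ge0// expR_le1 oppr_le0.
  exact: cW_ge0.
- by rewrite inE/= in_itv/= t0 ltrDl ltr01.
Qed.

Let gE c t : 0 <= c -> ((g c t)%:E = \int[P]_(w in G) (expR (- (c * (t `^ nu * W w))))%:E)%E.
Proof. by move=> c0; rewrite /g /Rintegral fineK//; exact: integrable_fin_num (g_integrable t c0). Qed.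

Lemma stable_transform_tailE c t : 0 < c -> 0 <= t ->
  (\int[leb]_(s in `]t, +oo[) (nu * s `^ (nu - 1) * v c s)%:E = (c^-1 * g c t)%:E)%E.
Proof.
move=> c0 t0; rewrite stable_transform_tail// EFinM gE ?(ltW c0)//.
under eq_integral do rewrite EFinM.
rewrite ge0_integralZl_EFin//.
- by apply/measurable_EFinP; apply: mexp_comp; apply: measurable_funM.
- by rewrite invr_ge0 ltW.
Qed.

Let g_measurable c : 0 <= c -> measurable_fun `](0 : R), +oo[ (g c).
Proof. by move=> c0; apply: continuous_measurable_itvoy => x x0; exact: g_continuous. Qed.

Let g_ge0 c t : 0 <= g c t.
Proof. by apply: Rintegral_ge0 => w _; exact: expR_ge0. Qed.

Let g0 c : g c 0 = 1.
Proof.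
rewrite /g; transitivity (\int[P]_(w in G) (1 : R)).
  by apply: eq_Rintegral => w _; rewrite powR0 ?gt_eqF// mul0r mulr0 oppr0 expR0.
by rewrite /Rintegral integral_cst// mul1e; exact: congr1 PG.
Qed.

Let kv_ge0 c s : 0 <= nu * s `^ (nu - 1) * v c s.
Proof. by rewrite mulr_ge0 ?v_ge0// mulr_ge0 ?powR_ge0// ltW. Qed.

Let kv_measurable c : 0 <= c -> measurable_fun `](0 : R), +oo[ (fun s => nu * s `^ (nu - 1) * v c s).
Proof. by move=> c0; apply: measurable_funM; [exact: mkern|exact: mvc]. Qed.

(** Integrate th exp(- th t) nu s^(nu - 1) v(c, s) over t < s in both orders. Integrating in s first
    gives th / c times the transform of g, as g / c is a tail integral; integrating in t first gives
    1 / c - 1 / (c + th^nu). *)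
Let g_laplace c th : 0 < c -> 0 < th ->
  (\int[leb]_(t in `]0%R, +oo[) (expR (- (th * t)) * g c t)%:E = (th `^ (nu - 1) / (c + th `^ nu))%:E)%E.
Proof.
move=> c0 th0; have c0' := ltW c0.
pose H (t s : R) : \bar R :=
  ((t < s)%R%:R * (th * expR (- (th * t)) * (nu * s `^ (nu - 1) * v c s)))%:E.
have te0 (t : R) : 0 <= th * expR (- (th * t)) by rewrite mulr_ge0 ?expR_ge0// ltW.
have H0 t s : (0 <= H t s)%E.
  by rewrite lee_fin; apply: mulr_ge0 => //; apply: mulr_ge0 (te0 t) (kv_ge0 c s).
have mte (D : set R) : measurable_fun D (fun t : R => th * expR (- (th * t))).
  by apply: measurable_funM => //; exact: mexp_comp.
have step1 : (\int[leb]_(t in `]0%R, +oo[) \int[leb]_(s in `]0%R, +oo[) H t s =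
    (th * c^-1)%:E * \int[leb]_(t in `]0%R, +oo[) (expR (- (th * t)) * g c t)%:E)%E.
  rewrite -ge0_integralZl_EFin//; last 3 first.
  - by move=> t _; rewrite lee_fin; apply: mulr_ge0 (expR_ge0 _) (g_ge0 c t).
  - by apply/measurable_EFinP; apply: measurable_funM; [exact: mexp_comp|exact: g_measurable].
  - by rewrite mulr_ge0 ?invr_ge0 ?ltW.
  apply: eq_integral => t; rewrite inE/= in_itv/= andbT => t0; rewrite /H.
  rewrite -integral_setI_natr.
  have -> : `]0, +oo[%classic `&` [set s | t < s] = `]t, +oo[%classic.
    apply/seteqP; split => s /=; rewrite !in_itv/= !andbT; first by case.
    by move=> st; split => //; exact: lt_trans st.
  under eq_integral do rewrite EFinM.
  rewrite ge0_integralZl_EFin//; last 2 first.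
  - by move=> s _; rewrite lee_fin; exact: kv_ge0.
  - apply/measurable_EFinP; apply: (measurable_funS _ _ (kv_measurable c0')) => //.
    by move=> s /=; rewrite !in_itv/= !andbT; exact: lt_trans.
  rewrite (stable_transform_tailE c0 (ltW t0)) -!EFinM; congr EFin.
  by set X := g c t; ring.
have kvi : leb.-integrable `]0, +oo[ (EFin \o (fun s => nu * s `^ (nu - 1) * v c s)).
  apply: ge0_integrable => //; first exact: kv_measurable.
  by rewrite (stable_transform_tailE c0 (lexx 0)) ltry.
have step2 : (\int[leb]_(t in `]0%R, +oo[) \int[leb]_(s in `]0%R, +oo[) H t s =
    (c^-1 - (c + th `^ nu)^-1)%:E)%E.
  rewrite (@tonelli_sets _ _ _ _ _ leb leb `]0, +oo[%classic `]0, +oo[%classic _ _ H)//; last first.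
    apply/measurable_EFinP; apply: measurable_funM.
      apply: (@measurable_lteif _ _ _ (`](0 : R), +oo[%classic `*` `](0 : R), +oo[%classic) fst snd false); first exact: measurableX.
      - by apply: measurable_funTS; exact: measurable_fst.
      - by apply: measurable_funTS; exact: measurable_snd.
    apply: measurable_funM.
      by apply: (measurable_fun_fst_setX (f := fun t : R => th * expR (- (th * t)))).
    by apply: (measurable_fun_snd_setX (f := fun s => nu * s `^ (nu - 1) * v c s)) => //; exact: kv_measurable.
  transitivity (\int[leb]_(s in `]0%R, +oo[) ((nu * s `^ (nu - 1) * v c s)%:E -
     (nu * s `^ (nu - 1) * expR (- (th * s)) * v c s)%:E))%E.
    apply: eq_integral => s; rewrite inE/= in_itv/= andbT => s0; rewrite /H.
    rewrite -integral_setI_natr.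
    have -> : `]0, +oo[%classic `&` [set t | t < s] = `]0, s[%classic.
      by apply/seteqP; split => t /=; rewrite !in_itv/= andbT; [case=> -> ->|move=> /andP[-> ->]].
    under eq_integral do rewrite mulrC EFinM.
    rewrite ge0_integralZl_EFin//; last 2 first.
    - by move=> t _; rewrite lee_fin; exact: te0.
    - by apply/measurable_EFinP; exact: mte.
    have := @integral_expRN_bounded R s th true (ltW s0) th0.
    rewrite /= => ->; rewrite -EFinM -EFinB; congr EFin.
    by set X := v c s; ring.
  have kvei : leb.-integrable `]0, +oo[ (EFin \o (fun s => nu * s `^ (nu - 1) * expR (- (th * s)) * v c s)).
    apply: ge0_integrable.
    - exact: measurable_itv.
    - apply: measurable_funM; last exact: mvc.
      by apply: measurable_funM; [exact: mkern|exact: mexp_comp].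
    - move=> s _; rewrite mulrAC; exact: mulr_ge0 (kv_ge0 c s) (expR_ge0 _).
    - by rewrite (stable_transform_laplace c0' th0) ltry.
  transitivity (\int[leb]_(s in `]0%R, +oo[) (nu * s `^ (nu - 1) * v c s)%:E -
     \int[leb]_(s in `]0%R, +oo[) (nu * s `^ (nu - 1) * expR (- (th * s)) * v c s)%:E)%E.
    exact: (integralB _ kvi kvei).
  by rewrite (stable_transform_tailE c0 (lexx 0)) (stable_transform_laplace c0' th0) g0 mulr1.
have thc0 : 0 < th * c^-1 by rewrite mulr_gt0// invr_gt0.
have e1 : (1 = ((th * c^-1)^-1)%:E * (th * c^-1)%:E)%E by rewrite -EFinM mulVf ?gt_eqF.
rewrite -[LHS]mul1e [X in (X * _)%E = _]e1 -muleA -step1 step2 -EFinM; congr EFin.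
have -> : th `^ nu = th * th `^ (nu - 1) by rewrite gt0_mulr_powRB1.
have : 0 < c + th * th `^ (nu - 1) by rewrite addr_gt0 ?mulr_gt0 ?powR_gt0.
by set X := th `^ _ => h; field; rewrite !gt_eqF.
Qed.

(** Both sides are continuous in t and have Laplace transform Gamma(1 - nu) th^(nu - 1) / (c +
    th^nu). Since the derivative of g is - c nu s^(nu - 1) v, this is the Caputo equation with
    eigenvalue - c, written without differentiating g. *)
Lemma stable_convolution c t : 0 < c -> 0 < t ->
  (\int[leb]_(s in `]0%R, t[) ((t - s) `^ (- nu) * (nu * s `^ (nu - 1) * v c s))%:E =
   (Gamma (1 - nu) * g c t)%:E)%E.
Proof.
move=> c0 t0; have c0' := ltW c0.
have cE s : 0 < s -> ((convolution c s)%:E = \int[leb]_(x in `]0%R, s[) ((s - x) `^ (- nu) * (x `^ (nu - 1) * v c x))%:E)%E.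
  move=> s0; rewrite (convolution_subst c0' s0) /convolution /Rintegral fineK//.
  exact: integrable_fin_num (convolution_integrable c0' s0).
have conv_ge0 s : 0 <= convolution c s.
  apply: Rintegral_ge0 => y; rewrite /= in_itv/= andbT => y0.
  exact: mulr_ge0 (kernel_ge0 y0) (v_ge0 _ _).
have conv_measurable : measurable_fun `](0 : R), +oo[ (convolution c).
  by apply: continuous_measurable_itvoy => x x0; exact: convolution_continuous.
have gL (th : R) : 0 < th -> (\int[leb]_(s in `]0%R, +oo[) (expR (- (th * s)) * (Gamma (1 - nu) * g c s))%:E =
    (Gamma (1 - nu) * (th `^ (nu - 1) / (c + th `^ nu)))%:E)%E.
  move=> th0; rewrite EFinM -(g_laplace c0 th0) -ge0_integralZl_EFin//.
  - by apply: eq_integral => s _; rewrite -EFinM mulrCA.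
  - by move=> s _; rewrite lee_fin; exact: mulr_ge0 (expR_ge0 _) (g_ge0 c s).
  - by apply/measurable_EFinP; apply: measurable_funM; [exact: mexp_comp|exact: g_measurable].
  - exact: ltW.
have cL (th : R) : 0 < th -> (\int[leb]_(s in `]0%R, +oo[) (expR (- (th * s)) * (nu * convolution c s))%:E =
    (Gamma (1 - nu) * (th `^ (nu - 1) / (c + th `^ nu)))%:E)%E.
  move=> th0; have -> : Gamma (1 - nu) * (th `^ (nu - 1) / (c + th `^ nu)) =
      nu * (nu^-1 * Gamma (1 - nu) * th `^ (nu - 1) / (c + th `^ nu)).
    by rewrite !mulrA mulfV ?gt_eqF// mul1r.
  rewrite EFinM -(stable_convolution_laplace c0' th0).
  transitivity (\int[leb]_(s in `]0%R, +oo[) (nu%:E * (expR (- (th * s)) * convolution c s)%:E))%E.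
    by apply: eq_integral => s _; rewrite -EFinM mulrCA.
  rewrite ge0_integralZl_EFin//; last 3 first.
  - by move=> s _; rewrite lee_fin; exact: mulr_ge0 (expR_ge0 _) (conv_ge0 s).
  - by apply/measurable_EFinP; apply: measurable_funM; [exact: mexp_comp|exact: conv_measurable].
  - exact: ltW.
  congr (_ * _)%E; apply: eq_integral => s; rewrite inE/= in_itv/= andbT => s0.
  by rewrite EFinM cE.
have E : nu * convolution c t = Gamma (1 - nu) * g c t.
  apply: (@laplace_inj _ (fun t => nu * convolution c t) (fun t => Gamma (1 - nu) * g c t)) => //.
  - exact: measurable_funM.
  - by apply: measurable_funM => //; exact: g_measurable.
  - by move=> s _; apply: mulr_ge0 (ltW nu0) (conv_ge0 s).
  - by move=> s _; apply: mulr_ge0 (ltW Gam_gt0) (g_ge0 c s).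
  - by move=> th th0; rewrite cL// ltry.
  - by move=> th th0; rewrite cL// gL.
  - by apply: cvg_at_right_filter; apply: cvgM; [exact: cvg_cst|exact: convolution_continuous].
  - by apply: cvg_at_right_filter; apply: cvgM; [exact: cvg_cst|exact: g_continuous].
rewrite -E EFinM (cE t t0) -ge0_integralZl_EFin//.
- by apply: eq_integral => s _; rewrite -EFinM; congr EFin; set X := v c s; ring.
- by move=> s _; rewrite lee_fin; apply: mulr_ge0 (powR_ge0 _ _) (mulr_ge0 (powR_ge0 _ _) (v_ge0 _ _)).
- apply/measurable_EFinP; apply: measurable_funM.
    by apply: mpow_comp; apply: measurable_funB.
  apply: measurable_funM; first exact: mpow_comp.
  by apply: mvc => // s /=; rewrite !in_itv/= andbT => /andP[].
- exact: ltW.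
Qed.

End stable_moment.

(** * The Caputo derivative on coefficients *)

Section caputo_mixture.
Context d (T : measurableType d) (R : realType) (P : probability T R).
Notation leb := (@lebesgue_measure R).
Variables (nu : R) (a : T -> R) (G : set T).
Hypotheses (nu0 : 0 < nu) (nu1 : nu < 1) (mG : measurable G) (ma : measurable_fun G a).
Hypothesis a0 : forall w, G w -> 0 < a w.
Hypothesis aL : forall x : R, 0 < x ->
  (\int[P]_(w in G) (expR (- (x * a w)))%:E = (expR (- (x `^ nu)))%:E)%E.
Hypothesis PG : P G = 1%E.
Variables (beta mu : R) (psi : R -> R) (r q : nat -> R -> R) (b : nat -> R).
Hypotheses (beta0 : 0 < beta) (mu0 : 0 < mu).
Hypothesis psi0 : forall u : R, 0 < u -> u < 1 -> 0 < psi u.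

Let c u := mu * (psi u / (beta + psi u)).
Let W (w : T) : R := a w `^ (- nu).

Hypothesis er : expfam r c.
Hypothesis gq : forall t, 0 < t ->
  genfun (q ^~ t) (fun u => \int[P]_(w in G) expR (- (c u * (t `^ nu * W w)))).
Hypothesis gb : genfun b (fun u => beta / (beta + psi u)).

Let c_gt0 u : 0 < u -> u < 1 -> 0 < c u.
Proof. by move=> u0 u1; rewrite mulr_gt0// divr_gt0// ?addr_gt0 ?psi0. Qed.

Let W_gt0 w : G w -> 0 < W w. Proof. by move=> Gw; rewrite powR_gt0// a0. Qed.

Let mW : measurable_fun G W.
Proof. by apply: (@measurable_comp _ _ _ _ _ _ setT (fun x : R => x `^ (- nu))). Qed.

Let iW : P.-integrable G (EFin \o W).
Proof. exact: stable_scale_integrable nu0 nu1 mG ma a0 aL. Qed.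

Let vt := stable_transform P nu a G.

Let vk k s := \int[P]_(w in G) (W w * r k (s `^ nu * W w)).

Let vk_genfun s : (forall k, P.-integrable G (EFin \o (fun w => W w * r k (s `^ nu * W w)))) /\
  genfun (vk ^~ s) (fun u => vt (c u) s).
Proof.
apply: (@expfam_mixture _ _ _ P G mG r c er W (fun w => s `^ nu * W w)) => //.
- by move=> w _; exact: powR_ge0.
- exact: measurable_funM.
- by move=> w _; rewrite mulr_ge0 ?powR_ge0.
- move=> u u0 u1.
  apply: integrable_lty => //.
  exact: (stable_transform_integrable nu0 nu1 mG ma a0 aL s (ltW (c_gt0 u0 u1))).
Qed.

Let r_bound k (x : R) : 0 <= x -> `|r k x| <= 1.
Proof. by move=> x0; have [/(_ k)/andP[r0 r1] _] := er x0; rewrite ger0_norm. Qed.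

Let vk_ge0 k s : 0 <= vk k s.
Proof.
apply: Rintegral_ge0 => w _; rewrite mulr_ge0 ?powR_ge0//.
have h : 0 <= s `^ nu * W w by rewrite mulr_ge0 ?powR_ge0.
by have [/(_ k)/andP[]] := er h.
Qed.

Let vk_continuous k s : 0 < s -> {for s, continuous (vk k)}.
Proof.
move=> s0; apply: (@continuity_under_integral _ _ _ P
  (fun s w => W w * r k (s `^ nu * W w)) G mG 0 (s + 1) _ _ W).
- by move=> x _; have [+ _] := vk_genfun x; exact.
- apply: aeW => w Gw x; rewrite inE/= in_itv/= => /andP[x0 _].
  have cx : {for x, continuous (fun x : R => r k (x `^ nu * W w))}.
    apply: (@continuous_comp R R R (fun x => x `^ nu * W w) (r k)).
      by apply: continuousM; [exact: continuous_powR|exact: cst_continuous].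
    have p0 : 0 < x `^ nu * W w by apply: mulr_gt0; [exact: powR_gt0|exact: W_gt0].
    exact: expfam_continuous er p0.
  by apply: cvgM; [exact: cvg_cst|exact: cx].
- exact: iW.
- move=> x _; apply: aeW => w Gw; rewrite normrM ger0_norm ?powR_ge0// ler_piMr ?powR_ge0//.
  by rewrite r_bound// mulr_ge0 ?powR_ge0.
- by rewrite inE/= in_itv/= s0 ltrDl ltr01.
Qed.

Let D k s := nu * s `^ (nu - 1) * vk k s.

Let D_ge0 k s : 0 <= D k s.
Proof. by apply: mulr_ge0 (vk_ge0 k s); rewrite mulr_ge0 ?powR_ge0// ltW. Qed.

Let D_continuous k s : 0 < s -> {for s, continuous (D k)}.
Proof.
move=> s0; apply: continuousM; last exact: vk_continuous.
by apply: continuousM; [exact: cst_continuous|exact: continuous_powR].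
Qed.

Let D_measurable k : measurable_fun `](0 : R), +oo[ (D k).
Proof. by apply: continuous_measurable_itvoy => x; exact: D_continuous. Qed.

Let D_genfun s : genfun (D ^~ s) (fun u => nu * s `^ (nu - 1) * vt (c u) s).
Proof. by have [_ h] := vk_genfun s; exact: genfunZ h. Qed.

Let rho k t := \int[leb]_(s in `]t, +oo[) D k s.

Let rho_genfun t : 0 < t -> (forall k, leb.-integrable `]t, +oo[ (EFin \o D k)) /\
  genfun (rho ^~ t) (fun u => (c u)^-1 * \int[P]_(w in G) expR (- (c u * (t `^ nu * W w)))).
Proof.
move=> t0; have I u : 0 < u -> u < 1 ->
    (\int[leb]_(s in `]t, +oo[) (nu * s `^ (nu - 1) * vt (c u) s)%:E =
     ((c u)^-1 * \int[P]_(w in G) expR (- (c u * (t `^ nu * W w))))%:E)%E.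
  move=> u0 u1.
  exact: (stable_transform_tailE nu0 nu1 mG ma a0 aL (c_gt0 u0 u1) (ltW t0)).
have [|||||h1 h2] := @genfun_integral _ _ _ leb `]t, +oo[%classic _ D
  (fun u s => nu * s `^ (nu - 1) * vt (c u) s).
- exact: measurable_itv.
- move=> k; apply: (measurable_funS _ _ (D_measurable k)) => //.
  by move=> s /=; rewrite !in_itv/= !andbT; exact: lt_trans.
- by move=> k s _; exact: D_ge0.
- by move=> s _; exact: D_genfun.
- by move=> u u0 u1; rewrite (I u u0 u1) ltry.
split => //; apply: genfun_ext h2 => u u0 u1.
by rewrite /Rintegral (I u u0 u1).
Qed.

Let rho_is_derive k (t : R) : 0 < t -> is_derive t 1 (rho k) (- D k t).
Proof.
move=> t0; apply: integrable_itvoy_is_derive => //; last exact: D_continuous.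
by move=> s s0; have [+ _] := rho_genfun s0; exact.
Qed.

(** The generating function of [rho] is that of [q] divided by c; multiplying back by c = mu (1 -
    beta / (beta + psi)) gives this formula, whose right-hand side can be differentiated for each
    k. *)
Let qE k t : 0 < t -> q k t = mu * (rho k t - conv b (rho ^~ t) k).
Proof.
move=> t0; have [_ gr] := rho_genfun t0.
apply: (genfun_inj_at k (gq t0) (@genfunZ _ mu _ _ (genfunB gr (genfun_conv gb gr)))) => u u0 u1.
have : 0 < psi u by exact: psi0.
set I := Rintegral _ _ _ => p0; rewrite /c.
by field; rewrite !gt_eqF ?addr_gt0.
Qed.

Let dq k t := mu * (conv b (D ^~ t) k - D k t).

Let q_is_derive k (t : R) : 0 < t -> is_derive t 1 (q k) (dq k t).
Proof.
move=> t0; apply: (@near_eq_is_derive _ _ _ (fun t => mu * (rho k t - conv b (rho ^~ t) k))).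
  by near=> s; rewrite qE//; near: s; exact: lt_nbhsr.
have -> : dq k t = mu *: (- D k t - conv b (fun i => - D i t) k).
  by rewrite convN opprK addrC.
apply: is_deriveZ; apply: is_deriveB; first exact: rho_is_derive.
by apply: is_derive_conv => i; exact: rho_is_derive.
Unshelve. all: by end_near. Qed.

Let I k (t s : R) := (t - s) `^ (- nu) * D k s.

(** The identity for transforms read on coefficients, which the positivity of [D] permits. As - D is
    the derivative of [rho], it says that the Caputo derivative of [rho] is - q. *)
Let I_integral t : 0 < t ->
  (forall k, leb.-integrable `]0, t[ (EFin \o I k t)) /\
  forall k, \int[leb]_(s in `]0, t[) I k t s = Gamma (1 - nu) * q k t.
Proof.
move=> t0; have E u : 0 < u -> u < 1 ->
    (\int[leb]_(s in `]0%R, t[) ((t - s) `^ (- nu) * (nu * s `^ (nu - 1) * vt (c u) s))%:E =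
     (Gamma (1 - nu) * \int[P]_(w in G) expR (- (c u * (t `^ nu * W w))))%:E)%E.
  move=> u0 u1.
  exact: (stable_convolution nu0 nu1 mG ma a0 aL PG (c_gt0 u0 u1) t0).
have [|||||h1 h2] := @genfun_integral _ _ _ leb `]0, t[%classic _ (fun k => I k t)
  (fun u s => (t - s) `^ (- nu) * (nu * s `^ (nu - 1) * vt (c u) s)).
- exact: measurable_itv.
- move=> k; apply: measurable_funM.
    apply: (@measurableT_comp _ _ _ _ _ _ (fun y : R => y `^ (- nu))); first exact: measurable_powR.
    exact: measurable_funB.
  apply: (measurable_funS _ _ (D_measurable k)) => //.
  by move=> s /=; rewrite !in_itv/= andbT => /andP[].
- by move=> k s _; apply: mulr_ge0 (D_ge0 k s); exact: powR_ge0.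
- by move=> s _; exact: (genfunZ (@D_genfun s)).
- by move=> u u0 u1; rewrite (E u u0 u1) ltry.
split => // k.
apply: (genfun_inj_at k h2 (@genfunZ _ (Gamma (1 - nu)) _ _ (gq t0))) => u u0 u1.
by rewrite /Rintegral (E u u0 u1).
Qed.

Variables (a' : nat -> R) (k : nat).
Let f (t : R) := conv a' (q ^~ t) k.

Let f_is_derive (t : R) : 0 < t -> is_derive t 1 f (conv a' (dq ^~ t) k).
Proof. by move=> t0; apply: is_derive_conv => i; exact: q_is_derive. Qed.

Let caputo_integral t : 0 < t ->
  leb.-integrable `]0, t[ (EFin \o caputo_integrand nu f t) /\
  \int[leb]_(s in `]0, t[) caputo_integrand nu f t s =
    - (Gamma (1 - nu) * (mu * conv a' (fun i => q i t - conv b (q ^~ t) i) k)).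
Proof.
move=> t0; have [iI EI] := I_integral t0.
pose J i s := mu * (conv b (fun l => I l t s) i - I i t s).
have iJ i : leb.-integrable `]0, t[ (EFin \o J i) /\
    \int[leb]_(s in `]0, t[) J i s =
    - (Gamma (1 - nu) * (mu * (q i t - conv b (q ^~ t) i))).
  have [//|ic Ec] := @Rintegral_conv R _ _ leb `]0, t[%classic (fun i => I i t) b i _ iI.
  have iB : leb.-integrable `]0, t[ (EFin \o (fun s => conv b (fun l => I l t s) i - I i t s)).
    by apply: eq_integrable (integrableB _ ic (iI i)) => // s _ /=; rewrite EFinB.
  split.
    by apply: eq_integrable (integrableZl _ mu iB) => // s _ /=; rewrite EFinM.
  rewrite /J RintegralZl// RintegralB// Ec EI.
  under eq_fun do rewrite EI.
  rewrite convZr; ring.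
have E : {in `]0, t[%classic, caputo_integrand nu f t =1 (fun s => conv a' (J ^~ s) k)}.
  move=> s; rewrite inE/= in_itv/= => /andP[s0 st].
  rewrite /caputo_integrand derive1E; have [_ ->] := f_is_derive s0.
  rewrite -convZr; congr conv; apply/funext => i.
  by rewrite /J /dq /I convZr; set X := conv _ _ _; set Y := D _ _; ring.
have [//||iC EC] := @Rintegral_conv R _ _ leb `]0, t[%classic J a' k _.
  by move=> i; have [] := iJ i.
split.
  by apply: eq_integrable iC => // s sD /=; rewrite E.
transitivity (\int[leb]_(s in `]0, t[) conv a' (J ^~ s) k).
  by apply: eq_Rintegral; exact: E.
rewrite EC -convZr -convZr -convN.
by congr conv; apply/funext => i; have [_ ->] := iJ i.
Qed.

Lemma caputo_conv t : 0 < t ->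
  caputo nu f t = - (mu * conv a' (fun i => q i t - conv b (q ^~ t) i) k).
Proof.
move=> t0; rewrite /caputo; have [_ ->] := caputo_integral t0.
have [Gam0 _] := @Gamma_gt0_lty R (1 - nu) ltac:(by rewrite subr_gt0) ltac:(by rewrite gerBl ltW).
by rewrite mulrN mulKf// gt_eqF.
Qed.

Lemma caputo_derivable_conv : caputo_derivable nu f.
Proof.
split => t t0; first by have [] := f_is_derive t0.
by have [] := caputo_integral t0.
Qed.

End caputo_mixture.

(** * The composed process *)

Section right_constant.
Context {R : realType}.

(** For integer-valued paths this is right-continuity. For arbitrary values it is stronger and,
    unlike continuity in general, survives application of any function to the path. *)
Definition right_constant (E : Type) (x : R -> E) : Prop :=
  forall t : R, 0 <= t -> \forall s \near t^'+, x s = x t.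

(** A nondecreasing right-continuous time either stays at tau t or approaches it from the right, so
    the outer path is only looked at on the side where it is constant. *)
Lemma right_constant_comp (E : Type) (x : R -> E) (tau : R -> R) :
  right_constant x -> (forall t, 0 <= t -> 0 <= tau t) ->
  (forall s t, 0 <= s -> s <= t -> tau s <= tau t) ->
  (forall t, 0 <= t -> tau s @[s --> t^'+] --> tau t) ->
  right_constant (x \o tau).
Proof.
move=> xc tau0 taum tauc t t0; have xt := xc _ (tau0 t t0).
have h : \forall y \near tau t, tau t < y -> x y = x (tau t) by exact: xt.
have h' : \forall s \near t^'+, tau t < tau s -> x (tau s) = x (tau t) by exact: (tauc t t0) _ h.
near=> s; have ts : t < s by near: s; exact: nbhs_right_gt.
have := taum t s t0 (ltW ts); rewrite le_eqVlt => /predU1P[/= ->//|].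
by near: s.
Unshelve. all: by end_near. Qed.

Lemma right_constant_natr (n : R -> nat) :
  (forall t : R, 0 <= t -> (n s)%:R @[s --> t^'+] --> ((n t)%:R : R)) -> right_constant n.
Proof.
move=> nc t t0; have /cvgrPdist_lt := nc t t0.
move=> /(_ 1 ltr01); apply: filterS => s.
rewrite ltr_norml => /andP[h1 h2].
have ts : (n t < (n s).+1)%N by rewrite -(ltr_nat R) -natr1; lra.
have st : (n s < (n t).+1)%N by rewrite -(ltr_nat R) -natr1; lra.
by apply/eqP; rewrite eqn_leq -ltnS st.
Qed.

End right_constant.

Section subordination.
Context d (T : measurableType d) (R : realType) (P : probability T R).
Hypothesis Pc : measure_is_complete P.

(** One step of composition. The last conclusion keeps the composed process independent of any event
    that was independent of the outer process and the time together, which prepares the next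
    step. *)
Lemma genfun_subordination (X : R -> T -> nat) (tau : R -> T -> R)
    (zeta : nat -> R -> R) (psi : R -> R) :
  (forall u, 0 < u -> u < 1 -> 0 <= psi u) -> expfam zeta psi ->
  (forall k s, 0 <= s -> measurable [set w | X s w = k]) ->
  (forall k s, 0 <= s -> P [set w | X s w = k] = (zeta k s)%:E) ->
  {ae P, forall w, right_constant (X ^~ w)} ->
  (forall t, 0 <= t -> measurable_fun setT (tau t)) ->
  (forall t, 0 <= t -> {ae P, forall w, 0 <= tau t w}) ->
  (forall k s t a b, 0 <= s -> 0 <= t ->
    (P ([set w | X s w = k] `&` (tau t @^-1` `[a, b[)) =
     P [set w | X s w = k] * P (tau t @^-1` `[a, b[))%E) ->
  [/\ forall k t, 0 <= t -> measurable [set w | X (tau t w) w = k],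
      forall t, 0 <= t -> (forall k, 0 <= fine (P [set w | X (tau t w) w = k]) <= 1) /\
        genfun (fun k => fine (P [set w | X (tau t w) w = k]))
          (fun u => \int[P]_(w in tau t @^-1` `[0, +oo[) expR (- (psi u * tau t w))) &
      forall k t C, 0 <= t -> measurable C ->
        (forall s a b, 0 <= s ->
          (P ([set w | X s w = k] `&` (tau t @^-1` `[a, b[ `&` C)) =
           P [set w | X s w = k] * (P (tau t @^-1` `[a, b[) * P C))%E) ->
        (P ([set w | X (tau t w) w = k] `&` C) = P [set w | X (tau t w) w = k] * P C)%E].
Proof.
move=> psi0 ez mX PX Xrc mtau tau0 ind.
have Zrc t : 0 <= t -> {ae P, forall w, forall k, \forall s \near (tau t w)^'+,
    [set w | X s w = k] w <-> [set w' | X (tau t w) w' = k] w}.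
  move=> t0; apply: filterS2 Xrc (tau0 t t0) => w Xw t0w j.
  by apply: filterS (Xw _ t0w) => s /= ->.
have tc t k : 0 <= t -> measurable [set w | X (tau t w) w = k] /\
    P [set w | X (tau t w) w = k] = (\int[P]_(w in tau t @^-1` `[0%R, +oo[) zeta k (tau t w))%:E.
  move=> t0; have [|m E] := @expfam_time_change _ _ _ P Pc (fun k s => [set w | X s w = k]) (tau t) zeta psi
    psi0 ez mX (mtau t t0) (tau0 t t0) (Zrc t t0) PX setT k measurableT _.
  - move=> s a b s0; rewrite setIT probability_setT mule1; exact: ind.
  by rewrite setIT probability_setT mule1 in E.
split => [k t t0|t t0|k t C t0 mC indC]; first by have [] := tc t k t0.
- split => [k|].
    have [m _] := tc t k t0; rewrite fine_ge0//= -lee_fin fineK ?fin_num_measure//.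
    exact: probability_le1.
  have [_ g] := genfun_time_change P psi0 ez (mtau t t0).
  rewrite (_ : (fun k => _) = (fun k => \int[P]_(w in tau t @^-1` `[0, +oo[) zeta k (tau t w)))//.
  by apply/funext => k; have [_ ->] := tc t k t0.
- have [_ ->] := tc t k t0.
  by have [] := @expfam_time_change _ _ _ P Pc (fun k s => [set w | X s w = k]) (tau t) zeta psi
    psi0 ez mX (mtau t t0) (tau0 t t0) (Zrc t t0) PX C k mC indC.
Qed.

End subordination.

Lemma integral_full_set d (T : measurableType d) (R : realType) (P : probability T R)
    (G : set T) (f : T -> R) : measurable G -> P G = 1%E ->
  measurable_fun setT f -> (forall w, 0 <= f w) ->
  (\int[P]_(w in G) (f w)%:E = \int[P]_w (f w)%:E)%E.
Proof.
move=> mG PG mf f0.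
have nG : P (~` G) = 0%E by rewrite probability_setC// PG subee.
rewrite -[in RHS](setUv G) ge0_integral_setU//.
- rewrite [X in (_ + X)%E](_ : _ = 0%E) ?adde0//.
  apply: null_set_integral => //; [exact: measurableC|].
  by apply/measurable_EFinP; exact: measurable_funTS.
- exact: measurableC.
- by rewrite setUv; exact/measurable_EFinP.
- by move=> w _; rewrite lee_fin.
- by apply/disj_setPS => w [].
Qed.

Section composed_process.
Context d (T : measurableType d) (R : realType) (P : probability T R).
Hypothesis Pc : measure_is_complete P.
Variables (eta mu beta : R).
Hypotheses (eta0 : 0 < eta) (eta1 : eta < 1) (mu0 : 0 < mu) (beta0 : 0 < beta).

Variables (N1 : R -> T -> nat) (Aeta : R -> T -> R).
Hypothesis mN1 : forall k t, 0 <= t -> measurable [set w | N1 t w = k].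
Hypothesis PN1 : forall k t, 0 <= t -> P [set w | N1 t w = k] = (poisson_family k t)%:E.
Hypothesis N1rc : {ae P, forall w, right_constant (N1 ^~ w)}.
Hypothesis mA : forall t, 0 <= t -> measurable_fun setT (Aeta t).
Hypothesis A0 : {ae P, forall w, Aeta 0 w = 0}.
Hypothesis Amono : {ae P, forall w, forall s t, 0 <= s -> s <= t -> Aeta s w <= Aeta t w}.
Hypothesis Arc : {ae P, forall w, forall t, 0 <= t -> Aeta s w @[s --> t^'+] --> Aeta t w}.
Hypothesis AL : forall t th, 0 <= t -> 0 <= th ->
  (\int[P]_w (expR (- (th * Aeta t w)))%:E = (expR (- (th `^ eta * t)))%:E)%E.
Hypothesis N1A : forall k s t a b, 0 <= s -> 0 <= t ->
  (P ([set w | N1 s w = k] `&` (Aeta t @^-1` `[a, b[)) =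
   P [set w | N1 s w = k] * P (Aeta t @^-1` `[a, b[))%E.

Let N1eta : R -> T -> nat := time_change N1 Aeta.
Let psi (u : R) := (1 - u) `^ eta.

Let psi_gt0 (u : R) : 0 < u -> u < 1 -> 0 < psi u.
Proof. by move=> u0 u1; rewrite powR_gt0// subr_gt0. Qed.

Let mexp (c : R) (tau : T -> R) : measurable_fun setT tau ->
  measurable_fun setT (fun w => expR (- (c * tau w))).
Proof.
move=> mtau; apply: measurableT_comp; first exact: measurable_expR.
by apply: measurableT_comp => //; apply: measurable_funM.
Qed.

Let nonneg_full (tau : T -> R) : measurable_fun setT tau -> {ae P, forall w, 0 <= tau w} ->
  forall c : R, (\int[P]_(w in tau @^-1` `[0%R, +oo[) (expR (- (c * tau w)))%:E =
    \int[P]_w (expR (- (c * tau w)))%:E)%E.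
Proof.
move=> mtau tau0 c.
have [|m E] := @ae_probability1 _ _ _ P Pc (tau @^-1` `[0%R, +oo[) _.
  by apply: filterS tau0 => w; rewrite /= in_itv/= andbT.
by rewrite integral_full_set//; exact: mexp.
Qed.

Let A_ge0 : {ae P, forall w, forall t, 0 <= t -> 0 <= Aeta t w}.
Proof. exact: stable_ge0 A0 Amono. Qed.

Let N1eta_rc : {ae P, forall w, right_constant (N1eta ^~ w)}.
Proof.
apply: filterS2 N1rc (filterI A_ge0 (filterI Amono Arc)) => w N1w [Aw0 [Aw Awc]].
exact: right_constant_comp N1w Aw0 Aw Awc.
Qed.

Let N1eta_family :
  (forall k t, 0 <= t -> measurable [set w | N1eta t w = k]) /\
  expfam (fun k t => fine (P [set w | N1eta t w = k])) psi.
Proof.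
have [||m e _] := @genfun_subordination _ _ _ P Pc N1 Aeta poisson_family (fun u => 1 - u)
  _ (@poisson_expfam R) mN1 PN1 N1rc mA _ N1A.
- by move=> u _ u1; rewrite subr_ge0 ltW.
- by move=> t t0; apply: filterS A_ge0 => w; exact.
split => // t t0; have [e01 g] := e t t0; split => //; apply: genfun_ext g => u u0 u1.
rewrite /Rintegral nonneg_full ?AL ?subr_ge0 ?(ltW u1)//; first exact: mA.
by apply: filterS A_ge0 => w; exact.
Qed.

Let mN1eta := N1eta_family.1.
Let N1eta_expfam := N1eta_family.2.

Let PN1eta k t : 0 <= t -> P [set w | N1eta t w = k] = (fine (P [set w | N1eta t w = k]))%:E.
Proof. by move=> t0; rewrite fineK// fin_num_measure//; exact: mN1eta. Qed.

Variables (Nmu : R -> T -> nat) (Y : nat -> T -> R).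
Hypothesis mNmu : forall k t, 0 <= t -> measurable [set w | Nmu t w = k].
Hypothesis PNmu : forall k t, 0 <= t -> P [set w | Nmu t w = k] = (poisson_family k (mu * t))%:E.
Hypothesis Nmurc : {ae P, forall w, right_constant (Nmu ^~ w)}.
Hypothesis mY : forall k, (1 <= k)%N -> measurable_fun setT (Y k).
Variable F : R -> R.
Hypothesis F0 : forall z, 0 <= F z.
Hypothesis FE : forall z, 0 < z -> F z = 1 - expR (- (beta * z)).
Hypothesis Y_ge0 : {ae P, forall w, forall k, (1 <= k)%N -> 0 <= Y k w}.
Hypothesis NmuY : forall t n M z, 0 <= t ->
  (P ([set w | Nmu t w = n] `&` [set w | forall k, (0 < k)%N -> (k <= M)%N -> (Y k w <= z k)%R]) =
   P [set w | Nmu t w = n] * (\prod_(1 <= k < M.+1) F (z k))%:E)%E.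

Let S (t : R) (w : T) : R := \sum_(1 <= k < (Nmu t w).+1) Y k w.

Let mS t : 0 <= t -> measurable_fun setT (S t).
Proof.
move=> t0; pose E n := [set w | Nmu t w = n].
have -> : [set: T] = \bigcup_n E n by apply/seteqP; split => // w _; exists (Nmu t w).
apply/measurable_fun_bigcup => [n|n]; first exact: mNmu.
apply: (eq_measurable_fun (fun w => \sum_(1 <= k < n.+1) Y k w)).
  by move=> w; rewrite inE /S => ->.
apply: measurable_funTS; rewrite /index_iota subSS subn0.
elim: n => [|n IHn]; first by under eq_fun do rewrite big_nil; exact: measurable_cst.
rewrite -[n.+1]addn1 iotaD; under eq_fun do rewrite big_cat/= big_seq1.
by apply: measurable_funD => //; apply: mY; rewrite add1n.
Qed.

Let S_ge0 : {ae P, forall w, forall t, 0 <= t -> 0 <= S t w}.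
Proof.
apply: filterS Y_ge0 => w Yw t _; rewrite /S big_seq_cond; apply: sumr_ge0 => k.
by rewrite andbT mem_index_iota => /andP[k1 _]; exact: Yw.
Qed.

Let S_rc : {ae P, forall w, right_constant (S ^~ w)}.
Proof.
by apply: filterS Nmurc => w h t t0; apply: filterS (h t t0) => s; rewrite /S => ->.
Qed.

Let c u := mu * (psi u / (beta + psi u)).

Let S_laplace u t : 0 < u -> u < 1 -> 0 <= t ->
  (\int[P]_(w in S t @^-1` `[0%R, +oo[) (expR (- (psi u * S t w)))%:E =
   (expR (- (c u * t)))%:E)%E.
Proof.
move=> u0 u1 t0; rewrite nonneg_full; last 2 first.
- exact: mS.
- by apply: filterS S_ge0 => w; exact.
have [mG PG] := @ae_probability1 _ _ _ P Pc [set w | forall k, (1 <= k)%N -> 0 <= Y k w] Y_ge0.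
have := @compound_laplace _ _ _ P (Nmu t) Y F beta (mu * t) (psi u) beta0 (psi_gt0 u0 u1)
  (fun n => mNmu n t0) (fun n => PNmu n t0) mY F0 FE PG (fun n M z => NmuY n M z t0).
rewrite integral_full_set//; last by apply: mexp; exact: mS.
by move=> ->; congr (expR _)%:E; rewrite /c; ring.
Qed.

Variable tau : R -> T -> R.
Hypothesis mtau : forall t, 0 <= t -> measurable_fun setT (tau t).
Hypothesis tau_ge0 : forall t, 0 <= t -> {ae P, forall w, 0 <= tau t w}.
Hypothesis ind3 : forall k s t t' a b a' b', 0 <= s -> 0 <= t -> 0 <= t' ->
  (P ([set w | N1eta s w = k] `&` (S t @^-1` `[a, b[ `&` tau t' @^-1` `[a', b'[)) =
   P [set w | N1eta s w = k] * (P (S t @^-1` `[a, b[) * P (tau t' @^-1` `[a', b'[)))%E.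
Hypothesis ind2 : forall k s t a b, 0 <= s -> 0 <= t ->
  (P ([set w | N1eta s w = k] `&` S t @^-1` `[a, b[) =
   P [set w | N1eta s w = k] * P (S t @^-1` `[a, b[))%E.

Let X (t : R) (w : T) : nat := N1eta (S t w) w.

Let X_family :
  [/\ forall k t, 0 <= t -> measurable [set w | X t w = k],
      expfam (fun k t => fine (P [set w | X t w = k])) c &
      forall k s t a b, 0 <= s -> 0 <= t ->
        (P ([set w | X s w = k] `&` (tau t @^-1` `[a, b[)) =
         P [set w | X s w = k] * P (tau t @^-1` `[a, b[))%E].
Proof.
have [||m e i] := @genfun_subordination _ _ _ P Pc N1eta S _ psi
  _ N1eta_expfam mN1eta PN1eta N1eta_rc mS _ ind2.
- by move=> u u0 u1; exact/ltW/psi_gt0.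
- by move=> t t0; apply: filterS S_ge0 => w; exact.
split => //.
  move=> t t0; have [e01 g] := e t t0; split => //; apply: genfun_ext g => u u0 u1.
  by rewrite /Rintegral S_laplace.
move=> k s t a b s0 t0; apply: i => //.
  by rewrite -[_ @^-1` _]setTI; exact: mtau.
by move=> s' a' b' s'0; exact: ind3.
Qed.

Let X_rc : {ae P, forall w, right_constant (X ^~ w)}.
Proof.
by apply: filterS S_rc => w h t t0; apply: filterS (h t t0) => s; rewrite /X => ->.
Qed.

Let q k t : R := fine (P [set w | X (tau t w) w = k]).
Let b := exp_mixture beta (fun k t => fine (P [set w | N1eta t w = k])).

Let gb : genfun b (fun u => beta / (beta + psi u)).
Proof. by apply: genfun_exp_mixture N1eta_expfam => // u u0 u1; exact/ltW/psi_gt0. Qed.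

Let c_ge0 u : 0 < u -> u < 1 -> 0 <= c u.
Proof. by move=> u0 u1; rewrite mulr_ge0 ?divr_ge0 ?addr_ge0 ?(ltW mu0) ?(ltW beta0)// ltW// psi_gt0. Qed.

Let q_family t : 0 <= t -> (forall k, 0 <= q k t <= 1) /\
  genfun (q ^~ t) (fun u => fine (\int[P]_w (expR (- (c u * tau t w)))%:E)%E).
Proof.
move=> t0; have [mX eX iX] := X_family.
have PX k s : 0 <= s -> P [set w | X s w = k] = (fine (P [set w | X s w = k]))%:E.
  by move=> s0; rewrite fineK// fin_num_measure//; exact: mX.
have [_ e _] := @genfun_subordination _ _ _ P Pc X tau _ c c_ge0 eX mX PX X_rc mtau tau_ge0 iX.
have [e01 g] := e t t0; split => //; apply: genfun_ext g => u u0 u1.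
by rewrite /Rintegral nonneg_full//; [exact: mtau|exact: tau_ge0].
Qed.

Lemma composed_riemann_liouville nu : 1 < nu ->
  (forall t th, 0 <= t -> 0 <= th ->
    (\int[P]_w (expR (- (th * tau t w)))%:E = (expR (- (th `^ nu^-1 * t)))%:E)%E) ->
  (forall k, riemann_liouville_derivable nu (q k)) /\
  forall k t, 0 < t ->
    riemann_liouville nu (q k) t = 1 / beta * (mu * frac_diff eta (q ^~ t) k -
      riemann_liouville nu (fun s => frac_diff eta (q ^~ s) k) t).
Proof.
move=> nu1 tauL.
have eq : expfam q (fun u => c u `^ nu^-1).
  move=> t t0; have [q01 g] := q_family t0; split => //; apply: genfun_ext g => u u0 u1.
  by rewrite tauL ?c_ge0.
have qE k : q k = fun t => conv (fun i => (i == 0%N)%:R) (q ^~ t) k.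
  by apply/funext => t; rewrite conv_delta.
split => [k|k t t0].
  by rewrite qE; exact: (riemann_liouville_derivable_conv beta0 mu0 nu1 psi_gt0 eq gb).
rewrite [in LHS]qE (riemann_liouville_conv beta0 mu0 nu1 psi_gt0 eq gb _ _ t0) conv_delta.
pose g (j : nat) : R := (-1) ^+ j * gbinom eta j.
have -> : riemann_liouville nu (fun s => frac_diff eta (q ^~ s) k) t =
    mu * frac_diff eta (fun i => q i t - conv b (q ^~ t) i) k.
  exact: (riemann_liouville_conv beta0 mu0 nu1 psi_gt0 eq gb g k t0).
have [_ gt] := eq t (ltW t0).
rewrite -mulrBr -(frac_diff_mixture k eta0 eta1 beta0 gb gt).
by rewrite mul1r [mu * (beta * _)]mulrCA mulKf// gt_eqF.
Qed.

Lemma composed_caputo nu (A : R -> T -> R) : 0 < nu -> nu < 1 ->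
  (forall t, 0 <= t -> measurable_fun setT (A t)) ->
  {ae P, forall w, A 0 w = 0} ->
  {ae P, forall w, forall s t, 0 <= s -> s <= t -> A s w <= A t w} ->
  (forall t th, 0 <= t -> 0 <= th ->
    (\int[P]_w (expR (- (th * A t w)))%:E = (expR (- (th `^ nu * t)))%:E)%E) ->
  tau = inverse_process A ->
  (forall k, caputo_derivable nu (q k)) /\
  forall k t, 0 < t ->
    caputo nu (q k) t = - (1 / beta) * (mu * frac_diff eta (q ^~ t) k +
      caputo nu (fun s => frac_diff eta (q ^~ s) k) t).
Proof.
move=> nu0 nu1 mA' A0' Am' AL' tauE.
(* A full event on which the negative power of A 1 is a genuine power. *)
pose G := [set w | 0 < A 1 w].
have [mG PG] : measurable G /\ P G = 1%E.
  exact: ae_probability1 (stable_gt0 nu0 mA' AL' ltr01).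
have c_gt0 u : 0 < u -> u < 1 -> 0 < c u.
  by move=> u0 u1; rewrite mulr_gt0// divr_gt0 ?addr_gt0 ?psi_gt0.
have aL (x : R) : 0 < x -> (\int[P]_(w in G) (expR (- (x * A 1 w)))%:E = (expR (- (x `^ nu)))%:E)%E.
  move=> x0; rewrite integral_full_set//; last by apply: mexp; exact: mA'.
  by rewrite (AL' _ _ ler01 (ltW x0)) mulr1.
have gq t : 0 < t -> genfun (q ^~ t)
    (fun u => \int[P]_(w in G) expR (- (c u * (t `^ nu * A 1 w `^ (- nu))))).
  move=> t0; have [_ g] := q_family (ltW t0); apply: genfun_ext g => u u0 u1.
  by rewrite tauE (inverse_process_laplace Pc nu0 mA' A0' Am' AL' (c_gt0 u u0 u1) t0).
have eX : expfam (fun k t => fine (P [set w | X t w = k])) c by have [] := X_family.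
have qE k : q k = fun t => conv (fun i => (i == 0%N)%:R) (q ^~ t) k.
  by apply/funext => t; rewrite conv_delta.
have mA1 : measurable_fun G (A 1) by apply: measurable_funTS; exact: mA'.
have Gpos w : G w -> 0 < A 1 w by [].
split => [k|k t t0].
  rewrite qE; exact: (caputo_derivable_conv nu0 nu1 mG mA1 Gpos aL PG beta0 mu0 psi_gt0 eX gq gb).
rewrite [in LHS]qE (caputo_conv nu0 nu1 mG mA1 Gpos aL PG beta0 mu0 psi_gt0 eX gq gb _ _ t0) conv_delta.
pose g (j : nat) : R := (-1) ^+ j * gbinom eta j.
have -> : caputo nu (fun s => frac_diff eta (q ^~ s) k) t =
    - (mu * frac_diff eta (fun i => q i t - conv b (q ^~ t) i) k).
  exact: (caputo_conv nu0 nu1 mG mA1 Gpos aL PG beta0 mu0 psi_gt0 eX gq gb g k t0).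
rewrite -mulrBr -(frac_diff_mixture k eta0 eta1 beta0 gb (gq t t0)).
by rewrite mul1r mulNr [mu * (beta * _)]mulrCA mulKf// gt_eqF.
Qed.

Lemma composed_initial : {ae P, forall w, tau 0 w = 0} -> {ae P, forall w, Nmu 0 w = 0%N} ->
  {ae P, forall w, N1 0 w = 0%N} -> q 0 0 = 1 /\ forall k, (1 <= k)%N -> q k 0 = 0.
Proof.
move=> t00 Nmu0 N10.
have h : {ae P, forall w, X (tau 0 w) w = 0%N}.
  apply: filterS2 t00 (filterI Nmu0 (filterI N10 A0)) => w t0w [Nw [N1w A0w]].
  by rewrite t0w /X /S Nw big_nil /N1eta /time_change A0w.
split => [|k k1]; first by rewrite /q; have [_ ->] := ae_probability1 Pc h.
have [|_ E] := @ae_measurable_set _ _ _ P Pc set0 [set w | X (tau 0 w) w = k] measurable0.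
  by apply: filterS h => w /= ->; split => //; move: k1 => /[swap] <-.
by rewrite /q E measure0.
Qed.

End composed_process.

(** * Measurability up to null sets and independence *)

Section completion.
Context d (T : measurableType d) (R : realType) (P : probability T R).

(** The outer measure P^* on its Caratheodory sigma-algebra is complete, and its value on any set is
    [Pr]. Hypotheses and conclusions phrased with [Pr] thus become statements about one complete
    probability. *)
Definition completion : set (caratheodory_type (P^*)%mu) -> \bar R :=
  @completed_measure_extension _ _ _ P.

HB.instance Definition _ := Measure.on completion.

Lemma measurable_completion (A : set T) : measurable A ->
  measurable (A : set (caratheodory_type (P^*)%mu)).
Proof. exact: caratheodory_measurable_mu_ext. Qed.

Lemma completionE (A : set T) : measurable A -> completion A = P A.
Proof. exact: measurable_mu_extE. Qed.

Lemma completion_setT : completion [set: T] = 1%E.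
Proof. by rewrite completionE// probability_setT. Qed.

HB.instance Definition _ := Measure_isProbability.Build _ _ _ completion completion_setT.

Lemma completion_complete : measure_is_complete completion.
Proof. exact: measure_is_complete_caratheodory. Qed.

Lemma completion_Pr (A : set T) : completion A = (Pr P A)%:E.
Proof.
rewrite /Pr fineK// ge0_fin_numE ?mu_ext_ge0//.
apply: (@le_lt_trans _ _ 1%E); last exact: ltry.
rewrite -completion_setT; exact: le_mu_ext.
Qed.

Lemma measurable_fun_completion (f : T -> R) : measurable_fun setT f ->
  measurable_fun setT (f : caratheodory_type (P^*)%mu -> R).
Proof. by move=> mf _ B mB; apply: measurable_completion; exact: mf. Qed.

Lemma ae_completion (Q : T -> Prop) : {ae P, forall w, Q w} -> {ae completion, forall w, Q w}.
Proof.
move=> [N [mN PN QN]]; exists N; split => //; first exact: measurable_completion.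
by rewrite completionE.
Qed.

(** P is the image of its completion under the identity, which is measurable from the larger
    sigma-algebra to the original one. *)
Lemma integral_completion (f : T -> R) : measurable_fun setT f -> (forall w, 0 <= f w) ->
  (\int[completion]_w (f w)%:E = \int[P]_w (f w)%:E)%E.
Proof.
move=> mf f0.
have mid : measurable_fun setT (id : caratheodory_type (P^*)%mu -> T).
  by move=> _ B mB; rewrite setTI; exact: measurable_completion.
have mEf : measurable_fun setT (EFin \o f) by exact/measurable_EFinP.
have := @ge0_integral_pushforward _ _ _ _ R _ mid completion setT (EFin \o f) measurableT mEf.
rewrite preimage_setT => <-; last by move=> w _; rewrite lee_fin.
by apply: eq_measure_integral => A mA _; exact: completionE.
Qed.

End completion.

(** * Product formulas extracted from independence *)

Section independence.
Context d (T : measurableType d) (R : realType) (P : probability T R).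

Lemma process_sigma_preimage (I : Type) (D : set I) d' (E : measurableType d')
    (X : I -> T -> E) i (B : set E) : D i -> measurable B ->
  process_sigma D X (X i @^-1` B).
Proof.
move=> Di mB; apply: sub_sigma_algebra; exists i => //.
by exists B => //; rewrite setTI.
Qed.

Lemma mutually_independent_ord n (F : 'I_n -> set (set T)) (E : 'I_n -> set T) :
  mutually_independent P setT F -> (forall i, F i (E i)) ->
  Pr P (\bigcap_(i in setT) E i) = \prod_(i < n) Pr P (E i).
Proof.
move=> ind FE; have := ind [fset i | i in 'I_n]%fset E (@subsetT _ _) (fun i _ => FE i).
have -> : [set` [fset i | i in 'I_n]%fset] = [set: 'I_n].
  by apply/seteqP; split => // i _ /=; rewrite inE.
move=> ->; apply: perm_big; apply: uniq_perm; [exact: fset_uniq|exact: index_enum_uniq|].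
by move=> i; rewrite mem_index_enum inE.
Qed.

Lemma independent2P (F G : set (set T)) A B : independent2 P F G -> F A -> G B ->
  Pr P (A `&` B) = Pr P A * Pr P B.
Proof.
move=> ind FA GB.
have := @mutually_independent_ord 2 _ (tnth [tuple A; B]) ind.
rewrite !big_ord_recl big_ord0 mulr1 /= => <-.
  congr (Pr P _); apply/seteqP; split => w.
    by move=> [Aw Bw] i _; case: i => -[|[|//]] i2; rewrite /tnth/=.
  by move=> h; split; [have := h ord0 I|have := h (lift ord0 ord0) I].
by move=> i; case: i => -[|[|//]] i2; rewrite /tnth/=.
Qed.

Lemma independent3P (F G H : set (set T)) A B C : independent3 P F G H -> F A -> G B -> H C ->
  Pr P (A `&` (B `&` C)) = Pr P A * (Pr P B * Pr P C).
Proof.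
move=> ind FA GB HC.
have := @mutually_independent_ord 3 _ (tnth [tuple A; B; C]) ind.
rewrite !big_ord_recl big_ord0 mulr1 /= => <-.
  congr (Pr P _); apply/seteqP; split => w.
    by move=> [Aw [Bw Cw]] i _; case: i => -[|[|[|//]]] i3; rewrite /tnth/=.
  by move=> h; split; [have := h ord0 I|split; [have := h (lift ord0 ord0) I|have := h (lift ord0 (lift ord0 ord0)) I]].
by move=> i; case: i => -[|[|[|//]]] i3; rewrite /tnth/=.
Qed.

End independence.

(** * Consequences of the definitions of the processes *)

Section process_facts.
Context d (T : measurableType d) (R : realType) (P : probability T R).

Lemma poisson_family0 k : poisson_family k (0 : R) = (k == 0%N)%:R.
Proof.
rewrite /poisson_family oppr0 expR0 mulr1; case: k => [|k]; first by rewrite expr0 fact0 invr1 mulr1.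
by rewrite expr0n mul0r.
Qed.

Lemma ae_measurable_probability1 (A : set T) : measurable A -> {ae P, forall w, A w} -> P A = 1%E.
Proof.
move=> mA hA; have nA : P.-negligible (~` A) by exact: hA.
have E : P (~` A) = 0%E by apply: measure_negligible nA; exact: measurableC.
move/eqP: E; rewrite probability_setC// sube_eq ?fin_num_measure// ?add0e.
  by move/eqP.
Qed.

Lemma poisson_process_facts (m : R) (N : R -> T -> nat) : 0 < m -> is_poisson_process P m N ->
  [/\ forall k t, 0 <= t -> measurable [set w | N t w = k],
      forall k t, 0 <= t -> P [set w | N t w = k] = (poisson_family k (m * t))%:E,
      {ae P, forall w, right_constant (N ^~ w)} &
      {ae P, forall w, N 0 w = 0%N}].
Proof.
move=> m0 [[mN N0 _ _ Ncad] NP].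
have N0' : {ae P, forall w, N 0 w = 0%N}.
  by apply: filterS N0 => w /eqP; rewrite pnatr_eq0 => /eqP.
have mNk k t : 0 <= t -> measurable [set w | N t w = k].
  move=> t0; rewrite (_ : [set w | _] = (fun w => (N t w)%:R : R) @^-1` [set k%:R]).
    by rewrite -[_ @^-1` _]setTI; apply: mN.
  by apply/seteqP; split => w /= => [->//|/eqP]; rewrite eqr_nat => /eqP.
split => //.
(* The law is prescribed for t > 0 only; at t = 0 it comes from the almost sure initial value. *)
- move=> k t; rewrite le_eqVlt => /predU1P[<-|t0]; last first.
    by rewrite NP// poisson_pmfE// mulr_gt0.
  rewrite mulr0 poisson_family0.
  have P0 : P [set w | N 0 w = 0%N] = 1%E.
    exact: ae_measurable_probability1 (mNk _ _ (lexx 0)) N0'.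
  case: eqVneq => [->//|k0]; apply/eqP; rewrite eq_le measure_ge0 andbT.
  rewrite -[leRHS](subee (x := 1%E))// -[X in (_ <= _ - X)%E]P0 -probability_setC; last exact: mNk.
  apply: le_measure; rewrite ?inE; [exact: mNk|by apply: measurableC; exact: mNk|].
  by move=> w /= -> /eqP; rewrite (negbTE k0).
- apply: filterS Ncad => w [Nr _]; exact: right_constant_natr.
Qed.

Lemma stable_subordinator_facts (alpha : R) (A : R -> T -> R) : is_stable_subordinator P alpha A ->
  [/\ forall t, 0 <= t -> measurable_fun setT (A t),
      {ae P, forall w, A 0 w = 0},
      {ae P, forall w, forall s t, 0 <= s -> s <= t -> A s w <= A t w},
      {ae P, forall w, forall t, 0 <= t -> A s w @[s --> t^'+] --> A t w} &
      forall t th, 0 <= t -> 0 <= th ->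
        (\int[P]_w (expR (- (th * A t w)))%:E = (expR (- (th `^ alpha * t)))%:E)%E].
Proof.
move=> [[mA A0 _ _ Acad] Am AL]; split => //.
- by apply: filterS Acad => w [].
- by move=> t th t0 th0; have := AL t th t0 th0; rewrite expectation.unlock.
Qed.

End process_facts.

Section exponential_facts.
Context d (T : measurableType d) (R : realType) (P : probability T R).
Variables (beta : R) (Y : nat -> {RV P >-> R}).

Let E M (z : nat -> R) : set T := [set w | forall k, (0 < k)%N -> (k <= M)%N -> Y k w <= z k].

Let EE M z : E M z = \bigcap_(k in [set k | (0 < k <= M)%N]) (Y k @^-1` `]-oo, z k]).
Proof.
apply/seteqP; split => w /=.
  by move=> h k /= /andP[k0 kM]; rewrite in_itv/=; exact: h.
by move=> h k k0 kM; have := h k; rewrite /= in_itv/= k0 kM; exact.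
Qed.

Lemma process_sigma_le M z :
  process_sigma [set k | (1 <= k)%N] (fun k => Y k : T -> R) (E M z).
Proof.
rewrite EE; pose C := \bigcup_(i in [set k | (1 <= k)%N]) preimage_set_system setT (Y i : T -> R) measurable.
apply: (@bigcap_measurableType _ (g_sigma_algebraType C)) => k /= /andP[k0 _].
apply: sub_sigma_algebra; exists k => //.
by exists `]-oo, z k]%classic; [exact: measurable_itv|rewrite setTI].
Qed.

Hypothesis (Yiid : is_iid_exponential beta Y).

Let YE k (B : set R) : (1 <= k)%N -> measurable B -> P (Y k @^-1` B) = exponential_prob beta B.
Proof. by move=> k1 mB; have [_ h] := Yiid; exact: (h k B k1 mB). Qed.

Let F (z : R) : R := fine (exponential_prob beta `]-oo, z]).

Lemma iid_exponential_le M z : Pr P (E M z) = \prod_(1 <= k < M.+1) F (z k).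
Proof.
have [ind _] := Yiid.
pose J : {fset nat} := [fset k in index_iota 1 M.+1]%fset.
have JE k : (k \in J) = (0 < k <= M)%N by rewrite !inE/= mem_index_iota ltnS.
have := ind J (fun k => Y k @^-1` `]-oo, z k]) _ _.
have -> : \bigcap_(k in [set` J]) (Y k @^-1` `]-oo, z k]) = E M z.
  by rewrite EE; congr bigcap; apply/seteqP; split => k /=; rewrite JE.
move=> ->.
- rewrite (perm_big (index_iota 1 M.+1)).
    apply: eq_big_nat => k /andP[k1 _]; rewrite /Pr measurable_mu_extE.
      by congr fine; exact: YE.
    by rewrite -[_ @^-1` _]setTI; apply: measurable_funPT.
  apply: uniq_perm; [exact: fset_uniq|exact: iota_uniq|].
  by move=> k; rewrite JE mem_index_iota ltnS.
- by move=> k /=; rewrite JE => /andP[].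
- move=> k kJ; exists `]-oo, z k]%classic; [exact: measurable_itv|by rewrite setTI].
Qed.

Lemma iid_exponential_ge0 : {ae P, forall w, forall k, (1 <= k)%N -> 0 <= Y k w}.
Proof.
apply/ae_foralln => -[|k]; first exact: aeW.
exists (Y k.+1 @^-1` `]-oo, 0[); split.
- by rewrite -[_ @^-1` _]setTI; apply: measurable_funPT.
- by apply: etrans (YE _ _) (exponential_prob_lt0 beta).
- by move=> w /= h; rewrite in_itv/= ltNge; apply/negP => h'; apply: h.
Qed.

End exponential_facts.

Unset Implicit Arguments.

Theorem proposition5p1 (R : realType) (d : measure_display)
    (T : measurableType d) (P : probability T R)
    (eta lambda p mu beta : R)
    (eta_gt0 : 0 < eta) (eta_lt1 : eta < 1)
    (lambda_gt0 : 0 < lambda) (p_gt0 : 0 < p) (p_lt1 : p < 1)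
    (mu_def : mu = lambda / p) (beta_def : beta = (1 - p) / p)
    (N1 : R -> T -> nat) (Aeta : R -> T -> R)
    (N1_poisson : is_poisson_process P 1 N1)
    (Aeta_stable : is_stable_subordinator P eta Aeta)
    (N1_Aeta_indep :
       independent2 P (process_sigma times N1) (process_sigma times Aeta))
    (Nmu : R -> T -> nat) (Y : nat -> {RV P >-> R})
    (Nmu_poisson : is_poisson_process P mu Nmu)
    (Y_iid : is_iid_exponential beta Y)
    (Nmu_Y_indep :
       independent2 P (process_sigma times Nmu)
         (process_sigma [set k | (1 <= k)%N] (fun k => Y k : T -> R))) :
  let N1eta : R -> T -> nat := time_change N1 Aeta in
  let S : R -> T -> R := compound Nmu Y in
  (forall (nu : R) (A : R -> T -> R), 0 < nu -> nu < 1 ->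
     is_stable_subordinator P nu A ->
     let L := inverse_process A in
     independent3 P (process_sigma times N1eta) (process_sigma times S)
       (process_sigma times L) ->
     let q := pmf_at P (time_change N1eta (time_change S L)) in
     [/\ forall k, caputo_derivable nu (q k),
         forall t : R, 0 < t ->
           caputo nu (q 0%N) t
             = - (1 / beta) * (mu * q 0%N t + caputo nu (q 0%N) t),
         forall (k : nat) (t : R), (1 <= k)%N -> 0 < t ->
           let Dq := fun s => frac_diff eta (q ^~ s) k in
           caputo nu (q k) t = - (1 / beta) * (mu * Dq t + caputo nu Dq t),
         q 0%N 0 = 1
       & forall k : nat, (1 <= k)%N -> q k 0 = 0 ])
  /\
  (forall (nu : R) (A : R -> T -> R), 1 < nu ->
     is_stable_subordinator P (1 / nu) A ->
     independent3 P (process_sigma times N1eta) (process_sigma times S)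
       (process_sigma times A) ->
     let q := pmf_at P (time_change N1eta (time_change S A)) in
     [/\ forall k, riemann_liouville_derivable nu (q k),
         forall t : R, 0 < t ->
           riemann_liouville nu (q 0%N) t
             = 1 / beta * (mu * q 0%N t - riemann_liouville nu (q 0%N) t),
         forall (k : nat) (t : R), (1 <= k)%N -> 0 < t ->
           let Dq := fun s => frac_diff eta (q ^~ s) k in
           riemann_liouville nu (q k) t
             = 1 / beta * (mu * Dq t - riemann_liouville nu Dq t),
         q 0%N 0 = 1
       & forall k : nat, (1 <= k)%N -> q k 0 = 0 ]).
Proof.
have beta0 : 0 < beta by rewrite beta_def divr_gt0// subr_gt0.
have mu0 : 0 < mu by rewrite mu_def divr_gt0.
move=> N1eta S.
have [mN1 PN1 N1rc N10] := poisson_process_facts ltr01 N1_poisson.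
have [mNmu PNmu Nmurc Nmu0] := poisson_process_facts mu0 Nmu_poisson.
have [mA A0 Amono Arc AL] := stable_subordinator_facts Aeta_stable.
(* From here on every event is measured by the completion; the laws, path properties and Laplace
   transforms known under P are transported to it. *)
pose T' : measurableType _ := caratheodory_type (P^*)%mu.
pose Q : probability T' R := @completion _ _ _ P.
have Qc : measure_is_complete Q := @completion_complete _ _ _ P.
have QPr (E : set T) : Q E = (Pr P E)%:E by exact: completion_Pr.
have mset (E : set T) : measurable E -> (measurable : set (set T')) E by exact: measurable_completion.
have mfun (f : T -> R) : measurable_fun setT f -> measurable_fun setT (f : T' -> R).
  exact: measurable_fun_completion.
have aeQ (H : T -> Prop) : {ae P, forall w, H w} -> {ae Q, forall w, H w} by exact: ae_completion.
have iQ (f : T -> R) (c : R) : measurable_fun setT f ->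
    (\int[Q]_w (expR (- (c * f w)))%:E = \int[P]_w (expR (- (c * f w)))%:E)%E.
  move=> mf; apply: integral_completion => //.
  apply: measurableT_comp; first exact: measurable_expR.
  by apply: measurableT_comp => //; apply: measurable_funM.
have mN1' k t : 0 <= t -> (measurable : set (set T')) [set w | N1 t w = k] by move=> t0; exact/mset/mN1.
have PN1' k t : 0 <= t -> Q [set w | N1 t w = k] = (poisson_family k t)%:E.
  by move=> t0; rewrite /= /Q completionE ?PN1 ?mul1r//; exact: mN1.
have mA' t : 0 <= t -> measurable_fun setT (Aeta t : T' -> R) by move=> t0; exact/mfun/mA.
have AL' t th : 0 <= t -> 0 <= th ->
    (\int[Q]_w (expR (- (th * Aeta t w)))%:E = (expR (- (th `^ eta * t)))%:E)%E.
  by move=> t0 th0; rewrite iQ ?AL//; exact: mA.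
have N1A k s t a b : 0 <= s -> 0 <= t ->
    (Q ([set w | N1 s w = k] `&` (Aeta t @^-1` `[a, b[)) =
     Q [set w | N1 s w = k] * Q (Aeta t @^-1` `[a, b[))%E.
  move=> s0 t0; rewrite !QPr -EFinM; congr EFin; apply: independent2P N1_Aeta_indep _ _.
    exact: (@process_sigma_preimage _ _ _ times _ _ N1 s [set k]).
  exact: (@process_sigma_preimage _ _ _ times _ _ Aeta t `[a, b[%classic).
have mNmu' k t : 0 <= t -> (measurable : set (set T')) [set w | Nmu t w = k] by move=> t0; exact/mset/mNmu.
have PNmu' k t : 0 <= t -> Q [set w | Nmu t w = k] = (poisson_family k (mu * t))%:E.
  by move=> t0; rewrite /= /Q completionE ?PNmu//; exact: mNmu.
have mY k : (1 <= k)%N -> measurable_fun setT (Y k : T' -> R).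
  by move=> _; apply: mfun; exact: measurable_funPT.
pose F (z : R) : R := fine (exponential_prob beta `]-oo, z]).
have F0 z : 0 <= F z.
  rewrite fine_ge0//; apply: integral_ge0 => x _.
  by rewrite lee_fin exponential_pdf_ge0// ltW.
have FE (z : R) : 0 < z -> F z = 1 - expR (- (beta * z)).
  by move=> z0; rewrite /F exponential_prob_le.
have NmuY t n M z : 0 <= t ->
    (Q ([set w | Nmu t w = n] `&` [set w | forall k, (0 < k)%N -> (k <= M)%N -> (Y k w <= z k)%R]) =
     Q [set w | Nmu t w = n] * (\prod_(1 <= k < M.+1) F (z k))%:E)%E.
  move=> t0; rewrite !QPr -(iid_exponential_le Y_iid) -EFinM; congr EFin.
  apply: independent2P Nmu_Y_indep _ _; last exact: process_sigma_le.
  exact: (@process_sigma_preimage _ _ _ times _ _ Nmu t [set n]).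
have Y_ge0 := aeQ _ (iid_exponential_ge0 Y_iid).
have ind3 (L : R -> T -> R) :
    independent3 P (process_sigma times N1eta) (process_sigma times S) (process_sigma times L) ->
  forall k s t t' a b a' b', 0 <= s -> 0 <= t -> 0 <= t' ->
  (Q ([set w | N1eta s w = k] `&` (S t @^-1` `[a, b[ `&` L t' @^-1` `[a', b'[)) =
   Q [set w | N1eta s w = k] * (Q (S t @^-1` `[a, b[) * Q (L t' @^-1` `[a', b'[)))%E.
  move=> ind k s t t' a b a' b' s0 t0 t'0; rewrite !QPr -!EFinM; congr EFin.
  apply: independent3P ind _ _ _.
  - exact: (@process_sigma_preimage _ _ _ times _ _ N1eta s [set k]).
  - exact: (@process_sigma_preimage _ _ _ times _ _ S t `[a, b[%classic).
  - exact: (@process_sigma_preimage _ _ _ times _ _ L t' `[a', b'[%classic).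
have ind2 (L : R -> T -> R) :
    independent3 P (process_sigma times N1eta) (process_sigma times S) (process_sigma times L) ->
  forall k s t a b, 0 <= s -> 0 <= t ->
  (Q ([set w | N1eta s w = k] `&` S t @^-1` `[a, b[) =
   Q [set w | N1eta s w = k] * Q (S t @^-1` `[a, b[))%E.
  move=> ind k s t a b s0 t0; rewrite !QPr -EFinM; congr EFin.
  (* Independence of the pair is that of the triple with the sure event in the third place. *)
  have := independent3P (A := [set w | N1eta s w = k]) (B := S t @^-1` `[a, b[) (C := setT) ind.
  rewrite setIT => ->.
  - by congr (_ * _); rewrite -[X in _ * X]/(fine (EFin (Pr P setT))) -QPr probability_setT mulr1.
  - exact: (@process_sigma_preimage _ _ _ times _ _ N1eta s [set k]).
  - exact: (@process_sigma_preimage _ _ _ times _ _ S t `[a, b[%classic).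
  - exact: (@process_sigma_preimage _ _ _ times _ _ L 0 setT (lexx 0) measurableT).
split => [nu A nu0 nu1 A_stable L ind q|nu A nu1 A_stable ind q].
- have [mA2 A20 A2mono _ A2L] := stable_subordinator_facts A_stable.
  have mA2' t : 0 <= t -> measurable_fun setT (A t : T' -> R) by move=> t0; exact/mfun/mA2.
  have A2L' t th : 0 <= t -> 0 <= th ->
      (\int[Q]_w (expR (- (th * A t w)))%:E = (expR (- (th `^ nu * t)))%:E)%E.
    by move=> t0 th0; rewrite iQ ?A2L//; exact: mA2.
  have mL t : 0 <= t -> measurable_fun setT (L t : T' -> R).
    by move=> _; exact: (measurable_inverse_process Qc mA2' (aeQ _ A2mono) A2L').
  have L0 t : 0 <= t -> {ae Q, forall w, 0 <= L t w}.
    by move=> _; apply: aeW => w; exact: inverse_process_ge0.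
  have [cd ceq] := composed_caputo Qc eta_gt0 eta_lt1 mu0 beta0 mN1' PN1' (aeQ _ N1rc) mA'
    (aeQ _ A0) (aeQ _ Amono) (aeQ _ Arc) AL' N1A mNmu' PNmu' (aeQ _ Nmurc) mY F0 FE Y_ge0 NmuY
    mL L0 (ind3 L ind) (ind2 L ind) nu0 nu1 mA2' (aeQ _ A20) (aeQ _ A2mono) A2L' (erefl L).
  have L00 : {ae Q, forall w, L 0 w = 0}.
    exact: (inverse_process0 nu0 mA2' A2L').
  have [q0 qk] := composed_initial Qc (aeQ _ A0) Y L00 (aeQ _ Nmu0) (aeQ _ N10).
  split => //.
  + move=> t t0; have Dq0 : (fun s => frac_diff eta (q ^~ s) 0%N) = q 0%N.
      by apply/funext => s; rewrite frac_diff0.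
    by have := ceq 0%N t t0; rewrite -[X in mu * X]/((fun s => frac_diff eta (q ^~ s) 0%N) t) Dq0.
  + move=> k t _ t0; exact: ceq k t t0.
- have [mA2 A20 A2mono _ A2L] := stable_subordinator_facts A_stable.
  have mA2' t : 0 <= t -> measurable_fun setT (A t : T' -> R) by move=> t0; exact/mfun/mA2.
  have A2L' t th : 0 <= t -> 0 <= th ->
      (\int[Q]_w (expR (- (th * A t w)))%:E = (expR (- (th `^ nu^-1 * t)))%:E)%E.
    by move=> t0 th0; rewrite iQ ?A2L// ?div1r//; exact: mA2.
  have A2ge0 t : 0 <= t -> {ae Q, forall w, 0 <= A t w}.
    by move=> t0; apply: filterS (stable_ge0 (aeQ _ A20) (aeQ _ A2mono)) => w; exact.
  have [cd ceq] := composed_riemann_liouville Qc eta_gt0 eta_lt1 mu0 beta0 mN1' PN1' (aeQ _ N1rc) mA'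
    (aeQ _ A0) (aeQ _ Amono) (aeQ _ Arc) AL' N1A mNmu' PNmu' (aeQ _ Nmurc) mY F0 FE Y_ge0 NmuY
    mA2' A2ge0 (ind3 A ind) (ind2 A ind) nu1 A2L'.
  have [q0 qk] := composed_initial Qc (aeQ _ A0) Y (aeQ _ A20) (aeQ _ Nmu0) (aeQ _ N10).
  split => //.
  + move=> t t0; have Dq0 : (fun s => frac_diff eta (q ^~ s) 0%N) = q 0%N.
      by apply/funext => s; rewrite frac_diff0.
    by have := ceq 0%N t t0; rewrite -[X in mu * X]/((fun s => frac_diff eta (q ^~ s) 0%N) t) Dq0.
  + move=> k t _ t0; exact: ceq k t t0.
Qed.
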